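(* Let $\xi_0\in\mathbb R$, $w\in\mathbb C$, and for $i=0,1$ let $$a_i=a_{i-}H(\xi_0-x)+a_{i+}H(x-\xi_0)+\sum_{j=0}^1A_{ij}\delta^{(j)}_{\xi_0},\qquad b_i=b_{i-}H(\xi_0-x)+b_{i+}H(x-\xi_0)+\sum_{j=0}^3B_{ij}\delta^{(j)}_{\xi_0},$$ where $a_{i\pm},b_{i\pm}\in\mathcal C^\infty(\mathbb R)$ and $A_{ij},B_{ij}\in\mathbb C$. Set $a=a_{0-}+a_{1+}$, $a_\pm=a_{0\pm}+a_{1\pm}$, $b_\pm=b_{0\pm}+b_{1\pm}$, and assume (C1'') $a(\xi_0)\neq0$; (C2'') $a_\pm(x)\neq0$ for all $x\in\mathbb R$. Then every solution $\phi$ of the ODE $$\sum_{i=0}^{2}\binom{2}{i}\left(a_0^{(i)}*\phi^{(4-i)}+\phi^{(4-i)}*a_1^{(i)}\right)-w^2\left(b_0*\phi+\phi*b_1\right)=0$$ is of the form $$\phi(x)=H(\xi_0-x)\phi_1(x)+H(x-\xi_0)\phi_2(x),$$ where $\phi_1,\phi_2\in\mathcal C^\infty(\mathbb R)$ satisfy $$\sum_{i=0}^{2}\binom{2}{i}a_-^{(i)}\phi_1^{(4-i)}-w^2b_-\phi_1=0\ \text{ on }(-\infty,\xi_0],\qquad \sum_{i=0}^{2}\binom{2}{i}a_+^{(i)}\phi_2^{(4-i)}-w^2b_+\phi_2=0\ \text{ on }[\xi_0,+\infty).$$ Moreover, at $\xi_0$ the solutions satisfy the interface condition $$\mathbf A(\xi_0)\,\overline{\phi_1(\xi_0)}=\mathbf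 B(\xi_0)\,\overline{\phi_2(\xi_0)},$$ where $\overline{\phi_i}=(\phi_i,\phi_i',\phi_i'',\phi_i''')^T$, $i=1,2$, and $$\mathbf A=\begin{pmatrix}B_{10}w^2&-B_{11}w^2&a_-'+B_{12}w^2&a_--B_{13}w^2\\ B_{11}w^2&-2B_{12}w^2&a_-+3B_{13}w^2&0\\ -a'+B_{12}w^2&a-3B_{13}w^2&-A_{10}&A_{11}\\ a+B_{13}w^2&0&-A_{11}&0\end{pmatrix},$$ $$\mathbf B=\begin{pmatrix}-B_{00}w^2&B_{01}w^2&a_+'-B_{02}w^2&a_++B_{03}w^2\\ -B_{01}w^2&2B_{02}w^2&a_+-3B_{03}w^2&0\\ -a'-B_{02}w^2&a+3B_{03}w^2&A_{00}&-A_{01}\\ a-B_{03}w^2&0&A_{01}&0\end{pmatrix}.$$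
   Context: All functions and distributions are complex valued and all derivatives are distributional. $\mathcal D'$ is the space of Schwartz distributions on $\mathbb R$; locally integrable functions are identified with the associated regular distributions. $H$ is the Heaviside step function and $\delta_{x_0}$ the Dirac measure at $x_0$. $\mathcal C_p^\infty$ is the space of functions on $\mathbb R$ that are smooth except on a finite set of points, where they and all their derivatives have finite left and right limits. $\mathcal A\subset\mathcal D'$ is the space of all functions in $\mathcal C_p^\infty$, regarded as distributions, together with all their distributional derivatives of all orders. Equivalently, $F\in\mathcal A$ iff there are points $x_1<\dots<x_m$ such that, with $x_0=-\infty$, $x_{m+1}=+\infty$, $\Omega_i=(x_i,x_{i+1})$ and $\chi_{\Omega_i}$ the characteristic function of $\Omega_i$, $F=\sum_{i=1}^m\sum_{j=0}^n c_{ij}\delta^{(j)}_{x_i}+\sum_{i=0}^m f_i\chi_{\Omega_i}$ with $c_{ij}\in\mathbb C$ and $f_i\in\mathcal C^\infty(\mathbb R)$. Product $*$: for $F,G\in\mathcal A$, $F*G=\lim_{\epsilon\downarrow0}F(x)\cdot G(x+\epsilon)$ in the distributional sense, where for small $\epsilon>0$ the two factors have disjoint singular supports and $\cdot$ is the Hörmander product (locally, the product of a distribution by a smooth function). Explicitly, if $F=\sum_{i=1}^m\sum_{j=0}^n c_{ij}\delta^{(j)}_{x_i}+\sum_{i=0}^m f_i\chi_{\Omega_i}$ and $G=\sum_{i=1}^m\sum_{j=0}^n d_{ij}\delta^{(j)}_{x_i}+\sum_{i=0}^m g_i\chi_{\Omega_i}$ (same points for both, $f_i,g_i\in\mathcal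 C^\infty(\mathbb R)$), then $$F*G=\sum_{i=1}^m\sum_{j=0}^n\left[c_{ij}g_i+d_{ij}f_{i-1}\right]\delta^{(j)}_{x_i}+\sum_{i=0}^m f_ig_i\chi_{\Omega_i}\in\mathcal A .$$ A solution of the ODE is a $\phi\in\mathcal A$ satisfying it in the sense of distributions on $\mathbb R$. *)

(* Defs.v *)
From Stdlib Require Import Reals Lra Lia List.
From Coquelicot Require Import Coquelicot.

Open Scope R_scope.

(** Meaningful only where the derivatives exist ([Derive_n] is total). *)
Definition Cderive_n (f : R -> C) (n : nat) (x : R) : C :=
  (Derive_n (fun t => Re (f t)) n x, Derive_n (fun t => Im (f t)) n x).

Definition ex_Cderive_n (f : R -> C) (n : nat) (x : R) : Prop :=
  ex_derive_n (fun t => Re (f t)) n x /\ ex_derive_n (fun t => Im (f t)) n x.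

Definition smooth (f : R -> C) : Prop := forall n x, ex_Cderive_n f n x.

Record smoothfun := SmoothFun {
  sf_fun :> R -> C;
  sf_smooth : smooth sf_fun
}.

Record testfun := TestFun {
  tf_fun :> smoothfun;
  tf_compact : exists K : R, forall x, K < Rabs x -> tf_fun x = RtoC 0
}.

Lemma ex_derive_n_Derive (f : R -> R) (n : nat) (x : R) :
  ex_derive_n f (S n) x -> ex_derive_n (Derive f) n x.
Proof.
  destruct n as [|n]; [easy|].
  simpl. intros H. apply ex_derive_ext with (2 := H).
  intros t. change (Derive_n f (S n) t = Derive_n (Derive_n f 1) n t).
  rewrite Derive_n_comp. now rewrite Nat.add_1_r.
Qed.

Lemma ex_derive_n_of_Derive (f : R -> R) (n : nat) (x : R) :
  ex_derive f x -> ex_derive_n (Derive f) n x -> ex_derive_n f (S n) x.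
Proof.
  destruct n as [|n]; [easy|].
  simpl. intros _ H. apply ex_derive_ext with (2 := H).
  intros t. change (Derive_n (Derive_n f 1) n t = Derive_n f (S n) t).
  rewrite Derive_n_comp. now rewrite Nat.add_1_r.
Qed.

Lemma ex_derive_n_mult_all (n : nat) : forall f g : R -> R,
  (forall k x, ex_derive_n f k x) -> (forall k x, ex_derive_n g k x) ->
  forall k x, (k <= n)%nat -> ex_derive_n (fun t => f t * g t) k x.
Proof.
  induction n as [|n IH]; intros f g Hf Hg k x Hk.
  - now replace k with 0%nat by lia.
  - destruct k as [|k]; [easy|].
    assert (Df : forall j y, ex_derive_n (Derive f) j y)
      by (intros j y; apply ex_derive_n_Derive, Hf).
    assert (Dg : forall j y, ex_derive_n (Derive g) j y)
      by (intros j y; apply ex_derive_n_Derive, Hg).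
    apply ex_derive_n_of_Derive.
    + apply (ex_derive_mult f g x); [apply (Hf 1%nat) | apply (Hg 1%nat)].
    + apply ex_derive_n_ext with (fun t => Derive f t * g t + f t * Derive g t).
      * intros t. symmetry.
        apply Derive_mult; [apply (Hf 1%nat) | apply (Hg 1%nat)].
      * apply ex_derive_n_plus; apply filter_forall; intros y j Hj;
          apply IH; auto; lia.
Qed.

Lemma smooth_mult (f g : R -> C) :
  smooth f -> smooth g -> smooth (fun x => Cmult (f x) (g x)).
Proof.
  intros Hf Hg n x.
  assert (M : forall u v : R -> R, (forall k y, ex_derive_n u k y) ->
    (forall k y, ex_derive_n v k y) ->
    forall k y, ex_derive_n (fun t => u t * v t) k y)
    by (intros u v Hu Hv k y; apply ex_derive_n_mult_all with k; auto).
  split; simpl; [apply ex_derive_n_minus | apply ex_derive_n_plus];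
    apply filter_forall; intros y k _; apply M; intros j z;
    solve [apply Hf | apply Hg].
Qed.

Lemma smooth_derive (f : R -> C) : smooth f -> smooth (Cderive_n f 1).
Proof.
  intros Hf n x; split; apply ex_derive_n_Derive, Hf.
Qed.

Lemma smooth_translate (f : R -> C) (e : R) :
  smooth f -> smooth (fun x => f (x + e)).
Proof.
  intros Hf n x; split.
  - apply (ex_derive_n_comp_trans (fun t => Re (f t))), Hf.
  - apply (ex_derive_n_comp_trans (fun t => Im (f t))), Hf.
Qed.

Lemma compact_mult (f : R -> C) (psi : testfun) :
  exists K, forall x, K < Rabs x -> Cmult (f x) (psi x) = RtoC 0.
Proof.
  destruct (tf_compact psi) as [K HK]. exists K. intros x Hx.
  rewrite (HK x Hx). apply Cmult_0_r.
Qed.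

Lemma compact_derive (psi : testfun) :
  exists K, forall x, K < Rabs x -> Cderive_n psi 1 x = RtoC 0.
Proof.
  destruct (tf_compact psi) as [K HK]. exists K. intros x Hx.
  assert (L : locally x (fun t => psi t = RtoC 0)).
  { apply locally_open with (D := fun t => K < Rabs t); auto.
    apply open_comp with (f := Rabs) (D := fun t => K < t).
    - intros y _. apply (continuous_Rabs y).
    - apply open_gt. }
  unfold Cderive_n, RtoC. f_equal.
  - rewrite (Derive_n_ext_loc _ (fun _ => 0)).
    + apply (Derive_n_const 0 0).
    + revert L. apply filter_imp. now intros t ->.
  - rewrite (Derive_n_ext_loc _ (fun _ => 0)).
    + apply (Derive_n_const 0 0).
    + revert L. apply filter_imp. now intros t ->.
Qed.

Lemma compact_translate (psi : testfun) (e : R) :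
  exists K, forall x, K < Rabs x -> psi (x + e) = RtoC 0.
Proof.
  destruct (tf_compact psi) as [K HK]. exists (K + Rabs e). intros x Hx.
  apply HK. generalize (Rabs_triang (x + e) (- e)).
  replace (x + e + - e) with x by ring. rewrite Rabs_Ropp. lra.
Qed.

Definition test_mult (f : smoothfun) (psi : testfun) : testfun :=
  TestFun (SmoothFun _ (smooth_mult f psi (sf_smooth f) (sf_smooth psi)))
    (compact_mult f psi).

Definition test_derive (psi : testfun) : testfun :=
  TestFun (SmoothFun _ (smooth_derive psi (sf_smooth psi)))
    (compact_derive psi).

Definition test_translate (e : R) (psi : testfun) : testfun :=
  TestFun (SmoothFun _ (smooth_translate psi e (sf_smooth psi)))
    (compact_translate psi e).

Definition supported (psi : testfun) (c d : R) : Prop :=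
  forall x, x < c \/ d < x -> psi x = RtoC 0.

(** The operations below are defined on arbitrary functionals; those that are
    elements of D' are singled out by [is_distribution].  Equality of
    distributions is pointwise equality on test functions. *)
Definition functional := testfun -> C.

(** Linearity, and on each compact interval an estimate by finitely many of the
    seminorms [sup |psi^(j)|]. *)
Definition is_distribution (F : functional) : Prop :=
  (forall (l m : C) (phi psi chi : testfun),
     (forall x, chi x = Cplus (Cmult l (phi x)) (Cmult m (psi x))) ->
     F chi = Cplus (Cmult l (F phi)) (Cmult m (F psi))) /\
  (forall K : R, exists (N : nat) (c : R),
     forall (psi : testfun) (M : R),
       supported psi (- K) K ->
       (forall j x, (j <= N)%nat -> Cmod (Cderive_n psi j x) <= M) ->
       Cmod (F psi) <= c * M).

Definition regular (f : R -> C) : functional := fun psi =>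
  RInt_gen (V := C_R_CompleteNormedModule) (fun x => Cmult (f x) (psi x))
    (Rbar_locally m_infty) (Rbar_locally p_infty).

Definition dirac (x0 : R) : functional := fun psi => psi x0.

Definition deriv (F : functional) : functional := fun psi =>
  Copp (F (test_derive psi)).

Fixpoint deriv_n (n : nat) (F : functional) : functional :=
  match n with
  | O => F
  | S k => deriv (deriv_n k F)
  end.

Definition smooth_times (f : smoothfun) (F : functional) : functional :=
  fun psi => F (test_mult f psi).

(** The distribution [F(x + e)]. *)
Definition translate (e : R) (F : functional) : functional := fun psi =>
  F (test_translate (- e) psi).

Definition eq_on (c d : R) (F G : functional) : Prop :=
  forall (psi : testfun) (c' d' : R),
    c < c' -> d' < d -> supported psi c' d' -> F psi = G psi.

Definition in_sing_supp (F : functional) (x : R) : Prop :=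
  ~ exists (c d : R) (f : smoothfun), c < x < d /\ eq_on c d F (regular f).

(** [P] is the Hörmander product of two distributions [F], [G] with disjoint
    singular supports: wherever one of the factors is a smooth function, [P] is
    the product of the other factor by that function. *)
Definition is_hormander_product (F G P : functional) : Prop :=
  is_distribution P /\
  (forall x, ~ (in_sing_supp F x /\ in_sing_supp G x)) /\
  (forall (c d : R) (f : smoothfun),
     eq_on c d F (regular f) -> eq_on c d P (smooth_times f G)) /\
  (forall (c d : R) (g : smoothfun),
     eq_on c d G (regular g) -> eq_on c d P (smooth_times g F)).

(** [P = F * G], the distributional limit of [F(x) . G(x + e)] as [e] decreases
    to [0]. *)
Definition is_star (F G P : functional) : Prop :=
  is_distribution P /\
  exists Pe : R -> functional,
    at_right 0 (fun e => is_hormander_product F (translate e G) (Pe e)) /\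
    forall psi : testfun,
      filterlim (fun e => Pe e psi) (at_right 0)
        (locally (T := C_UniformSpace) (P psi)).

Definition Cp_infty (f : R -> C) : Prop :=
  exists s : list R,
    (forall x, ~ In x s -> forall n, ex_Cderive_n f n x) /\
    (forall x, In x s -> forall n, exists l r : C,
       filterlim (Cderive_n f n) (at_left x)
         (locally (T := C_UniformSpace) l) /\
       filterlim (Cderive_n f n) (at_right x)
         (locally (T := C_UniformSpace) r)).

Definition in_A (F : functional) : Prop :=
  exists (k : nat) (f : R -> C),
    Cp_infty f /\ forall psi : testfun, F psi = deriv_n k (regular f) psi.

(** The value at [0] is irrelevant for the associated distribution. *)
Definition heaviside (x : R) : C := if Rlt_dec 0 x then RtoC 1 else RtoC 0.

(** [fm(x) H(x0 - x) + fp(x) H(x - x0)] *)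
Definition glue (x0 : R) (fm fp : R -> C) (x : R) : C :=
  Cplus (Cmult (fm x) (heaviside (x0 - x))) (Cmult (fp x) (heaviside (x - x0))).

(** [fm H(x0 - x) + fp H(x - x0) + sum_(0 <= j <= n) c j delta_x0^(j)];
    note that [sum_n _ n] has [n + 1] terms. *)
Definition coefficient (x0 : R) (fm fp : R -> C) (n : nat) (c : nat -> C)
  : functional := fun psi =>
  Cplus (regular (glue x0 fm fp) psi)
    (sum_n (G := C_AbelianMonoid)
       (fun j => Cmult (c j) (deriv_n j (dirac x0) psi)) n).

Definition binom (n k : nat) : C := RtoC (Binomial.C n k).

(** [phi] in A solves
    [sum_i binom(2,i) (a0^(i) * phi^(4-i) + phi^(4-i) * a1^(i))
       - w^2 (b0 * phi + phi * b1) = 0];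
    [P i], [Q i], [S0], [S1] are the values of the products involved. *)
Definition is_solution (w : C) (a0 a1 b0 b1 phi : functional) : Prop :=
  in_A phi /\
  exists (P Q : nat -> functional) (S0 S1 : functional),
    (forall i, (i <= 2)%nat ->
       is_star (deriv_n i a0) (deriv_n (4 - i) phi) (P i) /\
       is_star (deriv_n (4 - i) phi) (deriv_n i a1) (Q i)) /\
    is_star b0 phi S0 /\
    is_star phi b1 S1 /\
    forall psi : testfun,
      Cminus
        (sum_n (G := C_AbelianMonoid)
           (fun i => Cmult (binom 2 i) (Cplus (P i psi) (Q i psi))) 2)
        (Cmult (Cpow w 2) (Cplus (S0 psi) (S1 psi))) = RtoC 0.

(** Left-hand side, at [x], of
    [sum_i binom(2,i) a^(i) u^(4-i) - w^2 b u = 0]. *)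
Definition classical_ode (w : C) (a b u : R -> C) (x : R) : C :=
  Cminus
    (sum_n (G := C_AbelianMonoid)
       (fun i => Cmult (binom 2 i)
                   (Cmult (Cderive_n a i x) (Cderive_n u (4 - i) x))) 2)
    (Cmult (Cmult (Cpow w 2) (b x)) (u x)).

(** The column vector [(u, u', u'', u''')^T] at [x]. *)
Definition jet (u : R -> C) (x : R) : matrix (T := C) 4 1 :=
  [ [ u x ], [ Cderive_n u 1 x ], [ Cderive_n u 2 x ], [ Cderive_n u 3 x ] ].

Open Scope C_scope.

(** The interface matrices; [a], [am], [ap] are the functions a, a_-, a_+. *)
Definition matA (w : C) (a am : R -> C) (A B : nat -> nat -> C) (x : R)
  : matrix (T := C) 4 4 :=
  [ [ B 1%nat 0%nat * w ^ 2, - (B 1%nat 1%nat * w ^ 2),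
      Cderive_n am 1 x + B 1%nat 2%nat * w ^ 2,
      am x - B 1%nat 3%nat * w ^ 2 ],
    [ B 1%nat 1%nat * w ^ 2, - (2 * B 1%nat 2%nat * w ^ 2),
      am x + 3 * B 1%nat 3%nat * w ^ 2,
      RtoC 0 ],
    [ - Cderive_n a 1 x + B 1%nat 2%nat * w ^ 2,
      a x - 3 * B 1%nat 3%nat * w ^ 2,
      - A 1%nat 0%nat,
      A 1%nat 1%nat ],
    [ a x + B 1%nat 3%nat * w ^ 2,
      RtoC 0,
      - A 1%nat 1%nat,
      RtoC 0 ] ].

Definition matB (w : C) (a ap : R -> C) (A B : nat -> nat -> C) (x : R)
  : matrix (T := C) 4 4 :=
  [ [ - (B 0%nat 0%nat * w ^ 2), B 0%nat 1%nat * w ^ 2,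
      Cderive_n ap 1 x - B 0%nat 2%nat * w ^ 2,
      ap x + B 0%nat 3%nat * w ^ 2 ],
    [ - (B 0%nat 1%nat * w ^ 2), 2 * B 0%nat 2%nat * w ^ 2,
      ap x - 3 * B 0%nat 3%nat * w ^ 2,
      RtoC 0 ],
    [ - Cderive_n a 1 x - B 0%nat 2%nat * w ^ 2,
      a x + 3 * B 0%nat 3%nat * w ^ 2,
      A 0%nat 0%nat,
      - A 0%nat 1%nat ],
    [ a x - B 0%nat 3%nat * w ^ 2,
      RtoC 0,
      A 0%nat 1%nat,
      RtoC 0 ] ].

Close Scope C_scope.

(* Main.v *)
(** Near every point [p] an element of A has the form [u H(p - x) + v H(x - p)
    + sum c_j delta_p^(j)] with [u], [v] smooth on the whole line (Borel's lemma
    extends the one-sided germs), and the product [F * G] can be computed from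
    such local forms by cutting a test function between the singularities of
    [F] and of [G(x + e)].  Applied to the equation at [p], the coefficient of
    [delta^(l+4)] forces [c_l = 0], the regular part gives the two ordinary
    differential equations, and the coefficients of [delta^(3), ..., delta]
    are the four interface conditions.  At [p <> xi0] the coefficients are
    smooth, so the same four conditions say that [u] and [v] have equal jets of
    order 3; by the differential equation all their derivatives agree and the
    solution is smooth there.  The local pieces are patched by a partition of
    unity. *)
Require Import Defs.
From Stdlib Require Import Reals Arith Lra Lia List.
From Stdlib Require Import Classical ClassicalEpsilon FunctionalExtensionality.
From Coquelicot Require Import Coquelicot.
Open Scope R_scope.

(** [is_star] is a relation: a limit of products that are characterised only locally. Its explicit
    formula has to be derived first. The shift by e > 0 moves the singularity of the second factor
    to p - e. So the Dirac terms of F at p meet the right germ of G, those of G meet the left germ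
    of F, and the strip between p - e and p disappears in the limit. Condition (C1'') comes from
    here: Dirac terms of phi at xi0 are multiplied by the left germ of a_0 in the first product and
    by the right germ of a_1 in the second. At other points both germs of a coefficient agree and
    the same factor is a_- or a_+, nonzero by (C2'').

    The local analysis is done once, for arbitrary germs and Dirac coefficients at p. It serves at
    xi0 with the given data, and elsewhere with equal germs and zero Dirac coefficients. The germs
    [u], [v] are global smooth functions whose values on the wrong side of p carry no information,
    so each solves its equation on one side only and comparisons at p go through jets. *)

Ltac minmax := unfold Rmin, Rmax in *; repeat destruct Rle_dec; try lra.

(** * Smooth real functions and their gluing at a point *)

Definition rsmooth (f : R -> R) : Prop := forall n x, ex_derive_n f n x.

Lemma locally_Ioo (P : R -> Prop) (x a b : R) :
  a < x < b -> (forall y, a < y < b -> P y) -> locally x P.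
Proof.
  intros Hx H. apply locally_open with (D := fun y => a < y < b); auto.
  apply open_and; [apply open_gt | apply open_lt].
Qed.

Lemma Derive_n_S_comm (f : R -> R) (n : nat) (x : R) :
  Derive_n f (S n) x = Derive_n (Derive f) n x.
Proof.
  change (Derive_n f (S n) x = Derive_n (Derive_n f 1) n x).
  rewrite Derive_n_comp. now rewrite Nat.add_1_r.
Qed.

Lemma rsmooth_ext (f g : R -> R) : (forall x, f x = g x) -> rsmooth f -> rsmooth g.
Proof. intros E H n x. apply ex_derive_n_ext with f; auto. Qed.

Lemma rsmooth_Derive (f : R -> R) : rsmooth f -> rsmooth (Derive f).
Proof. intros H n x. apply ex_derive_n_Derive, H. Qed.

Lemma rsmooth_Derive_n (f : R -> R) (k : nat) : rsmooth f -> rsmooth (Derive_n f k).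
Proof.
  induction k as [|k IH]; intros H; [exact H|].
  apply (rsmooth_Derive _ (IH H)).
Qed.

Lemma rsmooth_is_derive_n (f : R -> R) (n : nat) (x : R) :
  rsmooth f -> is_derive (Derive_n f n) x (Derive_n f (S n) x).
Proof. intros H. apply Derive_correct, (H (S n)). Qed.

Lemma rsmooth_continuous (f : R -> R) (x : R) : rsmooth f -> continuous f x.
Proof. intros H. apply (ex_derive_continuous (V := R_NormedModule)). apply (H 1%nat). Qed.

Lemma rsmooth_of_derive (f g : R -> R) :
  (forall x, is_derive f x (g x)) -> rsmooth g -> rsmooth f.
Proof.
  intros D H n x. destruct n as [|n]; [easy|].
  apply ex_derive_n_of_Derive; [now exists (g x)|].
  apply ex_derive_n_ext with g; auto.
  intros t. symmetry. now apply is_derive_unique.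
Qed.

Lemma rsmooth_const (c : R) : rsmooth (fun _ => c).
Proof. intros n x. apply ex_derive_n_const. Qed.

Lemma rsmooth_id : rsmooth (fun x => x).
Proof.
  apply rsmooth_of_derive with (fun _ => 1); [|apply rsmooth_const].
  intros x. apply (is_derive_id x).
Qed.

Lemma rsmooth_plus (f g : R -> R) : rsmooth f -> rsmooth g -> rsmooth (fun x => f x + g x).
Proof.
  intros Hf Hg n x. apply ex_derive_n_plus; apply filter_forall; intros; [apply Hf | apply Hg].
Qed.

Lemma rsmooth_mult (f g : R -> R) : rsmooth f -> rsmooth g -> rsmooth (fun x => f x * g x).
Proof. intros Hf Hg n x. apply ex_derive_n_mult_all with n; auto. Qed.

Lemma rsmooth_opp (f : R -> R) : rsmooth f -> rsmooth (fun x => - f x).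
Proof. intros Hf n x. apply ex_derive_n_opp, Hf. Qed.

Lemma rsmooth_affine (f : R -> R) (a b : R) : rsmooth f -> rsmooth (fun x => f (a * x + b)).
Proof.
  intros Hf n x.
  apply (ex_derive_n_comp_scal (fun y => f (y + b))).
  apply filter_forall. intros y k _. apply ex_derive_n_comp_trans, Hf.
Qed.

Lemma rsmooth_pow (n : nat) (p : R) : rsmooth (fun x => (x - p) ^ n).
Proof.
  induction n as [|n IH]; simpl; [apply rsmooth_const|].
  apply rsmooth_mult; auto.
  apply (rsmooth_plus (fun x => x) (fun _ => - p)); [apply rsmooth_id | apply rsmooth_const].
Qed.

(* By the mean value theorem a difference quotient at [p] is a value of the
   derivative at a nearby point. *)
Lemma is_derive_of_continuous (h k : R -> R) (p r : R) : 0 < r ->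
  (forall x, p - r < x < p + r -> x <> p -> is_derive h x (k x)) ->
  continuous h p -> continuous k p -> is_derive h p (k p).
Proof.
  intros Hr Hd Hc Hk.
  apply is_derive_Reals. intros eps He.
  destruct (proj1 (filterlim_locally k (k p)) Hk (mkposreal eps He)) as [d Hdl].
  assert (Hm : 0 < Rmin d r) by (apply Rmin_glb_lt; [apply cond_pos | lra]).
  exists (mkposreal _ Hm). intros y Hy Hyd. simpl in Hyd.
  assert (Hyd1 : Rabs y < d) by (apply Rlt_le_trans with (1 := Hyd), Rmin_l).
  assert (Hyd2 : Rabs y < r) by (apply Rlt_le_trans with (1 := Hyd), Rmin_r).
  apply Rabs_lt_between in Hyd2.
  assert (Hcp : forall x, p - r < x < p + r -> continuity_pt h x).
  { intros x Hx. apply continuity_pt_filterlim. destruct (Req_dec x p) as [->|N]; auto.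
    apply (ex_derive_continuous (V := R_NormedModule)). exists (k x). now apply Hd. }
  destruct (MVT_gen h p (p + y) k) as [c [H1 H2]].
  - intros x Hx. apply Hd; minmax.
  - intros x Hx. apply Hcp; minmax.
  - rewrite H2. replace (k c * (p + y - p) / y - k p) with (k c - k p) by (field; auto).
    apply (Hdl c). change (Rabs (c - p) < d). apply Rabs_lt_between in Hyd1.
    apply Rabs_lt_between. minmax.
Qed.

(** Proposing all derivatives at once turns smoothness into first-order statements. This suits
    functions whose iterated [Derive_n] is awkward to reach, such as piecewise functions and limits
    of series. *)
Lemma rsmooth_family (H : nat -> R -> R) :
  (forall n x, is_derive (H n) x (H (S n) x)) ->
  rsmooth (H 0%nat) /\ forall n x, Derive_n (H 0%nat) n x = H n x.
Proof.
  intros HD.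
  assert (E : forall n x, Derive_n (H 0%nat) n x = H n x).
  { induction n as [|n IH]; intros x; [reflexivity|].
    simpl. rewrite (Derive_ext _ _ _ IH). now apply is_derive_unique. }
  split; auto.
  intros [|n] x; [easy|]. simpl. apply ex_derive_ext with (H n); [now intros t; rewrite E|].
  eexists; apply HD.
Qed.

(** At the exceptional point continuity of each member suffices, by the mean value argument of
    [is_derive_of_continuous]. *)
Lemma is_derive_family (H : nat -> R -> R) (p : R) :
  (forall n x, x <> p -> is_derive (H n) x (H (S n) x)) ->
  (forall n, continuous (H n) p) ->
  forall n x, is_derive (H n) x (H (S n) x).
Proof.
  intros HD HC n x. destruct (Req_dec x p) as [->|N]; auto.
  apply (is_derive_of_continuous (H n) (H (S n)) p 1); auto; lra.
Qed.

Lemma continuous_piecewise (u v : R -> R) (p : R) :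
  filterlim u (at_left p) (locally (v p)) -> continuous v p ->
  continuous (fun x => if Rlt_dec x p then u x else v x) p.
Proof.
  intros Hu Hv. unfold continuous. destruct (Rlt_dec p p); [lra|].
  intros P HP. specialize (Hu P HP). specialize (Hv P HP).
  unfold filtermap, at_left, within in *.
  generalize (filter_and _ _ Hu Hv). apply filter_imp.
  intros x [H1 H2]. destruct (Rlt_dec x p); auto.
Qed.

Lemma is_derive_piecewise (u v : R -> R) (p x lu lv : R) :
  (x < p -> is_derive u x lu) -> (p < x -> is_derive v x lv) -> x <> p ->
  is_derive (fun x => if Rlt_dec x p then u x else v x) x (if Rlt_dec x p then lu else lv).
Proof.
  intros Hu Hv N. destruct (Rlt_dec x p) as [L|L].
  - apply is_derive_ext_loc with u; auto. apply locally_Ioo with (x - 1) p; [lra|].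
    intros y Hy. destruct (Rlt_dec y p); lra.
  - apply is_derive_ext_loc with v; [|apply Hv; lra].
    apply locally_Ioo with p (x + 1); [lra|].
    intros y Hy. destruct (Rlt_dec y p); lra.
Qed.

Lemma rsmooth_piecewise (u v : R -> R) (p : R) :
  (forall n x, x < p -> ex_derive_n u n x) ->
  (forall n, filterlim (Derive_n u n) (at_left p) (locally (Derive_n v n p))) ->
  rsmooth v -> rsmooth (fun x => if Rlt_dec x p then u x else v x).
Proof.
  intros Hu Hl Hv.
  apply (rsmooth_family (fun n x => if Rlt_dec x p then Derive_n u n x else Derive_n v n x)).
  apply is_derive_family with p.
  - intros n x N. apply is_derive_piecewise; auto; intros L; apply Derive_correct.
    + apply (Hu (S n) x L).
    + apply (Hv (S n)).
  - intros n. apply continuous_piecewise; auto.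
    apply rsmooth_continuous, rsmooth_Derive_n, Hv.
Qed.

(** * Cutoff functions *)

(** With M = m + 1, raise y/M < exp(y/M) to the power m and use m y/M < y. *)
Lemma pow_exp_bound (m : nat) (y : R) : 0 < y -> y ^ m * exp (- y) <= INR (S m) ^ m.
Proof.
  intros Hy. set (M := INR (S m)).
  assert (HM : 1 <= M) by (unfold M; rewrite S_INR; generalize (pos_INR m); lra).
  assert (H1 : y / M < exp (y / M)) by (generalize (exp_ineq1_le (y / M)); lra).
  assert (H0 : 0 < y / M) by (apply Rdiv_lt_0_compat; lra).
  assert (H2 : (y / M) ^ m <= exp (y / M) ^ m) by (apply pow_incr; lra).
  assert (E : forall k, exp (y / M) ^ k = exp (INR k * (y / M))).
  { induction k as [|k IH]; [simpl; now rewrite Rmult_0_l, exp_0|].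
    rewrite S_INR. simpl. rewrite IH, <- exp_plus. f_equal. ring. }
  assert (H3 : exp (y / M) ^ m <= exp y).
  { rewrite E.
    assert (INR m * (y / M) < y).
    { replace y with (M * (y / M)) at 2 by (field; lra).
      apply Rmult_lt_compat_r; auto. unfold M; rewrite S_INR; lra. }
    apply Rlt_le, exp_increasing; auto. }
  replace (y ^ m) with (M ^ m * (y / M) ^ m)
    by (rewrite <- Rpow_mult_distr; f_equal; field; lra).
  rewrite exp_Ropp. generalize (exp_pos y); intros He.
  apply Rmult_le_reg_r with (exp y); auto.
  rewrite Rmult_assoc, Rinv_l, Rmult_1_r by lra.
  apply Rmult_le_compat_l; [apply pow_le; lra | lra].
Qed.

(** The case k = 0 is the classical flat function. The powers of 1/x are included because the
    derivative of each member is a combination of later members, so that smoothness follows by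
    induction on the order for all k together. *)
Definition flat_exp (k : nat) (x : R) : R :=
  if Rlt_dec 0 x then (/ x) ^ k * exp (- / x) else 0.

Lemma flat_exp_continuous_0 (k : nat) : continuous (flat_exp k) 0.
Proof.
  assert (H0 : flat_exp k 0 = 0) by (unfold flat_exp; destruct (Rlt_dec 0 0); lra).
  apply filterlim_locally. intros eps. rewrite H0.
  (* The bound is used with one power more than needed, k + 1, which leaves a factor x tending to
     0. *)
  set (M := INR (S (S k)) ^ S k).
  assert (HM : 0 < M) by (apply pow_lt, lt_0_INR; lia).
  assert (Hd : 0 < eps / M) by (apply Rdiv_lt_0_compat; auto; apply cond_pos).
  exists (mkposreal _ Hd). intros x Hx. change (Rabs (x - 0) < eps / M) in Hx.
  change (Rabs (flat_exp k x - 0) < eps). rewrite Rminus_0_r in *.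
  unfold flat_exp. destruct (Rlt_dec 0 x) as [L|L].
  - rewrite Rabs_right in Hx by lra.
    assert (Hi : 0 < / x) by now apply Rinv_0_lt_compat.
    generalize (pow_exp_bound (S k) (/ x) Hi). fold M. simpl (_ ^ S k). intros B.
    rewrite Rabs_right by (apply Rle_ge, Rmult_le_pos; [apply pow_le; lra | apply Rlt_le, exp_pos]).
    apply Rle_lt_trans with (x * M).
    + replace ((/ x) ^ k * exp (- / x)) with (x * (/ x * (/ x) ^ k * exp (- / x))) by (field; lra).
      apply Rmult_le_compat_l; lra.
    + apply Rmult_lt_reg_r with (/ M); [now apply Rinv_0_lt_compat|].
      rewrite Rmult_assoc, Rinv_r, Rmult_1_r by lra. exact Hx.
  - rewrite Rabs_R0. apply cond_pos.
Qed.

Lemma flat_exp_derive (k : nat) (x : R) :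
  is_derive (flat_exp k) x (- INR k * flat_exp (S k) x + flat_exp (S (S k)) x).
Proof.
  assert (HN : forall x, x <> 0 -> is_derive (flat_exp k) x
     (- INR k * flat_exp (S k) x + flat_exp (S (S k)) x)).
  { clear x. intros x N. unfold flat_exp. destruct (Rlt_dec 0 x) as [L|L].
    - apply is_derive_ext_loc with (fun x => (/ x) ^ k * exp (- / x)).
      + apply locally_Ioo with 0 (x + 1); [lra|]. intros y Hy.
        destruct (Rlt_dec 0 y); lra.
      + auto_derive; [lra|]. destruct k as [|k]; [simpl; field; lra|].
        rewrite S_INR. simpl pred. simpl pow. field. lra.
    - apply is_derive_ext_loc with (fun _ => 0).
      + apply locally_Ioo with (x - 1) 0; [lra|]. intros y Hy.
        destruct (Rlt_dec 0 y); lra.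
      + replace (- INR k * 0 + 0) with 0 by ring. apply (is_derive_const (V := R_NormedModule)). }
  destruct (Req_dec x 0) as [->|N]; auto.
  apply (is_derive_of_continuous (flat_exp k)
    (fun x => - INR k * flat_exp (S k) x + flat_exp (S (S k)) x) 0 1); auto.
  - lra.
  - apply flat_exp_continuous_0.
  - apply (continuous_plus (V := R_NormedModule)).
    + apply (continuous_scal_r (V := R_NormedModule)), flat_exp_continuous_0.
    + apply flat_exp_continuous_0.
Qed.

Lemma flat_exp_smooth (k : nat) : rsmooth (flat_exp k).
Proof.
  assert (H : forall n k x, ex_derive_n (flat_exp k) n x).
  { induction n as [n IH] using lt_wf_ind. intros j x. destruct n as [|n]; [easy|].
    apply ex_derive_n_of_Derive; [eexists; apply flat_exp_derive|].
    apply ex_derive_n_ext with (fun x => - INR j * flat_exp (S j) x + flat_exp (S (S j)) x).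
    { intros t. symmetry. apply is_derive_unique, flat_exp_derive. }
    apply ex_derive_n_plus; apply filter_forall; intros y i Hi;
      [apply ex_derive_n_scal_l|]; apply IH; lia. }
  intros n x. apply H.
Qed.

Definition bump (x : R) : R := flat_exp 0 x * flat_exp 0 (1 - x).

Lemma bump_smooth : rsmooth bump.
Proof.
  apply rsmooth_mult; [apply flat_exp_smooth|].
  apply rsmooth_ext with (fun x => flat_exp 0 (-1 * x + 1)).
  - intros x. f_equal. ring.
  - apply rsmooth_affine, flat_exp_smooth.
Qed.

Lemma bump_pos (x : R) : 0 < x < 1 -> 0 < bump x.
Proof.
  intros H. apply Rmult_lt_0_compat; unfold flat_exp; destruct Rlt_dec; try lra;
    rewrite Rmult_1_l; apply exp_pos.
Qed.

Lemma bump_zero (x : R) : x <= 0 \/ 1 <= x -> bump x = 0.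
Proof.
  intros H. unfold bump, flat_exp. repeat destruct Rlt_dec; try lra.
Qed.

Lemma ex_RInt_bump (a b : R) : ex_RInt bump a b.
Proof. apply (ex_RInt_continuous (V := R_CompleteNormedModule)). intros; apply rsmooth_continuous, bump_smooth. Qed.

Lemma RInt_bump_pos : 0 < RInt bump 0 1.
Proof.
  apply RInt_gt_0; [lra | apply bump_pos | intros; apply rsmooth_continuous, bump_smooth].
Qed.

Definition unit_step (x : R) : R := RInt bump 0 x / RInt bump 0 1.

Lemma unit_step_smooth : rsmooth unit_step.
Proof.
  apply rsmooth_of_derive with (fun x => / RInt bump 0 1 * bump x).
  - intros x. unfold unit_step, Rdiv.
    apply is_derive_ext with (fun x => / RInt bump 0 1 * RInt bump 0 x); [intros t; apply Rmult_comm|].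
    apply (is_derive_scal (RInt bump 0)).
    apply (is_derive_RInt (V := R_NormedModule) bump (RInt bump 0) 0).
    + apply filter_forall. intros y. apply (RInt_correct (V := R_CompleteNormedModule)), ex_RInt_bump.
    + apply rsmooth_continuous, bump_smooth.
  - apply rsmooth_mult; [apply rsmooth_const | apply bump_smooth].
Qed.

Lemma RInt_bump_zero (a b : R) : (a <= b <= 0 \/ 1 <= a <= b) -> RInt bump a b = 0.
Proof.
  intros H. rewrite (RInt_ext bump (fun _ => 0)).
  - rewrite RInt_const. apply Rmult_0_r.
  - intros x. rewrite Rmin_left, Rmax_right by lra. intros Hx. apply bump_zero. lra.
Qed.

Lemma unit_step_0 (x : R) : x <= 0 -> unit_step x = 0.
Proof.
  intros H. unfold unit_step. rewrite <- opp_RInt_swap by apply ex_RInt_bump.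
  rewrite RInt_bump_zero by lra. unfold opp; simpl. lra.
Qed.

Lemma unit_step_1 (x : R) : 1 <= x -> unit_step x = 1.
Proof.
  intros H. unfold unit_step.
  rewrite <- (RInt_Chasles (V := R_CompleteNormedModule) bump 0 1 x) by apply ex_RInt_bump.
  rewrite (RInt_bump_zero 1 x) by lra. unfold plus; simpl. field.
  apply Rgt_not_eq, RInt_bump_pos.
Qed.

Definition step (a b x : R) : R := unit_step (/ (b - a) * x + - a / (b - a)).

Lemma step_smooth (a b : R) : rsmooth (step a b).
Proof. apply rsmooth_affine, unit_step_smooth. Qed.

Lemma step_0 (a b x : R) : a < b -> x <= a -> step a b x = 0.
Proof.
  intros H Hx. apply unit_step_0.
  replace (_ + _) with (- ((a - x) * / (b - a))) by (field; lra).
  assert (0 <= (a - x) * / (b - a)); [|lra].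
  apply Rmult_le_pos; [lra | apply Rlt_le, Rinv_0_lt_compat; lra].
Qed.

Lemma step_1 (a b x : R) : a < b -> b <= x -> step a b x = 1.
Proof.
  intros H Hx. apply unit_step_1.
  replace (_ + _) with (1 + (x - b) * / (b - a)) by (field; lra).
  assert (0 <= (x - b) * / (b - a)); [|lra].
  apply Rmult_le_pos; [lra | apply Rlt_le, Rinv_0_lt_compat; lra].
Qed.

(** * Smooth extension of one-sided germs *)

Definition monomial (p : R) (m : nat) (x : R) : R := (x - p) ^ m / INR (fact m).

Lemma monomial_derive (p : R) (m : nat) (x : R) :
  is_derive (monomial p (S m)) x (monomial p m x).
Proof.
  unfold monomial. auto_derive; auto.
  change (fact m + m * fact m)%nat with (S m * fact m)%nat.
  change (match m with 0%nat => 1 | S _ => INR m + 1 end) with (INR (S m)).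
  rewrite mult_INR. unfold Rdiv, Rminus.
  match goal with |- @eq _ ?a ?b => change (@eq R a b) end. field. split; [apply INR_fact_neq_0 | apply not_0_INR; lia].
Qed.

Lemma monomial_0 (p x : R) : monomial p 0 x = 1.
Proof. unfold monomial. simpl. field. Qed.

Lemma monomial_smooth (p : R) (m : nat) : rsmooth (monomial p m).
Proof.
  apply rsmooth_mult; [apply rsmooth_pow | apply rsmooth_const].
Qed.

Lemma Derive_n_monomial (p : R) (m j : nat) :
  Derive_n (monomial p m) j p = if Nat.eq_dec j m then 1 else 0.
Proof.
  revert j. induction m as [|m IH]; intros j.
  - rewrite (Derive_n_ext _ (fun _ => 1)) by (intros; apply monomial_0).
    destruct j as [|j]; simpl Nat.eq_dec; [reflexivity|]. apply Derive_n_const.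
  - destruct j as [|j].
    + destruct Nat.eq_dec; [lia|]. unfold monomial; simpl.
      rewrite Rminus_diag. unfold Rdiv. ring.
    + rewrite Derive_n_S_comm, (Derive_n_ext _ (monomial p m)), IH.
      * repeat destruct Nat.eq_dec; lia || reflexivity.
      * intros t. apply is_derive_unique, monomial_derive.
Qed.

Definition plateau (x : R) : R := step (-2) (-1) x * step (-2) (-1) (- x).

Lemma plateau_smooth : rsmooth plateau.
Proof.
  apply rsmooth_mult; [apply step_smooth|].
  apply rsmooth_ext with (fun x => step (-2) (-1) (-1 * x + 0)).
  - intros x. f_equal. ring.
  - apply rsmooth_affine, step_smooth.
Qed.

Lemma plateau_1 (x : R) : -1 <= x <= 1 -> plateau x = 1.
Proof. intros H. unfold plateau. rewrite !step_1 by lra. ring. Qed.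

Lemma plateau_0 (x : R) : 2 < Rabs x -> plateau x = 0.
Proof.
  intros H. unfold plateau. unfold Rabs in H. destruct (Rcase_abs x).
  - rewrite (step_0 _ _ x) by lra. ring.
  - rewrite (step_0 _ _ (- x)) by lra. ring.
Qed.

Lemma locally_outside (K x : R) : K < Rabs x -> locally x (fun t => K < Rabs t).
Proof.
  intros H. apply locally_open with (D := fun t => K < Rabs t); auto.
  apply open_comp with (f := Rabs) (D := fun t => K < t).
  - intros y _. apply (continuous_Rabs y).
  - apply open_gt.
Qed.

Lemma Derive_n_zero_loc (f : R -> R) (n : nat) (x : R) :
  locally x (fun y => f y = 0) -> Derive_n f n x = 0.
Proof.
  intros H. rewrite (Derive_n_ext_loc f (fun _ => 0)) by auto.
  destruct n as [|n]; [reflexivity|]. apply Derive_n_const.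
Qed.

Lemma Derive_n_bounded (g : R -> R) (K : R) (n : nat) :
  rsmooth g -> (forall x, K < Rabs x -> g x = 0) ->
  exists M, 0 <= M /\ forall x j, (j < n)%nat -> Rabs (Derive_n g j x) <= M.
Proof.
  intros Hg HK. induction n as [|n [M [HM IH]]]; [exists 0; split; [lra|]; lia|].
  destruct (bounded_continuity (K := R_AbsRing) (V := R_NormedModule) (Derive_n g n) (- K) K)
    as [M' HM'].
  { intros x _. apply rsmooth_continuous, rsmooth_Derive_n, Hg. }
  exists (Rmax M M'). split; [apply Rle_trans with M; auto; apply Rmax_l|].
  intros x j Hj. destruct (Nat.eq_dec j n) as [->|N].
  - destruct (Rle_dec (Rabs x) K) as [L|L].
    + apply Rle_trans with M'; [|apply Rmax_r]. apply Rlt_le, HM'.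
      now apply Rabs_le_between in L.
    + rewrite Derive_n_zero_loc.
      * rewrite Rabs_R0. apply Rle_trans with M; auto. apply Rmax_l.
      * apply filter_imp with (fun t => K < Rabs t); auto. apply locally_outside. lra.
  - apply Rle_trans with M; [apply IH; lia | apply Rmax_l].
Qed.

(* With cutoff radius [1/l], the derivatives of order [< n] of the [n]-th term
   of the series are [O(1/l)]. *)
Lemma borel_term (n : nat) (c : R) :
  exists U : R -> R, rsmooth U /\
    (forall j, Derive_n U j 0 = if Nat.eq_dec j n then c else 0) /\
    (forall j x, (j < n)%nat -> Rabs (Derive_n U j x) <= (1 / 2) ^ n).
Proof.
  set (g := fun y => monomial 0 n y * plateau y).
  assert (Hg : rsmooth g) by (apply rsmooth_mult; [apply monomial_smooth | apply plateau_smooth]).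
  destruct (Derive_n_bounded g 2 n Hg) as [M [HM0 HM]].
  { intros x Hx. unfold g. rewrite plateau_0 by auto. ring. }
  (* After j < n differentiations the scaling leaves at least one factor 1/l. Since l exceeds |c| M
     2^n, this factor yields the bound (1/2)^n; the summand 1 gives l >= 1, so further factors 1/l
     do no harm. *)
  set (l := 1 + Rabs c * M * 2 ^ n).
  assert (H2 : 0 < 2 ^ n) by (apply pow_lt; lra).
  assert (Hl : 1 <= l).
  { unfold l. assert (0 <= Rabs c * M * 2 ^ n); [|lra].
    repeat apply Rmult_le_pos; try lra. apply Rabs_pos. }
  assert (Hln : forall k, 0 < l ^ k) by (intros k; apply pow_lt; lra).
  exists (fun x => c / l ^ n * g (l * x)).
  assert (HD : forall j x, Derive_n (fun x => c / l ^ n * g (l * x)) j x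
     = c / l ^ n * (l ^ j * Derive_n g j (l * x))).
  { intros j x. rewrite Derive_n_scal_l. f_equal.
    apply Derive_n_comp_scal. apply filter_forall. intros y k _. apply Hg. }
  split; [|split].
  - apply rsmooth_mult; [apply rsmooth_const|].
    apply rsmooth_ext with (fun x => g (l * x + 0)); [intros; f_equal; ring|].
    apply rsmooth_affine, Hg.
  - intros j. rewrite HD. replace (l * 0) with 0 by ring.
    rewrite (Derive_n_ext_loc g (monomial 0 n)).
    + rewrite Derive_n_monomial. destruct Nat.eq_dec as [->|]; [field|ring].
      apply Rgt_not_eq, Hln.
    + apply locally_Ioo with (-1) 1; [lra|]. intros y Hy. unfold g.
      rewrite plateau_1 by lra. ring.
  - intros j x Hj. rewrite HD.
    rewrite Rabs_mult, Rabs_mult. rewrite (Rabs_right (l ^ j)) by (apply Rle_ge, Rlt_le, Hln).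
    unfold Rdiv. rewrite Rabs_mult, (Rabs_right (/ l ^ n)) by (apply Rle_ge, Rlt_le, Rinv_0_lt_compat, Hln).
    (* Writes l^n as l^j l l^(n-1-j): the first power cancels against the chain rule, the second is
       the spare factor. *)
    replace n with (j + S (n - S j))%nat at 1 by lia.
    rewrite pow_add, <- tech_pow_Rmult. set (k := (n - S j)%nat).
    assert (B : l ^ j * Rabs (Derive_n g j (l * x)) <= l ^ j * M).
    { apply Rmult_le_compat_l; [apply Rlt_le, Hln | now apply HM]. }
    apply Rle_trans with (Rabs c * / (l ^ j * (l * l ^ k)) * (l ^ j * M)).
    { apply Rmult_le_compat_l; auto. apply Rmult_le_pos; [apply Rabs_pos|].
      apply Rlt_le, Rinv_0_lt_compat. repeat apply Rmult_lt_0_compat; auto; lra. }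
    assert (Hk : 1 <= l ^ k) by (apply pow_R1_Rle; lra).
    replace (Rabs c * / (l ^ j * (l * l ^ k)) * (l ^ j * M))
      with (Rabs c * M * (/ l * / l ^ k)) by (field; split; [|split]; [apply Rgt_not_eq, Hln| |apply Rgt_not_eq, Hln]; lra).
    replace (1 * / 2) with (/ 2) by lra. rewrite pow_inv.
    apply Rmult_le_reg_r with (2 ^ n); auto. rewrite Rinv_l by lra.
    apply Rmult_le_reg_r with l; [lra|].
    replace (Rabs c * M * (/ l * / l ^ k) * 2 ^ n * l) with ((Rabs c * M * 2 ^ n) * / l ^ k)
      by (field; split; [apply Rgt_not_eq, Hln | lra]).
    apply Rle_trans with (Rabs c * M * 2 ^ n * 1); [|unfold l; lra].
    apply Rmult_le_compat_l; [unfold l in Hl; lra|].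
    rewrite <- Rinv_1. apply Rinv_le_contravar; lra.
Qed.

(** Terms up to [N0] are unrestricted because a j-th derivative is controlled only in the terms of
    index n > j. The tail is compared with the telescoping difference (1/2)^N - (1/2)^(N+k), a form
    that passes through the induction on k. *)
Lemma CVU_dom_geometric (a : nat -> R -> R) (N0 : nat) :
  (forall n x, (N0 < n)%nat -> Rabs (a n x) <= (1 / 2) ^ n) ->
  CVU_dom (fun N x => sum_n (fun n => a n x) N) (fun _ => True).
Proof.
  intros H. apply CVU_dom_cauchy. intros eps.
  assert (B : forall N k x, (N0 <= N)%nat ->
    Rabs (sum_n (fun n => a n x) (N + k) - sum_n (fun n => a n x) N) <= (1 / 2) ^ N - (1 / 2) ^ (N + k)).
  { intros N k x HN. induction k as [|k IH].
    - rewrite Nat.add_0_r, !Rminus_diag, Rabs_R0. lra.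
    - rewrite Nat.add_succ_r, sum_Sn.
      specialize (H (S (N + k)) x ltac:(lia)).
      unfold plus; simpl in *. unfold Rabs in *. repeat destruct Rcase_abs; lra. }
  destruct (pow_lt_1_zero (1 / 2) ltac:(rewrite Rabs_right; lra) (eps / 2)) as [N1 HN1].
  { generalize (cond_pos eps); lra. }
  exists (N0 + N1)%nat. intros n m x _ Hn Hm.
  set (N := (N0 + N1)%nat) in *.
  generalize (B N (n - N)%nat x ltac:(lia)) (B N (m - N)%nat x ltac:(lia)) (HN1 N ltac:(lia)).
  replace (N + (n - N))%nat with n by lia. replace (N + (m - N))%nat with m by lia.
  assert (P : forall k, 0 < (1 / 2) ^ k) by (intros k; apply pow_lt; lra).
  generalize (P n) (P m). rewrite (Rabs_right ((1 / 2) ^ N)) by (apply Rle_ge, Rlt_le, P).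
  unfold Rabs. repeat destruct Rcase_abs; lra.
Qed.

Lemma is_derive_sum_n (a a' : nat -> R -> R) (x : R) :
  (forall n, is_derive (a n) x (a' n x)) ->
  forall N, is_derive (fun x => sum_n (fun n => a n x) N) x (sum_n (fun n => a' n x) N).
Proof.
  intros H N. induction N as [|N IH].
  - apply is_derive_ext with (a 0%nat); [intros; now rewrite sum_O|]. rewrite sum_O. apply H.
  - apply is_derive_ext with (fun x => sum_n (fun n => a n x) N + a (S N) x).
    { intros; now rewrite sum_Sn. }
    rewrite sum_Sn. apply (is_derive_plus (V := R_NormedModule)); auto.
Qed.

Lemma borel (c : nat -> R) (p : R) :
  exists F : R -> R, rsmooth F /\ forall n, Derive_n F n p = c n.
Proof.
  set (X n := constructive_indefinite_description _ (borel_term n (c n))).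
  set (U n := proj1_sig (X n)).
  assert (HU : forall n, rsmooth (U n)) by (intros n; apply (proj2_sig (X n))).
  assert (HU0 : forall n j, Derive_n (U n) j 0 = if Nat.eq_dec j n then c n else 0)
    by (intros n; apply (proj2_sig (X n))).
  assert (HUb : forall n j x, (j < n)%nat -> Rabs (Derive_n (U n) j x) <= (1 / 2) ^ n)
    by (intros n; apply (proj2_sig (X n))).
  clearbody U. clear X.
  set (f j N x := sum_n (fun n => Derive_n (U n) j x) N).
  assert (Df : forall j N x, is_derive (f j N) x (f (S j) N x)).
  { intros j N x. apply (is_derive_sum_n (fun n => Derive_n (U n) j)
      (fun n => Derive_n (U n) (S j))). intros n. now apply rsmooth_is_derive_n. }
  assert (CV : forall j, CVU_dom (f j) (fun _ => True)).
  { intros j. apply CVU_dom_geometric with j. intros n x. apply HUb. }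
  assert (E : forall j N, Derive (f j N) = f (S j) N).
  { intros j N. apply functional_extensionality. intros x. now apply is_derive_unique. }
  (* The candidate for the j-th derivative is the sum of the termwise j-th derivatives; uniform
     convergence at every order justifies differentiating under the limit. *)
  destruct (rsmooth_family (fun j x => Lim_seq (fun N => f j N x))) as [S1 S2].
  { intros j x.
    replace (Lim_seq (fun N => f (S j) N x)) with (Lim_seq (fun N => Derive (f j N) x))
      by (apply Lim_seq_ext; intros; now rewrite E).
    apply (CVU_Derive (f j) (fun _ => True)); auto.
    - apply open_true.
    - intros a b y _ _ _. exact I.
    - intros N y _. eexists; apply Df.
    - intros N y _. rewrite E. apply continuity_pt_filterlim.
      apply (ex_derive_continuous (V := R_NormedModule)). eexists; apply Df.
    - intros eps. generalize (CV (S j) eps). apply filter_imp. intros N HN y Hy.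
      rewrite E. erewrite Lim_seq_ext; [apply (HN y Hy)|]. intros; simpl. now rewrite E. }
  exists (fun x => Lim_seq (fun N => f 0%nat N (1 * x + - p))).
  split; [apply (rsmooth_affine (fun x => Lim_seq (fun N => f 0%nat N x))), S1|].
  intros n. rewrite (Derive_n_ext _ (fun x => Lim_seq (fun N => f 0%nat N (x + - p))))
    by (intros; now rewrite Rmult_1_l).
  rewrite (Derive_n_comp_trans (fun x => Lim_seq (fun N => f 0%nat N x))), S2.
  rewrite Rplus_opp_r.
  rewrite (is_lim_seq_unique _ (c n)); [reflexivity|].
  (* At the centre only the n-th term has a nonzero n-th derivative, so the partial sums are
     constant from index n on. *)
  apply is_lim_seq_ext_loc with (fun _ => c n); [|apply is_lim_seq_const].
  exists n. intros N HN. unfold f.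
  rewrite (sum_n_ext _ (fun i => if Nat.eq_dec n i then c i else 0)) by (intros; apply HU0).
  assert (G : forall N, sum_n (fun i => if Nat.eq_dec n i then c i else 0) N
     = if le_dec n N then c n else 0).
  { clear. induction N as [|N IH].
    - rewrite sum_O. repeat destruct Nat.eq_dec; repeat destruct le_dec; subst; lia || reflexivity.
    - rewrite sum_Sn, IH. unfold plus; simpl.
      destruct (Nat.eq_dec n (S N)) as [->|]; repeat destruct le_dec; try lia; lra. }
  rewrite G. destruct le_dec; [reflexivity | lia].
Qed.

Lemma ex_derive_n_mult_Ioo (a b : R) (n : nat) : forall f g : R -> R,
  (forall k x, a < x < b -> ex_derive_n f k x) ->
  (forall k x, a < x < b -> ex_derive_n g k x) ->
  forall k x, (k <= n)%nat -> a < x < b -> ex_derive_n (fun t => f t * g t) k x.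
Proof.
  induction n as [|n IH]; intros f g Hf Hg k x Hk Hx.
  - now replace k with 0%nat by lia.
  - destruct k as [|k]; [easy|].
    apply ex_derive_n_of_Derive.
    + apply (ex_derive_mult f g x); [apply (Hf 1%nat) | apply (Hg 1%nat)]; auto.
    + apply ex_derive_n_ext_loc with (fun t => Derive f t * g t + f t * Derive g t).
      * apply locally_Ioo with a b; auto. intros t Ht. symmetry.
        apply Derive_mult; [apply (Hf 1%nat) | apply (Hg 1%nat)]; auto.
      * apply ex_derive_n_plus; apply locally_Ioo with a b; auto; intros y Hy j Hj;
          apply IH; auto; try lia; intros i z Hz; apply ex_derive_n_Derive; auto.
Qed.

Lemma at_left_Ioo (P : R -> Prop) (a p : R) :
  a < p -> (forall x, a < x < p -> P x) -> at_left p P.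
Proof.
  intros Ha H. unfold at_left, within. apply locally_Ioo with a (p + 1); [lra|].
  intros y Hy Hp. apply H. lra.
Qed.

Lemma at_right_Ioo (P : R -> Prop) (p b : R) :
  p < b -> (forall x, p < x < b -> P x) -> at_right p P.
Proof.
  intros Ha H. unfold at_right, within. apply locally_Ioo with (p - 1) b; [lra|].
  intros y Hy Hp. apply H. lra.
Qed.

Lemma extend_left (f : R -> R) (p r : R) : 0 < r ->
  (forall n x, p - r < x < p -> ex_derive_n f n x) ->
  (forall n, exists l : R, filterlim (Derive_n f n) (at_left p) (locally l)) ->
  exists F, rsmooth F /\ forall x, p - r / 2 < x < p -> F x = f x.
Proof.
  intros Hr Hf Hl.
  set (L n := constructive_indefinite_description _ (Hl n)).
  destruct (borel (fun n => proj1_sig (L n)) p) as [S [HS1 HS2]].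
  (* [f] is controlled only on (p - r, p). The cutoff vanishes left of p - 3r/4, so [u] is smooth on
     the whole left half-line, and it is 1 from p - r/2 on. The Borel function [S] continues it
     beyond p with matching one-sided derivatives. *)
  set (u := fun x => step (p - 3 / 4 * r) (p - r / 2) x * f x).
  exists (fun x => if Rlt_dec x p then u x else S x). split.
  - apply rsmooth_piecewise; auto.
    + intros n x Hx. destruct (Rlt_dec (p - r) x) as [H|H].
      * apply ex_derive_n_mult_Ioo with (p - r) p n; auto; try lra.
        intros k y _. apply step_smooth.
      * apply ex_derive_n_ext_loc with (fun _ => 0); [|apply ex_derive_n_const].
        apply locally_Ioo with (x - 1) (p - 3 / 4 * r); [lra|].
        intros y Hy. unfold u. rewrite step_0 by lra. ring.
    + intros n. rewrite HS2.
      apply filterlim_ext_loc with (Derive_n f n); [|apply (proj2_sig (L n))].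
      apply at_left_Ioo with (p - r / 2); [lra|]. intros x Hx.
      apply Derive_n_ext_loc. apply locally_Ioo with (p - r / 2) p; [lra|].
      intros y Hy. unfold u. rewrite step_1 by lra. ring.
  - intros x Hx. destruct (Rlt_dec x p); [|lra]. unfold u. rewrite step_1 by lra. ring.
Qed.

(** The reflection x -> -x reduces this to [extend_left]; the n-th derivative acquires the sign
    (-1)^n. *)
Lemma extend_right (f : R -> R) (p r : R) : 0 < r ->
  (forall n x, p < x < p + r -> ex_derive_n f n x) ->
  (forall n, exists l : R, filterlim (Derive_n f n) (at_right p) (locally l)) ->
  exists F, rsmooth F /\ forall x, p < x < p + r / 2 -> F x = f x.
Proof.
  intros Hr Hf Hl.
  assert (HN : forall n x, - p - r < x < - p ->
     locally (- x) (fun y => forall k, (k <= n)%nat -> ex_derive_n f k y)).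
  { intros n x Hx. apply locally_Ioo with p (p + r); [lra|]. intros y Hy k _. now apply Hf. }
  destruct (extend_left (fun x => f (- x)) (- p) r) as [F [HF1 HF2]]; auto.
  - intros n x Hx. apply ex_derive_n_comp_opp, HN; auto.
  - intros n. destruct (Hl n) as [l H]. exists ((-1) ^ n * l).
    apply filterlim_ext_loc with (fun x => (-1) ^ n * Derive_n f n (- x)).
    + apply at_left_Ioo with (- p - r); [lra|]. intros x Hx. symmetry.
      apply Derive_n_comp_opp, HN; auto.
    + apply (filterlim_comp _ _ _ (fun x => Derive_n f n (- x)) (fun y => (-1) ^ n * y) _ (locally l)).
      2: apply (filterlim_scal_r (K := R_AbsRing) (V := R_NormedModule) ((-1) ^ n) l).
      apply (filterlim_comp _ _ _ Ropp (Derive_n f n) _ (at_right p)); auto.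
      intros P HP. unfold filtermap, at_left, at_right, within in *.
      replace p with (- (- p)) in HP by ring.
      generalize (continuous_opp (V := R_NormedModule) (fun x : R => x) (- p) (continuous_id _) _ HP).
      unfold filtermap. apply filter_imp. intros x Hx Hlt. apply Hx. simpl. unfold opp; simpl. lra.
  - exists (fun x => F (-1 * x + 0)). split; [now apply rsmooth_affine|].
    intros x Hx. rewrite HF2 by lra. f_equal. ring.
Qed.

Lemma avoid_list (s : list R) (p : R) :
  exists r, 0 < r /\ forall x, 0 < Rabs (x - p) < r -> ~ In x s.
Proof.
  induction s as [|y s [r [Hr IH]]]; [exists 1; split; [lra|]; easy|].
  destruct (Req_dec y p) as [->|N].
  - exists r. split; auto. intros x Hx [->|H]; [|now apply (IH x)].
    rewrite Rminus_diag, Rabs_R0 in Hx. lra.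
  - assert (0 < Rabs (y - p)) by (apply Rabs_pos_lt; lra).
    exists (Rmin r (Rabs (y - p))). split; [now apply Rmin_glb_lt|].
    intros x [H0 Hx] [->|Hi].
    + generalize (Rmin_r r (Rabs (x - p))). lra.
    + apply (IH x); auto. split; auto. eapply Rlt_le_trans; [apply Hx | apply Rmin_l].
Qed.

Lemma smooth_of_parts (f g : R -> R) : rsmooth f -> rsmooth g -> smooth (fun x => (f x, g x)).
Proof. intros Hf Hg n x. split; [apply Hf | apply Hg]. Qed.

Lemma Cp_infty_germs (f : R -> C) (p : R) : Cp_infty f ->
  exists (r : R) (u v : smoothfun), 0 < r /\
    (forall x, p - r < x < p -> f x = u x) /\ (forall x, p < x < p + r -> f x = v x).
Proof.
  intros [s [Hs Hl]].
  destruct (avoid_list s p) as [r [Hr Ha]].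
  assert (HA : forall x n, p - r < x < p + r -> x <> p -> ex_Cderive_n f n x).
  { intros x n Hx N. apply Hs, Ha. split; [apply Rabs_pos_lt; lra | apply Rabs_lt_between; lra]. }
  assert (HL : forall n, (exists l : C, filterlim (Cderive_n f n) (at_left p) (locally (T := C_UniformSpace) l))
      /\ exists l : C, filterlim (Cderive_n f n) (at_right p) (locally (T := C_UniformSpace) l)).
  { intros n. destruct (in_dec Req_dec_T p s) as [i|i].
    - destruct (Hl p i n) as [l [l' [H1 H2]]]. split; eexists; eauto.
    (* Outside the exceptional list the function is smooth at p, and continuity supplies the
       one-sided limits, so the two cases merge. *)
    - assert (C : filterlim (Cderive_n f n) (locally p) (locally (T := C_UniformSpace) (Cderive_n f n p))).
      { destruct (Hs p i (S n)) as [E1 E2].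
        apply (filterlim_filter_le_2 (G := filter_prod (locally (Derive_n (fun t => Re (f t)) n p))
           (locally (Derive_n (fun t => Im (f t)) n p)))).
        - intros P [eps HP]. exists (fun y => ball (Derive_n (fun t => Re (f t)) n p) eps y)
            (fun y => ball (Derive_n (fun t => Im (f t)) n p) eps y); try apply locally_ball.
          intros x y Hx Hy. apply HP. now split.
        - apply filterlim_pair; apply (ex_derive_continuous (V := R_NormedModule)); [apply E1 | apply E2]. }
      split; exists (Cderive_n f n p); apply filterlim_filter_le_1 with (2 := C);
        intros P HP; unfold at_left, at_right, within; revert HP; apply filter_imp; auto. }
  assert (Hre : forall l : C, filterlim fst (locally (T := C_UniformSpace) l) (locally (fst l)))
    by (intros [l1 l2]; apply (continuous_fst (U := R_UniformSpace) (V := R_UniformSpace))).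
  assert (Him : forall l : C, filterlim snd (locally (T := C_UniformSpace) l) (locally (snd l)))
    by (intros [l1 l2]; apply (continuous_snd (U := R_UniformSpace) (V := R_UniformSpace))).
  destruct (extend_left (fun t => Re (f t)) p r) as [u1 [Hu1 Eu1]]; auto.
  { intros n x Hx. apply HA; lra. }
  { intros n. destruct (HL n) as [[l H] _]. exists (fst l). apply (filterlim_comp _ _ _ _ _ _ _ _ H (Hre l)). }
  destruct (extend_left (fun t => Im (f t)) p r) as [u2 [Hu2 Eu2]]; auto.
  { intros n x Hx. apply HA; lra. }
  { intros n. destruct (HL n) as [[l H] _]. exists (snd l). apply (filterlim_comp _ _ _ _ _ _ _ _ H (Him l)). }
  destruct (extend_right (fun t => Re (f t)) p r) as [v1 [Hv1 Ev1]]; auto.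
  { intros n x Hx. apply HA; lra. }
  { intros n. destruct (HL n) as [_ [l H]]. exists (fst l). apply (filterlim_comp _ _ _ _ _ _ _ _ H (Hre l)). }
  destruct (extend_right (fun t => Im (f t)) p r) as [v2 [Hv2 Ev2]]; auto.
  { intros n x Hx. apply HA; lra. }
  { intros n. destruct (HL n) as [_ [l H]]. exists (snd l). apply (filterlim_comp _ _ _ _ _ _ _ _ H (Him l)). }
  exists (r / 2), (SmoothFun _ (smooth_of_parts _ _ Hu1 Hu2)), (SmoothFun _ (smooth_of_parts _ _ Hv1 Hv2)).
  split; [lra|]. split; intros x Hx; simpl.
  - rewrite Eu1, Eu2 by lra. now destruct (f x).
  - rewrite Ev1, Ev2 by lra. now destruct (f x).
Qed.

(** * Calculus of smooth complex functions *)

Lemma smooth_plus (f g : R -> C) : smooth f -> smooth g -> smooth (fun x => f x + g x)%C.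
Proof.
  intros Hf Hg n x.
  split; apply ex_derive_n_plus; apply filter_forall; intros y k _; apply Hf || apply Hg.
Qed.

Lemma smooth_const (c : C) : smooth (fun _ => c).
Proof. intros n x. split; apply ex_derive_n_const. Qed.

Lemma smooth_real (f : R -> R) : rsmooth f -> smooth (fun x => RtoC (f x)).
Proof. intros Hf n x. split; [apply Hf | apply (ex_derive_n_const 0)]. Qed.

Lemma smooth_conj (f : R -> C) : smooth f -> smooth (fun x => Cconj (f x)).
Proof. intros Hf n x. split; [apply Hf | apply ex_derive_n_opp, Hf]. Qed.

Lemma smooth_Cderive_n (f : R -> C) (k : nat) : smooth f -> smooth (Cderive_n f k).
Proof.
  intros H n x. split; apply rsmooth_Derive_n; intros m y; apply H.
Qed.

Lemma Cderive_n_S (f : R -> C) (n : nat) (x : R) :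
  Cderive_n f (S n) x = Cderive_n (Cderive_n f 1) n x.
Proof. unfold Cderive_n. now rewrite !Derive_n_S_comm. Qed.

Lemma Cderive_n_comp (f : R -> C) (m n : nat) (x : R) :
  Cderive_n (Cderive_n f m) n x = Cderive_n f (n + m) x.
Proof.
  unfold Cderive_n. f_equal; simpl; apply Derive_n_comp.
Qed.

Lemma Cderive_n_ext_loc (f g : R -> C) (n : nat) (x : R) :
  locally x (fun t => f t = g t) -> Cderive_n f n x = Cderive_n g n x.
Proof.
  intros H. unfold Cderive_n.
  f_equal; apply Derive_n_ext_loc; revert H; apply filter_imp; intros t ->; reflexivity.
Qed.

Lemma Cderive_n_zero_loc (f : R -> C) (n : nat) (x : R) :
  locally x (fun t => f t = RtoC 0) -> Cderive_n f n x = RtoC 0.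
Proof.
  intros H. unfold Cderive_n, RtoC.
  f_equal; apply Derive_n_zero_loc; revert H; apply filter_imp; intros t ->; reflexivity.
Qed.

Lemma Cderive_n_plus (f g : R -> C) (n : nat) (x : R) : smooth f -> smooth g ->
  Cderive_n (fun t => f t + g t)%C n x = (Cderive_n f n x + Cderive_n g n x)%C.
Proof.
  intros Hf Hg. unfold Cderive_n, Cplus; simpl.
  f_equal; apply Derive_n_plus; apply filter_forall; intros y k _; apply Hf || apply Hg.
Qed.

Lemma Cderive_mult (f g : R -> C) (x : R) : smooth f -> smooth g ->
  Cderive_n (fun t => f t * g t)%C 1 x = (Cderive_n f 1 x * g x + f x * Cderive_n g 1 x)%C.
Proof.
  intros Hf Hg.
  destruct (Hf 1%nat x) as [f1 f2], (Hg 1%nat x) as [g1 g2]. simpl in *.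
  assert (M : forall a b : R -> R, ex_derive a x -> ex_derive b x -> ex_derive (fun t => a t * b t) x)
    by (intros a b Ha Hb; now apply (ex_derive_mult a b)).
  unfold Cderive_n, Cmult, Cplus; simpl.
  rewrite (Derive_minus (fun t => fst (f t) * fst (g t)) (fun t => snd (f t) * snd (g t))),
    (Derive_plus (fun t => fst (f t) * snd (g t)) (fun t => snd (f t) * fst (g t))) by (apply M; auto).
  rewrite !Derive_mult by auto.
  f_equal; unfold Re, Im; ring.
Qed.

Lemma Cderive_n_mult_S (f g : R -> C) (n : nat) (x : R) : smooth f -> smooth g ->
  Cderive_n (fun t => f t * g t)%C (S n) x =
  (Cderive_n (fun t => Cderive_n f 1 t * g t) n x + Cderive_n (fun t => f t * Cderive_n g 1 t) n x)%C.
Proof.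
  intros Hf Hg. rewrite Cderive_n_S, <- Cderive_n_plus;
    [|apply smooth_mult; auto; apply (smooth_Cderive_n _ 1); auto ..].
  f_equal. apply functional_extensionality. intros t. now apply Cderive_mult.
Qed.

Lemma Cderive_n_translate (f : R -> C) (n : nat) (e x : R) :
  Cderive_n (fun t => f (t + e)) n x = Cderive_n f n (x + e).
Proof.
  unfold Cderive_n.
  now rewrite (Derive_n_comp_trans (fun t => Re (f t))), (Derive_n_comp_trans (fun t => Im (f t))).
Qed.

Lemma Cderive_n_const (c : C) (n : nat) (x : R) :
  Cderive_n (fun _ => c) (S n) x = RtoC 0.
Proof. unfold Cderive_n. now rewrite !Derive_n_const. Qed.

Lemma Cderive_n_scal (c : C) (f : R -> C) (n : nat) (x : R) : smooth f ->
  Cderive_n (fun t => c * f t)%C n x = (c * Cderive_n f n x)%C.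
Proof.
  intros Hf. revert f Hf. induction n as [|n IH]; intros f Hf.
  - unfold Cderive_n; simpl. unfold Re, Im. now destruct (c * f x)%C, (f x).
  - rewrite Cderive_n_mult_S, (Cderive_n_S f) by auto using smooth_const.
    rewrite IH by now apply (smooth_Cderive_n _ 1).
    rewrite Cderive_n_zero_loc; [ring|].
    apply filter_forall. intros t. rewrite Cderive_n_const. ring.
Qed.

Lemma Cderive_n_0 (f : R -> C) (x : R) : Cderive_n f 0 x = f x.
Proof. unfold Cderive_n; simpl. now destruct (f x). Qed.

Lemma Ccontinuous_pair (f : R -> C) (x : R) :
  continuous (fun t => Re (f t)) x -> continuous (fun t => Im (f t)) x ->
  continuous (U := C_UniformSpace) f x.
Proof.
  intros H1 H2.
  apply (filterlim_ext (fun t => (Re (f t), Im (f t)))); [intros t; now destruct (f t)|].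
  apply (filterlim_filter_le_2 (G := filter_prod (locally (Re (f x))) (locally (Im (f x))))).
  - intros P [eps HP]. exists (fun y => ball (Re (f x)) eps y) (fun y => ball (Im (f x)) eps y);
      try apply locally_ball.
    intros a b Ha Hb. apply HP. now split.
  - now apply filterlim_pair.
Qed.

Lemma smooth_continuous (f : R -> C) (x : R) : smooth f -> continuous (U := C_UniformSpace) f x.
Proof.
  intros H. apply Ccontinuous_pair; apply rsmooth_continuous; intros n y; apply H.
Qed.

Lemma smooth_is_derive_Re (f : R -> C) (x : R) : smooth f ->
  is_derive (fun t => Re (f t)) x (Re (Cderive_n f 1 x)).
Proof. intros H. apply Derive_correct, (H 1%nat). Qed.

Lemma smooth_is_derive_Im (f : R -> C) (x : R) : smooth f ->
  is_derive (fun t => Im (f t)) x (Im (Cderive_n f 1 x)).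
Proof. intros H. apply Derive_correct, (H 1%nat). Qed.

(** * Integrals *)

Definition is_CInt (f : R -> C) (a b : R) (l : C) : Prop :=
  is_RInt (V := C_R_NormedModule) f a b l.

Definition CInt (f : R -> C) (a b : R) : C := RInt (V := C_R_CompleteNormedModule) f a b.

Lemma is_CInt_pair (f : R -> C) (a b : R) (l : C) :
  is_RInt (fun t => Re (f t)) a b (Re l) -> is_RInt (fun t => Im (f t)) a b (Im l) ->
  is_CInt f a b l.
Proof.
  intros H1 H2. destruct l as [l1 l2].
  apply (is_RInt_fct_extend_pair (U := R_NormedModule) (V := R_NormedModule)); auto.
Qed.

Lemma is_CInt_unique (f : R -> C) (a b : R) (l : C) : is_CInt f a b l -> CInt f a b = l.
Proof. apply (is_RInt_unique (V := C_R_CompleteNormedModule)). Qed.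

Lemma is_CInt_correct (f : R -> C) (a b : R) : smooth f -> is_CInt f a b (CInt f a b).
Proof.
  intros H. apply (RInt_correct (V := C_R_CompleteNormedModule)).
  apply (ex_RInt_continuous (V := C_R_CompleteNormedModule)). intros z _. now apply smooth_continuous.
Qed.

Lemma is_CInt_ext (f g : R -> C) (a b : R) (l : C) :
  (forall x, Rmin a b < x < Rmax a b -> f x = g x) -> is_CInt f a b l -> is_CInt g a b l.
Proof. apply (is_RInt_ext (V := C_R_NormedModule)). Qed.

Lemma is_CInt_Chasles (f : R -> C) (a b c : R) (l m : C) :
  is_CInt f a b l -> is_CInt f b c m -> is_CInt f a c (l + m)%C.
Proof. apply (is_RInt_Chasles (V := C_R_NormedModule)). Qed.

Lemma is_CInt_plus (f g : R -> C) (a b : R) (l m : C) :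
  is_CInt f a b l -> is_CInt g a b m -> is_CInt (fun x => f x + g x)%C a b (l + m)%C.
Proof. apply (is_RInt_plus (V := C_R_NormedModule)). Qed.

Lemma is_CInt_fst (f : R -> C) (a b : R) (l : C) :
  is_CInt f a b l -> is_RInt (fun t => Re (f t)) a b (Re l).
Proof. apply (is_RInt_fct_extend_fst (U := R_NormedModule) (V := R_NormedModule)). Qed.

Lemma is_CInt_snd (f : R -> C) (a b : R) (l : C) :
  is_CInt f a b l -> is_RInt (fun t => Im (f t)) a b (Im l).
Proof. apply (is_RInt_fct_extend_snd (U := R_NormedModule) (V := R_NormedModule)). Qed.

Lemma is_CInt_scal (k : C) (f : R -> C) (a b : R) (l : C) :
  is_CInt f a b l -> is_CInt (fun x => k * f x)%C a b (k * l)%C.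
Proof.
  intros H. generalize (is_CInt_fst _ _ _ _ H) (is_CInt_snd _ _ _ _ H). intros H1 H2.
  assert (S : forall (c : R) g (m : R), is_RInt g a b m -> is_RInt (fun x => c * g x) a b (c * m))
    by (intros; now apply (is_RInt_scal (V := R_NormedModule))).
  apply is_CInt_pair.
  - apply (is_RInt_minus (V := R_NormedModule) (fun t => fst k * Re (f t)) (fun t => snd k * Im (f t)));
      now apply S.
  - apply (is_RInt_plus (V := R_NormedModule) (fun t => fst k * Im (f t)) (fun t => snd k * Re (f t)));
      now apply S.
Qed.

Lemma is_CInt_zero (f : R -> C) (a b : R) :
  (forall x, Rmin a b < x < Rmax a b -> f x = RtoC 0) -> is_CInt f a b (RtoC 0).
Proof.
  intros H. apply is_CInt_ext with (fun _ => RtoC 0); [intros; symmetry; auto|].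
  refine (eq_ind _ (fun l => is_CInt (fun _ => RtoC 0) a b l)
    (is_RInt_const (V := C_R_NormedModule) a b (RtoC 0)) _ _).
  apply (scal_zero_r (V := C_R_NormedModule)).
Qed.

Lemma is_CInt_shift (f : R -> C) (e a b : R) (l : C) :
  is_CInt f (a + e) (b + e) l -> is_CInt (fun x => f (x + e)) a b l.
Proof.
  intros H.
  apply is_CInt_ext with (fun x => scal (V := C_R_NormedModule) 1 (f (1 * x + e))).
  - intros x _. rewrite Rmult_1_l. apply (scal_one (V := C_R_NormedModule)).
  - apply (is_RInt_comp_lin (V := C_R_NormedModule)). now rewrite !Rmult_1_l.
Qed.

Lemma is_CInt_derive (f : R -> C) (a b : R) : smooth f ->
  is_CInt (Cderive_n f 1) a b (f b - f a)%C.
Proof.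
  intros H. assert (H' := smooth_derive _ H).
  apply is_CInt_pair.
  - apply (is_RInt_derive (V := R_CompleteNormedModule) (fun t => Re (f t))); intros x _.
    + now apply smooth_is_derive_Re.
    + apply rsmooth_continuous. intros n y. apply H'.
  - apply (is_RInt_derive (V := R_CompleteNormedModule) (fun t => Im (f t))); intros x _.
    + now apply smooth_is_derive_Im.
    + apply rsmooth_continuous. intros n y. apply H'.
Qed.

Lemma CInt_plus (f g : R -> C) (a b : R) : smooth f -> smooth g ->
  CInt (fun x => f x + g x)%C a b = (CInt f a b + CInt g a b)%C.
Proof. intros Hf Hg. apply is_CInt_unique, is_CInt_plus; now apply is_CInt_correct. Qed.

Lemma CInt_scal (k : C) (f : R -> C) (a b : R) : smooth f ->
  CInt (fun x => k * f x)%C a b = (k * CInt f a b)%C.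
Proof. intros Hf. apply is_CInt_unique, is_CInt_scal; now apply is_CInt_correct. Qed.

Lemma CInt_Chasles (f : R -> C) (a b c : R) : smooth f ->
  CInt f a c = (CInt f a b + CInt f b c)%C.
Proof. intros Hf. apply is_CInt_unique. apply is_CInt_Chasles with b; now apply is_CInt_correct. Qed.

Lemma CInt_ext (f g : R -> C) (a b : R) : smooth f ->
  (forall x, Rmin a b < x < Rmax a b -> f x = g x) -> CInt f a b = CInt g a b.
Proof. intros Hf H. symmetry. apply is_CInt_unique. apply is_CInt_ext with f; auto. now apply is_CInt_correct. Qed.

Lemma CInt_zero (f : R -> C) (a b : R) :
  (forall x, Rmin a b < x < Rmax a b -> f x = RtoC 0) -> CInt f a b = RtoC 0.
Proof. intros H. now apply is_CInt_unique, is_CInt_zero. Qed.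

Lemma supported_le (psi : testfun) (c d c' d' : R) :
  supported psi c d -> c' <= c -> d <= d' -> supported psi c' d'.
Proof. intros H Hc Hd x Hx. apply H. lra. Qed.

Lemma test_supported (psi : testfun) : exists K, 0 < K /\ supported psi (- K) K.
Proof.
  destruct (tf_compact psi) as [K HK]. exists (Rmax K 1).
  assert (1 <= Rmax K 1) by apply Rmax_r. assert (K <= Rmax K 1) by apply Rmax_l.
  split; [lra|]. intros x Hx. apply HK. unfold Rabs. destruct Rcase_abs; lra.
Qed.

(** [regular] is a totalised improper integral, usable only once convergence is known. Here it
    converges trivially: the integrand vanishes outside the support, so all large enough intervals
    give the same integral. *)
Lemma regular_of_is_CInt (h : R -> C) (psi : testfun) (c d : R) (l : C) : c <= d ->
  supported psi c d -> is_CInt (fun x => h x * psi x)%C c d l -> regular h psi = l.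
Proof.
  intros Hcd Hs H. unfold regular.
  apply (is_RInt_gen_unique (V := C_R_CompleteNormedModule)).
  intros P HP. unfold filtermapi.
  apply (Filter_prod _ _ _ (fun a => a < c) (fun b => d < b)).
  - now exists c.
  - now exists d.
  - intros a b Ha Hb. exists l. split; [|now apply locally_singleton].
    replace l with ((0 + l) + 0)%C by ring.
    apply is_CInt_Chasles with d; [apply is_CInt_Chasles with c; auto|];
      apply is_CInt_zero; simpl; intros x Hx; rewrite Hs; try ring; minmax.
Qed.

Lemma regular_germs (h u v : R -> C) (psi : testfun) (c p d : R) :
  c <= p <= d -> supported psi c d -> smooth u -> smooth v ->
  (forall x, c < x < p -> h x = u x) -> (forall x, p < x < d -> h x = v x) ->
  regular h psi = (CInt (fun x => u x * psi x) c p + CInt (fun x => v x * psi x) p d)%C.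
Proof.
  intros Hp Hs Hu Hv Eu Ev. apply regular_of_is_CInt with c d; auto; [lra|].
  apply is_CInt_Chasles with p.
  - apply is_CInt_ext with (fun x => u x * psi x)%C.
    + intros x Hx. rewrite Eu; auto. minmax.
    + apply is_CInt_correct, smooth_mult; auto. apply sf_smooth.
  - apply is_CInt_ext with (fun x => v x * psi x)%C.
    + intros x Hx. rewrite Ev; auto. minmax.
    + apply is_CInt_correct, smooth_mult; auto. apply sf_smooth.
Qed.

Lemma glue_left (p x : R) (u v : R -> C) : x < p -> glue p u v x = u x.
Proof.
  intros H. unfold glue, heaviside. destruct (Rlt_dec 0 (p - x)), (Rlt_dec 0 (x - p)); try lra. ring.
Qed.

Lemma glue_right (p x : R) (u v : R -> C) : p < x -> glue p u v x = v x.
Proof.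
  intros H. unfold glue, heaviside. destruct (Rlt_dec 0 (p - x)), (Rlt_dec 0 (x - p)); try lra. ring.
Qed.

Lemma regular_glue (u v : R -> C) (psi : testfun) (c p d : R) :
  c <= p <= d -> supported psi c d -> smooth u -> smooth v ->
  regular (glue p u v) psi = (CInt (fun x => u x * psi x) c p + CInt (fun x => v x * psi x) p d)%C.
Proof.
  intros. apply regular_germs; auto; intros x Hx; [apply glue_left | apply glue_right]; lra.
Qed.

Lemma regular_smooth (u : R -> C) (psi : testfun) (c d : R) :
  c <= d -> supported psi c d -> smooth u ->
  regular u psi = CInt (fun x => u x * psi x)%C c d.
Proof.
  intros. apply regular_of_is_CInt with c d; auto.
  apply is_CInt_correct, smooth_mult; auto. apply sf_smooth.
Qed.

(** * Piecewise smooth functions plus derivatives of a Dirac measure *)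

Definition sf_derive (n : nat) (f : smoothfun) : smoothfun :=
  SmoothFun _ (smooth_Cderive_n f n (sf_smooth f)).

Definition sf_translate (e : R) (f : smoothfun) : smoothfun :=
  SmoothFun _ (smooth_translate f e (sf_smooth f)).

Definition sf_real (f : R -> R) (Hf : rsmooth f) : smoothfun :=
  SmoothFun _ (smooth_real f Hf).

Definition csum (a : nat -> C) (n : nat) : C := sum_n (G := C_AbelianMonoid) a n.

Lemma csum_S (a : nat -> C) (n : nat) : csum a (S n) = (csum a n + a (S n))%C.
Proof. apply (sum_Sn (G := C_AbelianMonoid)). Qed.

Lemma csum_0 (a : nat -> C) : csum a 0 = a 0%nat.
Proof. apply (sum_O (G := C_AbelianMonoid)). Qed.

Lemma csum_first (a : nat -> C) (n : nat) : csum a (S n) = (a 0%nat + csum (fun j => a (S j)) n)%C.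
Proof.
  induction n as [|n IH].
  - rewrite csum_S, !csum_0. reflexivity.
  - rewrite csum_S, IH, (csum_S (fun j => a (S j))). ring.
Qed.

Lemma csum_ext (a b : nat -> C) (n : nat) :
  (forall j, (j <= n)%nat -> a j = b j) -> csum a n = csum b n.
Proof. intros H. apply (sum_n_ext_loc (G := C_AbelianMonoid)), H. Qed.

Lemma csum_zero (a : nat -> C) (n : nat) :
  (forall j, (j <= n)%nat -> a j = RtoC 0) -> csum a n = RtoC 0.
Proof.
  induction n as [|n IH]; intros H; [rewrite csum_0; auto|].
  rewrite csum_S, IH, H by auto. ring.
Qed.

Lemma csum_scal (k : C) (a : nat -> C) (n : nat) :
  csum (fun j => k * a j)%C n = (k * csum a n)%C.
Proof.
  induction n as [|n IH]; [now rewrite !csum_0|]. rewrite !csum_S, IH. ring.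
Qed.

Lemma deriv_n_dirac (p : R) (j : nat) (psi : testfun) :
  deriv_n j (dirac p) psi = ((- (1)) ^ j * Cderive_n psi j p)%C.
Proof.
  revert psi. induction j as [|j IH]; intros psi.
  - rewrite Cderive_n_0. simpl. unfold dirac. ring.
  - simpl deriv_n. unfold deriv. rewrite IH. simpl test_derive.
    change (tf_fun (test_derive psi) : R -> C) with (Cderive_n psi 1).
    rewrite (Cderive_n_S psi). simpl. ring.
Qed.

(** [sum_(j <= n) c j delta_p^(j)] applied to [psi]. *)
Definition diracs (p : R) (n : nat) (c : nat -> C) (psi : testfun) : C :=
  csum (fun j => c j * ((- (1)) ^ j * Cderive_n psi j p))%C n.

Lemma coefficient_eq (p : R) (u v : R -> C) (n : nat) (c : nat -> C) (psi : testfun) :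
  coefficient p u v n c psi = (regular (glue p u v) psi + diracs p n c psi)%C.
Proof.
  unfold coefficient. f_equal. apply csum_ext. intros j _. now rewrite deriv_n_dirac.
Qed.

Lemma diracs_zero_loc (p : R) (n : nat) (c : nat -> C) (psi : testfun) :
  locally p (fun x => psi x = RtoC 0) -> diracs p n c psi = RtoC 0.
Proof.
  intros H. apply csum_zero. intros j _. rewrite Cderive_n_zero_loc by auto. ring.
Qed.

Lemma diracs_ext_loc (p : R) (n : nat) (c : nat -> C) (phi psi : testfun) :
  locally p (fun x => phi x = psi x) -> diracs p n c phi = diracs p n c psi.
Proof.
  intros H. apply csum_ext. intros j _. now rewrite (Cderive_n_ext_loc phi psi) by auto.
Qed.

Lemma supported_derive (psi : testfun) (c d : R) :
  supported psi c d -> supported (test_derive psi) c d.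
Proof.
  intros H x [Hx|Hx]; apply Cderive_n_zero_loc.
  - apply locally_Ioo with (x - 1) c; [lra|]. intros y Hy. apply H. lra.
  - apply locally_Ioo with d (x + 1); [lra|]. intros y Hy. apply H. lra.
Qed.

Lemma supported_mult (f : smoothfun) (psi : testfun) (c d : R) :
  supported psi c d -> supported (test_mult f psi) c d.
Proof. intros H x Hx. simpl. rewrite H by auto. ring. Qed.

Lemma supported_translate (e : R) (psi : testfun) (c d : R) :
  supported psi c d -> supported (test_translate e psi) (c - e) (d - e).
Proof. intros H x Hx. simpl. apply H. lra. Qed.

Lemma eq_on_deriv_n (c d : R) (F G : functional) (n : nat) :
  eq_on c d F G -> eq_on c d (deriv_n n F) (deriv_n n G).
Proof.
  induction n as [|n IH]; intros H; auto.
  intros psi c' d' Hc Hd Hs. simpl. unfold deriv. f_equal.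
  apply (IH H _ c' d'); auto. now apply supported_derive.
Qed.

Lemma eq_on_sub (c d c' d' : R) (F G : functional) :
  eq_on c d F G -> c <= c' -> d' <= d -> eq_on c' d' F G.
Proof. intros H Hc Hd psi a b Ha Hb Hs. apply (H psi a b); auto; lra. Qed.

Lemma eq_on_trans (c d : R) (F G H : functional) :
  eq_on c d F G -> eq_on c d G H -> eq_on c d F H.
Proof. intros H1 H2 psi a b Ha Hb Hs. rewrite (H1 psi a b), (H2 psi a b); auto. Qed.

Lemma eq_on_sym (c d : R) (F G : functional) : eq_on c d F G -> eq_on c d G F.
Proof. intros H psi a b Ha Hb Hs. symmetry. now apply (H psi a b). Qed.

(** A support interval may always be enlarged, so it can be made to straddle p, where the integrals
    are split. *)
Lemma eq_on_around (c d p : R) (F G : functional) : c < p < d ->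
  (forall (psi : testfun) c' d', c < c' < p -> p < d' < d -> supported psi c' d' -> F psi = G psi) ->
  eq_on c d F G.
Proof.
  intros Hp H psi a b Ha Hb Hs.
  apply (H psi (Rmin a ((c + p) / 2)) (Rmax b ((d + p) / 2))); [minmax| minmax|].
  apply supported_le with a b; auto; minmax.
Qed.

Lemma CInt_by_parts (u v : R -> C) (a b : R) : smooth u -> smooth v ->
  (CInt (fun x => u x * Cderive_n v 1 x) a b =
   u b * v b - u a * v a - CInt (fun x => Cderive_n u 1 x * v x) a b)%C.
Proof.
  intros Hu Hv.
  assert (Hu' := smooth_derive _ Hu). assert (Hv' := smooth_derive _ Hv).
  assert (E : CInt (Cderive_n (fun x => u x * v x)%C 1) a b = (u b * v b - u a * v a)%C).
  { apply is_CInt_unique, (is_CInt_derive (fun x => u x * v x)%C). now apply smooth_mult. }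
  rewrite <- E.
  rewrite (CInt_ext (Cderive_n (fun x => u x * v x)%C 1)
    (fun x => Cderive_n u 1 x * v x + u x * Cderive_n v 1 x)%C).
  - rewrite CInt_plus by now apply smooth_mult. ring.
  - apply (smooth_Cderive_n _ 1). now apply smooth_mult.
  - intros x _. now apply Cderive_mult.
Qed.

(** Dirac coefficients of the i-th derivative of u H(p - x) + v H(x - p) + sum c_j delta_p^(j): each
    differentiation raises the existing orders by one and adds the jump of the last derivative as
    coefficient of delta. *)
Fixpoint jumps (p : R) (u v : R -> C) (c : nat -> C) (i : nat) : nat -> C :=
  match i with
  | O => c
  | S i => fun j =>
      match j with
      | O => (Cderive_n v i p - Cderive_n u i p)%C
      | S k => jumps p u v c i k
      end
  end.

Lemma deriv_coefficient (p : R) (u v : smoothfun) (n : nat) (c : nat -> C) :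
  deriv (coefficient p u v n c) =
  coefficient p (Cderive_n u 1) (Cderive_n v 1) (S n) (jumps p u v c 1).
Proof.
  apply functional_extensionality. intros psi. unfold deriv. rewrite !coefficient_eq.
  destruct (test_supported psi) as [K [HK Hs]].
  (* The end points lie strictly beyond both the support and p: the boundary terms there vanish, and
     those at p produce the jump. *)
  set (a := Rmin (- K) p - 1). set (b := Rmax K p + 1).
  assert (Ha : a < - K /\ a < p) by (unfold a; minmax).
  assert (Hb : K < b /\ p < b) by (unfold b; minmax).
  assert (Hs' : supported psi a b) by (apply supported_le with (1 := Hs); lra).
  assert (Sp := sf_smooth psi). assert (Su := sf_smooth u). assert (Sv := sf_smooth v).
  rewrite (regular_glue u v (test_derive psi) a p b); auto using supported_derive; [|lra].
  rewrite (regular_glue (Cderive_n u 1) (Cderive_n v 1) psi a p b); auto using smooth_derive; [|lra].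
  change (tf_fun (test_derive psi) : R -> C) with (Cderive_n psi 1).
  rewrite !CInt_by_parts by auto.
  rewrite (Hs a), (Hs b) by lra.
  unfold diracs. rewrite csum_first. simpl (jumps _ _ _ _ _ _). rewrite !Cderive_n_0.
  rewrite (csum_ext (fun j => c j * _)%C
    (fun j => - (1) * (c j * ((- (1)) ^ S j * Cderive_n psi (S j) p)))%C).
  - rewrite csum_scal. simpl (_ ^ 0)%C. ring.
  - intros j _. rewrite (Cderive_n_S psi). simpl (_ ^ S _)%C.
    change (tf_fun (test_derive psi) : R -> C) with (Cderive_n psi 1). ring.
Qed.

Lemma deriv_n_coefficient (p : R) (u v : smoothfun) (n : nat) (c : nat -> C) (i : nat) :
  deriv_n i (coefficient p u v n c) =
  coefficient p (Cderive_n u i) (Cderive_n v i) (i + n) (jumps p u v c i).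
Proof.
  induction i as [|i IH].
  - simpl. f_equal; apply functional_extensionality; intros x; now rewrite Cderive_n_0.
  - simpl deriv_n. rewrite IH.
    rewrite (deriv_coefficient p (sf_derive i u) (sf_derive i v)). simpl sf_fun. reflexivity.
Qed.

Lemma in_A_coefficient (F : functional) (p : R) : in_A F ->
  exists (r : R) (u v : smoothfun) (n : nat) (c : nat -> C), 0 < r /\
    eq_on (p - r) (p + r) F (coefficient p u v n c).
Proof.
  intros [k [f [Hf HF]]].
  destruct (Cp_infty_germs f p Hf) as [r [u [v [Hr [Eu Ev]]]]].
  (* Locally [F] is the k-th derivative of a glued function, encoded with the single zero Dirac
     coefficient of index 0; hence the length k + 0. *)
  exists r, (sf_derive k u), (sf_derive k v), (k + 0)%nat, (jumps p u v (fun _ => RtoC 0) k).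
  split; auto. simpl sf_fun. rewrite <- deriv_n_coefficient.
  intros psi c d Hc Hd Hs. rewrite HF.
  revert psi c d Hc Hd Hs. apply (eq_on_deriv_n (p - r) (p + r) (regular f)).
  apply eq_on_around with p; [lra|]. intros psi c d Hc Hd Hs.
  rewrite coefficient_eq.
  rewrite (regular_germs f u v psi c p d), (regular_glue u v psi c p d); auto; try apply sf_smooth; try lra.
  - unfold diracs. rewrite csum_0. ring.
  - intros x Hx. apply Eu. lra.
  - intros x Hx. apply Ev. lra.
Qed.

(** * The fundamental lemma *)

Definition bump_on (c d x : R) : R := bump (/ (d - c) * x + - c / (d - c)).

Lemma bump_on_smooth (c d : R) : rsmooth (bump_on c d).
Proof. apply rsmooth_affine, bump_smooth. Qed.

Lemma bump_on_pos (c d x : R) : c < x < d -> 0 < bump_on c d x.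
Proof.
  intros H. apply bump_pos.
  replace (/ (d - c) * x + - c / (d - c)) with ((x - c) / (d - c)) by (field; lra).
  split; [apply Rdiv_lt_0_compat; lra|].
  apply Rmult_lt_reg_r with (d - c); [lra|]. field_simplify; lra.
Qed.

Lemma bump_on_zero (c d x : R) : c < d -> x <= c \/ d <= x -> bump_on c d x = 0.
Proof.
  intros H Hx. apply bump_zero.
  assert (0 < / (d - c)) by (apply Rinv_0_lt_compat; lra).
  replace (/ (d - c) * x + - c / (d - c)) with (/ (d - c) * (x - c)) by (field; lra).
  destruct Hx as [Hx|Hx]; [left | right].
  - assert (0 <= / (d - c) * (c - x)); [|lra]. apply Rmult_le_pos; lra.
  - apply Rmult_le_reg_l with (d - c); [lra|].
    replace ((d - c) * (/ (d - c) * (x - c))) with (x - c) by (field; lra). lra.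
Qed.

Lemma compact_of_interval (f : R -> C) (c d : R) :
  (forall x, x < c \/ d < x -> f x = RtoC 0) -> exists K, forall x, K < Rabs x -> f x = RtoC 0.
Proof.
  intros H. exists (Rmax (Rabs c) (Rabs d)). intros x Hx. apply H.
  assert (Rabs c < Rabs x) by (eapply Rle_lt_trans; [apply Rmax_l | apply Hx]).
  assert (Rabs d < Rabs x) by (eapply Rle_lt_trans; [apply Rmax_r | apply Hx]).
  unfold Rabs in *. repeat destruct Rcase_abs; lra.
Qed.

Lemma smooth_zero_of_tests (h : smoothfun) (a b : R) :
  (forall (psi : testfun) c d, a < c -> c < d -> d < b -> supported psi c d ->
     CInt (fun x => h x * psi x)%C c d = RtoC 0) ->
  forall x, a < x < b -> h x = RtoC 0.
Proof.
  intros H x0 Hx0. apply NNPP. intros N.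
  set (m := fun x => Re (h x) * Re (h x) + Im (h x) * Im (h x)).
  assert (Sh := sf_smooth h).
  assert (S1 : rsmooth (fun x => Re (h x))) by (intros n x; apply Sh).
  assert (S2 : rsmooth (fun x => Im (h x))) by (intros n x; apply Sh).
  assert (Sm : rsmooth m) by (apply rsmooth_plus; now apply rsmooth_mult).
  assert (Pm : 0 < m x0).
  { unfold m. apply Rnot_le_lt. intros L. apply N.
    assert (Re (h x0) = 0 /\ Im (h x0) = 0) as [E1 E2] by (split; nra).
    rewrite (surjective_pairing (h x0)). unfold Re, Im in *. now rewrite E1, E2. }
  assert (Lm : locally x0 (fun x => 0 < m x)).
  { apply (rsmooth_continuous m x0 Sm (fun y => 0 < y)).
    apply locally_open with (D := fun y => 0 < y); auto. apply open_gt. }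
  destruct Lm as [eta Heta].
  set (e := Rmin (eta / 2) (Rmin ((x0 - a) / 2) ((b - x0) / 2))).
  assert (He : 0 < e /\ e < eta /\ e < x0 - a /\ e < b - x0).
  { generalize (cond_pos eta). unfold e. minmax. }
  (* Testing [h] against its own conjugate times a bump makes the integrand |h|^2 times the bump,
     positive near [x0]. *)
  set (f := fun x => (Cconj (h x) * RtoC (bump_on (x0 - e) (x0 + e) x))%C).
  assert (Sf : smooth f).
  { apply smooth_mult; [apply smooth_conj, Sh | apply smooth_real, bump_on_smooth]. }
  assert (Zf : forall x, x < x0 - e \/ x0 + e < x -> f x = RtoC 0).
  { intros x Hx. unfold f. rewrite bump_on_zero by lra. ring. }
  set (psi := TestFun (SmoothFun f Sf) (compact_of_interval f _ _ Zf)).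
  specialize (H psi (x0 - e) (x0 + e) ltac:(lra) ltac:(lra) ltac:(lra) Zf).
  assert (G := is_CInt_correct (fun x => h x * psi x)%C (x0 - e) (x0 + e)
    (smooth_mult _ _ Sh Sf)).
  rewrite H in G. apply is_CInt_fst in G.
  apply (is_RInt_unique (V := R_CompleteNormedModule)) in G.
  assert (0 < RInt (fun x => m x * bump_on (x0 - e) (x0 + e) x) (x0 - e) (x0 + e)).
  { apply RInt_gt_0; [lra| |].
    - intros x Hx. apply Rmult_lt_0_compat; [|now apply bump_on_pos].
      apply Heta. apply Rabs_lt_between. unfold minus, plus, opp; simpl. lra.
    - intros x _. apply rsmooth_continuous, rsmooth_mult; [apply Sm | apply bump_on_smooth]. }
  rewrite (RInt_ext _ (fun t => Re (h t * psi t)%C)) in H0.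
  - rewrite G in H0. simpl in H0. lra.
  - intros x _. unfold psi, m, f; simpl. unfold Re, Im. ring.
Qed.

(** By continuity of the derivatives. Test functions see an equation only on open intervals; this
    carries it, with its whole jet, to the end points. *)
Lemma Cderive_n_zero_closure (h : R -> C) (a b p : R) (n : nat) : smooth h ->
  a < b -> a <= p <= b -> (forall x, a < x < b -> h x = RtoC 0) -> Cderive_n h n p = RtoC 0.
Proof.
  intros Sh Hab Hp H.
  assert (Z : forall x, a < x < b -> Cderive_n h n x = RtoC 0).
  { intros x Hx. apply Cderive_n_zero_loc, locally_Ioo with a b; auto. }
  assert (C := smooth_continuous _ p (smooth_Cderive_n _ n Sh)).
  destruct (Req_dec p a) as [->|Na].
  - apply (filterlim_locally_unique (K := R_AbsRing) (V := C_R_NormedModule) (F := at_right a) (Cderive_n h n)).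
    + apply filterlim_filter_le_1 with (2 := C). intros P HP. unfold at_right, within.
      revert HP; apply filter_imp; auto.
    + apply filterlim_ext_loc with (fun _ => RtoC 0); [|apply filterlim_const].
      apply at_right_Ioo with b; auto. intros x Hx. now rewrite Z.
  - destruct (Req_dec p b) as [->|Nb]; [|apply Z; lra].
    apply (filterlim_locally_unique (K := R_AbsRing) (V := C_R_NormedModule) (F := at_left b) (Cderive_n h n)).
    + apply filterlim_filter_le_1 with (2 := C). intros P HP. unfold at_left, within.
      revert HP; apply filter_imp; auto.
    + apply filterlim_ext_loc with (fun _ => RtoC 0); [|apply filterlim_const].
      apply at_left_Ioo with a; auto. intros x Hx. now rewrite Z.
Qed.

(** * Local form of the product *)

Definition Clim0 (f : R -> C) (l : C) : Prop :=
  filterlim f (at_right 0) (locally (T := C_UniformSpace) l).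

Lemma Clim0_plus (f g : R -> C) (l m : C) :
  Clim0 f l -> Clim0 g m -> Clim0 (fun e => f e + g e)%C (l + m)%C.
Proof.
  intros Hf Hg.
  apply (filterlim_comp_2 (G := locally (T := C_R_NormedModule) l) (H := locally (T := C_R_NormedModule) m)
    f g Cplus Hf Hg).
  apply (filterlim_plus (V := C_R_NormedModule)).
Qed.

Lemma Clim0_unique (f : R -> C) (l m : C) : Clim0 f l -> Clim0 f m -> l = m.
Proof.
  apply (filterlim_locally_unique (K := R_AbsRing) (V := C_R_NormedModule) (F := at_right 0) f).
Qed.

Lemma Clim0_ext (f g : R -> C) (l : C) (e0 : R) : 0 < e0 ->
  (forall e, 0 < e < e0 -> f e = g e) -> Clim0 f l -> Clim0 g l.
Proof.
  intros He H. apply filterlim_ext_loc. apply at_right_Ioo with e0; auto.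
Qed.

Lemma Clim0_norm (f : R -> C) (l : C) :
  (forall eps, 0 < eps -> exists d, 0 < d /\ forall e, 0 < e < d -> Cmod (f e - l) < eps) ->
  Clim0 f l.
Proof.
  intros H. apply (filterlim_locally_ball_norm (K := R_AbsRing) (U := C_R_NormedModule)).
  intros eps. destruct (H eps (cond_pos eps)) as [d [Hd1 Hd2]].
  apply at_right_Ioo with d; auto.
  intros e He. unfold ball_norm. rewrite <- Cmod_norm. now apply Hd2.
Qed.

Lemma Clim0_at (f : R -> C) (p s : R) : continuous (U := C_UniformSpace) f p ->
  Clim0 (fun e => f (p + s * e)) (f p).
Proof.
  intros H. unfold Clim0. replace (f p) with (f (p + s * 0)) by (f_equal; ring).
  assert (C : continuous (fun e => p + s * e) 0).
  { apply rsmooth_continuous, (rsmooth_plus (fun _ => p)); [apply rsmooth_const|].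
    apply rsmooth_mult; [apply rsmooth_const | apply rsmooth_id]. }
  apply (filterlim_comp _ _ _ (fun e => p + s * e) f _ (locally (p + s * 0))).
  - apply filterlim_filter_le_1 with (2 := C). intros P HP. unfold at_right, within.
    revert HP. apply filter_imp. auto.
  - replace (p + s * 0) with p by ring. exact H.
Qed.

Lemma Cmod_CInt_le (f : R -> C) (a b M : R) : a <= b -> smooth f ->
  (forall x, a <= x <= b -> Cmod (f x) <= M) -> Cmod (CInt f a b) <= (b - a) * M.
Proof.
  intros Hab Hf H.
  rewrite Cmod_norm.
  apply (norm_RInt_le_const (V := C_R_NormedModule) f a b); auto; [|now apply is_CInt_correct].
  intros x Hx. rewrite <- Cmod_norm. auto.
Qed.

Lemma smooth_Cmod_bounded (f : R -> C) (a b : R) : smooth f ->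
  exists M, 0 < M /\ forall x, a <= x <= b -> Cmod (f x) <= M.
Proof.
  intros Hf.
  destruct (bounded_continuity (K := R_AbsRing) (V := C_R_NormedModule) f a b) as [M HM].
  { intros x _. now apply smooth_continuous. }
  exists (Rmax M 1). split; [apply Rlt_le_trans with 1; [lra | apply Rmax_r]|].
  intros x Hx. apply Rle_trans with M; [rewrite Cmod_norm; now apply Rlt_le, HM | apply Rmax_l].
Qed.

Lemma CInt_translate_lim (k h : R -> C) (a b : R) : a <= b -> smooth k -> smooth h ->
  Clim0 (fun e => CInt (fun x => k x * h (x + e)%R) a b)%C (CInt (fun x => k x * h x) a b)%C.
Proof.
  intros Hab Hk Hh. apply Clim0_norm. intros eps Heps.
  destruct (smooth_Cmod_bounded k a b Hk) as [M [HM0 HM]].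
  (* The added 1 keeps [L] positive when a = b and makes the final inequality strict. *)
  set (L := (b - a + 1) * M).
  assert (HL : 0 < L) by (apply Rmult_lt_0_compat; lra).
  assert (He : 0 < eps / L) by now apply Rdiv_lt_0_compat.
  destruct (unifcont_normed_1d (K := R_AbsRing) (V := C_R_NormedModule) h a (b + 1)
    ltac:(intros; now apply smooth_continuous) (mkposreal _ He)) as [d Hd].
  exists (Rmin d 1). split; [apply Rmin_glb_lt; [apply cond_pos | lra]|].
  intros e He'. assert (Hed : e < d /\ e < 1) by minmax.
  assert (Hd' : forall x, a <= x <= b -> Cmod (h (x + e)%R - h x) < eps / L).
  { intros x Hx. rewrite Cmod_norm. apply (Hd x (x + e)); try lra.
    change (Rabs (x + e - x) < d). rewrite Rabs_right; lra. }
  assert (St := smooth_translate h e Hh).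
  replace (CInt (fun x => k x * h (x + e)%R) a b - CInt (fun x => k x * h x) a b)%C
    with (CInt (fun x => k x * h (x + e)%R + - (1) * (k x * h x)) a b)%C.
  - apply Rle_lt_trans with ((b - a) * (M * (eps / L))).
    + apply Cmod_CInt_le; auto.
      * apply smooth_plus; [now apply smooth_mult|].
        apply smooth_mult; [apply smooth_const | now apply smooth_mult].
      * intros x Hx.
        replace (k x * h (x + e)%R + - (1) * (k x * h x))%C with (k x * (h (x + e)%R - h x))%C by ring.
        rewrite Cmod_mult. apply Rmult_le_compat; auto using Cmod_ge_0.
        apply Rlt_le, Hd', Hx.
    + apply Rlt_le_trans with ((b - a + 1) * (M * (eps / L))).
      * apply Rmult_lt_compat_r; [apply Rmult_lt_0_compat|]; lra.
      * right. unfold L. field. lra.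
  - rewrite CInt_plus, CInt_scal; try apply smooth_mult; auto using smooth_const; try ring.
    apply smooth_mult; auto.
Qed.

(** The integrand stays bounded while the interval has length e. This disposes of the strip between
    the two singularities. *)
Lemma CInt_shrink_lim (k h : R -> C) (p : R) : smooth k -> smooth h ->
  Clim0 (fun e => CInt (fun x => k x * h (x + e)%R) (p - e) p)%C (RtoC 0).
Proof.
  intros Hk Hh. apply Clim0_norm. intros eps Heps.
  destruct (smooth_Cmod_bounded k (p - 1) p Hk) as [M [HM0 HM]].
  destruct (smooth_Cmod_bounded h (p - 1) (p + 1) Hh) as [N [HN0 HN]].
  assert (HMN : 0 < M * N) by now apply Rmult_lt_0_compat.
  exists (Rmin 1 (eps / (M * N))). split; [apply Rmin_glb_lt; [lra | now apply Rdiv_lt_0_compat]|].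
  intros e He. assert (He' : e < 1 /\ e < eps / (M * N)) by minmax.
  replace (CInt (fun x => k x * h (x + e)%R) (p - e) p - RtoC 0)%C
    with (CInt (fun x => k x * h (x + e)%R) (p - e) p)%C by ring.
  apply Rle_lt_trans with ((p - (p - e)) * (M * N)).
  - apply Cmod_CInt_le; [lra| |].
    + apply smooth_mult; auto. now apply smooth_translate.
    + intros x Hx. rewrite Cmod_mult. apply Rmult_le_compat; auto using Cmod_ge_0.
      * apply HM; lra.
      * apply HN; lra.
  - apply Rlt_le_trans with (eps / (M * N) * (M * N)).
    + apply Rmult_lt_compat_r; lra.
    + right. field. lra.
Qed.

(** Induction through the product rule, with both factors general because each step differentiates
    one of them; order 0 is continuity of [g]. *)
Lemma Cderive_n_translate_mult_lim (p : R) (j : nat) : forall g f : R -> C, smooth g -> smooth f ->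
  Clim0 (fun e => Cderive_n (fun x => g (x + e)%R * f x)%C j p) (Cderive_n (fun x => g x * f x)%C j p).
Proof.
  induction j as [|j IH]; intros g f Hg Hf.
  - rewrite Cderive_n_0.
    apply (Clim0_ext (fun e => (fun x => g x * f p)%C (p + 1 * e)) _ _ 1); [lra| |].
    + intros e _. now rewrite Cderive_n_0, Rmult_1_l.
    + apply (Clim0_at (fun x => g x * f p)%C).
      apply smooth_continuous, smooth_mult; auto. apply smooth_const.
  - rewrite Cderive_n_mult_S by auto.
    assert (Dg := smooth_derive _ Hg). assert (Df := smooth_derive _ Hf).
    apply (Clim0_ext (fun e => Cderive_n (fun x => Cderive_n g 1 (x + e)%R * f x) j p
       + Cderive_n (fun x => g (x + e)%R * Cderive_n f 1 x) j p)%C _ _ 1); [lra| |].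
    + intros e _. rewrite Cderive_n_mult_S by auto using smooth_translate.
      f_equal. f_equal. apply functional_extensionality. intros x.
      now rewrite Cderive_n_translate.
    + apply Clim0_plus; now apply IH.
Qed.

Lemma csum_lim (a : R -> nat -> C) (l : nat -> C) (n : nat) :
  (forall j, Clim0 (fun e => a e j) (l j)) -> Clim0 (fun e => csum (a e) n) (csum l n).
Proof.
  intros H. induction n as [|n IH].
  - rewrite csum_0. apply (Clim0_ext (fun e => a e 0%nat) _ _ 1); [lra| |apply H].
    intros; now rewrite csum_0.
  - rewrite csum_S. apply (Clim0_ext (fun e => csum (a e) n + a e (S n))%C _ _ 1); [lra| |].
    + intros; now rewrite csum_S.
    + now apply Clim0_plus.
Qed.

Lemma Clim0_scal (k : C) (f : R -> C) (l : C) : Clim0 f l -> Clim0 (fun e => k * f e)%C (k * l)%C.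
Proof.
  intros H. apply (Clim0_norm). intros eps Heps.
  assert (Hk : 0 <= Cmod k) by apply Cmod_ge_0.
  assert (He : 0 < eps / (Cmod k + 1)) by (apply Rdiv_lt_0_compat; lra).
  destruct (proj1 (filterlim_locally_ball_norm (K := R_AbsRing) (U := C_R_NormedModule) f l) H
    (mkposreal _ He)) as [d Hd].
  exists d. split; [apply cond_pos|]. intros e Hed.
  assert (Q : Cmod (f e - l) < eps / (Cmod k + 1)).
  { rewrite Cmod_norm. apply (Hd e); [|lra].
    change (Rabs (e - 0) < d). rewrite Rabs_right; lra. }
  replace (k * f e - k * l)%C with (k * (f e - l))%C by ring. rewrite Cmod_mult.
  apply Rle_lt_trans with (Cmod k * (eps / (Cmod k + 1))).
  - apply Rmult_le_compat_l; lra.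
  - apply Rlt_le_trans with ((Cmod k + 1) * (eps / (Cmod k + 1))).
    + apply Rmult_lt_compat_r; lra.
    + right. field. lra.
Qed.

Lemma diracs_lim (p : R) (n : nat) (c : nat -> C) (f : R -> testfun) (psi : testfun) :
  (forall j, Clim0 (fun e => Cderive_n (f e) j p) (Cderive_n psi j p)) ->
  Clim0 (fun e => diracs p n c (f e)) (diracs p n c psi).
Proof.
  intros H. apply csum_lim. intros j. apply Clim0_scal, Clim0_scal, H.
Qed.

Lemma distribution_plus (P : functional) (phi psi chi : testfun) : is_distribution P ->
  (forall x, chi x = phi x + psi x)%C -> P chi = (P phi + P psi)%C.
Proof.
  intros [H _] E. rewrite (H 1 1 phi psi chi)%C; [ring|]. intros x. rewrite E. ring.
Qed.

Lemma eq_on_right (p r e : R) (G : functional) (u v : smoothfun) (n : nat) (c : nat -> C) :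
  0 < e < r -> eq_on (p - r) (p + r) G (coefficient p u v n c) ->
  eq_on (p - e) (p + r - e) (translate e G) (regular (sf_translate e v)).
Proof.
  intros He H. apply eq_on_around with p; [lra|]. intros psi a b Ha Hb Hs.
  unfold translate.
  assert (Hs' := supported_translate (- e) psi a b Hs).
  rewrite (H _ (a - - e) (b - - e) ltac:(lra) ltac:(lra) Hs'), coefficient_eq, diracs_zero_loc.
  (* The splitting point is placed at the left end of the support, so the first integral is over a
     degenerate interval and only [v] contributes. *)
  - rewrite (regular_germs _ v v _ (a - - e) (a - - e) (b - - e)); auto; try apply sf_smooth; try lra.
    + rewrite (CInt_zero _ (a - - e) (a - - e)) by (intros x Hx; minmax).
      rewrite (regular_smooth (sf_translate e v) psi a b); auto; [|lra|apply sf_smooth].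
      rewrite <- (is_CInt_unique (fun x => sf_translate e v x * psi x)%C a b
        (CInt (fun x => v x * test_translate (- e) psi x) (a - - e) (b - - e))%C); [ring|].
      apply (is_CInt_ext (fun x => (fun y => v y * test_translate (- e) psi y)%C (x + e))).
      { intros x _. simpl. f_equal. f_equal. ring. }
      apply (is_CInt_shift (fun y => v y * test_translate (- e) psi y)%C).
      replace (a + e) with (a - - e) by ring. replace (b + e) with (b - - e) by ring.
      apply is_CInt_correct, smooth_mult; [apply sf_smooth | apply smooth_translate, sf_smooth].
    + intros x Hx. lra.
    + intros x Hx. apply glue_right. lra.
  - apply locally_Ioo with (p - 1) (a - - e); [lra|]. intros y Hy. apply Hs'. lra.
Qed.

Lemma eq_on_left (p r : R) (F : functional) (u v : smoothfun) (n : nat) (c : nat -> C) :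
  0 < r -> eq_on (p - r) (p + r) F (coefficient p u v n c) ->
  eq_on (p - r) p F (regular u).
Proof.
  intros Hr H. apply eq_on_around with (p - r / 2); [lra|]. intros psi a b Ha Hb Hs.
  rewrite (H psi a b), coefficient_eq, diracs_zero_loc; auto; try lra.
  - rewrite (regular_germs _ u u psi a b b); auto; try apply sf_smooth; try lra.
    + rewrite (CInt_zero _ b b) by (intros x Hx; minmax).
      rewrite (regular_smooth u psi a b); auto; [ring|lra|apply sf_smooth].
    + intros x Hx. apply glue_left. lra.
    + intros x Hx. lra.
  - apply locally_Ioo with b (p + 1); [lra|]. intros y Hy. apply Hs. lra.
Qed.

(* For [0 < e] the factors [F] and [G(. + e)] are singular only at [p] and
   [p - e]; a cutoff [s] with transition in [(p - e, p)] separates the two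
   contributions, and all terms containing [s] recombine. *)
Lemma hormander_local (F G Pe : functional) (p r c1 d1 e : R) (u v u' v' : smoothfun)
  (n n' : nat) (c c' : nat -> C) (psi : testfun) :
  eq_on (p - r) (p + r) F (coefficient p u v n c) ->
  eq_on (p - r) (p + r) G (coefficient p u' v' n' c') ->
  is_hormander_product F (translate e G) Pe ->
  p - r < c1 < p -> p < d1 < p + r -> supported psi c1 d1 ->
  0 < e -> e < p - c1 -> e < p + r - d1 ->
  Pe psi =
    (CInt (fun x => (u x * psi x) * u' (x + e)%R) c1 (p - e) +
     CInt (fun x => (u x * psi x) * v' (x + e)%R) (p - e) p +
     CInt (fun x => (v x * psi x) * v' (x + e)%R) p d1 +
     diracs p n c (test_mult (sf_translate e v') psi) +
     diracs p n' c' (test_translate (- e) (test_mult u psi)))%C.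
Proof.
  intros HF HG [HD [_ [H1 H2]]] Hc Hd Hs He Hec Hed.
  set (s := step (p - 2 / 3 * e) (p - 1 / 3 * e)).
  assert (s0 : forall x, x <= p - 2 / 3 * e -> s x = 0) by (intros; apply step_0; lra).
  assert (s1 : forall x, p - 1 / 3 * e <= x -> s x = 1) by (intros; apply step_1; lra).
  set (t := fun x => 1 + - s x).
  assert (Hsm : rsmooth s) by apply step_smooth.
  assert (Htm : rsmooth t)
    by (apply (rsmooth_plus (fun _ => 1)); [apply rsmooth_const | now apply rsmooth_opp]).
  assert (t1 : forall x, x <= p - 2 / 3 * e -> t x = 1) by (intros; unfold t; rewrite s0; lra).
  assert (t0 : forall x, p - 1 / 3 * e <= x -> t x = 0) by (intros; unfold t; rewrite s1; lra).
  set (psi1 := test_mult (sf_real s Hsm) psi). set (psi2 := test_mult (sf_real t Htm) psi).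
  assert (E1 : forall x, psi1 x = (RtoC (s x) * psi x)%C) by reflexivity.
  assert (E2 : forall x, psi2 x = (RtoC (t x) * psi x)%C) by reflexivity.
  rewrite (distribution_plus Pe psi1 psi2 psi HD).
  2: { intros x. rewrite E1, E2. unfold t. rewrite RtoC_plus, RtoC_opp. ring. }
  (* [psi1] lives to the right of p - e, where G(. + e) is the smooth function v'(. + e); [psi2]
     lives to the left of p, where F is [u]. On each piece the product is thus multiplication by a
     smooth function. *)
  rewrite (H2 _ _ _ (eq_on_right p r e G u' v' n' c' ltac:(lra) HG) psi1 (p - 2 / 3 * e) d1); try lra.
  2: { intros x Hx. rewrite E1. destruct Hx; [rewrite s0 by lra | rewrite Hs by lra]; ring. }
  rewrite (H1 _ _ _ (eq_on_left p r F u v n c ltac:(lra) HF) psi2 c1 (p - 1 / 3 * e)); try lra.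
  2: { intros x Hx. rewrite E2. destruct Hx; [rewrite Hs by lra | rewrite t0 by lra]; ring. }
  unfold smooth_times, translate.
  set (T1 := test_mult (sf_translate e v') psi1).
  set (T2 := test_translate (- e) (test_mult u psi2)).
  assert (ET1 : forall x, T1 x = (v' (x + e)%R * (RtoC (s x) * psi x))%C) by reflexivity.
  assert (ET2 : forall x, T2 x = (u (x + - e)%R * (RtoC (t (x + - e)%R) * psi (x + - e)%R))%C) by reflexivity.
  assert (ST1 : supported T1 c1 d1) by now apply supported_mult, supported_mult.
  assert (ST2 : supported T2 (c1 - - e) (d1 - - e))
    by now apply supported_translate, supported_mult, supported_mult.
  assert (Su := sf_smooth u). assert (Sv := sf_smooth v).
  assert (Su' := sf_smooth u'). assert (Sv' := sf_smooth v').
  assert (Sp := sf_smooth psi). assert (SsC := smooth_real s Hsm). assert (StC := smooth_real t Htm).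
  assert (ST1' := sf_smooth T1). assert (ST2' := sf_smooth T2).
  assert (Sue := smooth_translate u' e Su'). assert (Sve := smooth_translate v' e Sv').
  assert (Sup := smooth_mult _ _ Su Sp). assert (Svp := smooth_mult _ _ Sv Sp).
  rewrite (HF T1 c1 d1), (HG T2 (c1 - - e) (d1 - - e)), !coefficient_eq by (auto; lra).
  rewrite (regular_glue u v T1 c1 p d1), (regular_glue u' v' T2 (c1 - - e) p (d1 - - e)) by (auto; lra).
  (* The cutoff is 1 near p and 0 near p - e, so each Dirac part sees the uncut test function. *)
  rewrite (diracs_ext_loc p n c T1 (test_mult (sf_translate e v') psi)).
  2: { apply locally_Ioo with (p - 1 / 3 * e) (p + 1); [lra|]. intros x Hx.
       rewrite ET1, s1 by lra. simpl. ring. }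
  rewrite (diracs_ext_loc p n' c' T2 (test_translate (- e) (test_mult u psi))).
  2: { apply locally_Ioo with (p - 1) (p + 1 / 3 * e); [lra|]. intros x Hx.
       rewrite ET2. rewrite t1 by lra. simpl. ring. }
  (* The terms from [G] are integrals in the shifted variable; the substitution x -> x + e brings
     them back to that of [F]. *)
  assert (Sh : forall (g : smoothfun) a b,
    CInt (fun x => g x * T2 x)%C (a - - e) (b - - e) =
    CInt (fun x => (u x * psi x) * g (x + e)%R * RtoC (t x))%C a b).
  { intros g a b. symmetry. apply is_CInt_unique.
    apply (is_CInt_ext (fun x => (fun y => g y * T2 y)%C (x + e))).
    { intros x _. rewrite ET2. replace (x + e + - e) with x by ring. ring. }
    apply (is_CInt_shift (fun y => g y * T2 y)%C). replace (a + e) with (a - - e) by ring. replace (b + e) with (b - - e) by ring.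
    apply is_CInt_correct, smooth_mult; auto using sf_smooth. }
  assert (L1 : CInt (fun x => u' x * T2 x)%C (c1 - - e) p =
    CInt (fun x => (u x * psi x) * u' (x + e)%R)%C c1 (p - e)).
  { replace p with (p - e - - e) at 1 by ring. rewrite Sh. apply CInt_ext.
    - apply smooth_mult; auto. now apply smooth_mult.
    - intros x Hx. rewrite t1 by minmax. ring. }
  assert (L2 : CInt (fun x => v' x * T2 x)%C p (d1 - - e) =
    CInt (fun x => (u x * psi x) * v' (x + e)%R * RtoC (t x))%C (p - e) p).
  { replace p with (p - e - - e) at 1 by ring. rewrite Sh.
    rewrite (CInt_Chasles _ (p - e) p d1) by (apply smooth_mult; auto; now apply smooth_mult).
    rewrite (CInt_zero _ p d1); [ring|]. intros x Hx. rewrite t0 by minmax. ring. }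
  assert (L3 : CInt (fun x => u x * T1 x)%C c1 p =
    CInt (fun x => (u x * psi x) * v' (x + e)%R * RtoC (s x))%C (p - e) p).
  { rewrite (CInt_Chasles _ c1 (p - e) p) by (apply smooth_mult; auto).
    rewrite (CInt_zero _ c1 (p - e)), Cplus_0_l.
    - apply CInt_ext; [apply smooth_mult; auto|]. intros x _. rewrite ET1. ring.
    - intros x Hx. rewrite ET1, s0 by minmax. ring. }
  assert (L4 : CInt (fun x => v x * T1 x)%C p d1 =
    CInt (fun x => (v x * psi x) * v' (x + e)%R)%C p d1).
  { apply CInt_ext; [apply smooth_mult; auto|]. intros x Hx. rewrite ET1, s1 by minmax. ring. }
  assert (L5 : CInt (fun x => (u x * psi x) * v' (x + e)%R)%C (p - e) p =
    (CInt (fun x => (u x * psi x) * v' (x + e)%R * RtoC (s x)) (p - e) p +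
     CInt (fun x => (u x * psi x) * v' (x + e)%R * RtoC (t x)) (p - e) p)%C).
  { rewrite <- CInt_plus by (apply smooth_mult; auto; now apply smooth_mult).
    apply CInt_ext; [now apply smooth_mult|]. intros x _. unfold t.
    rewrite RtoC_plus, RtoC_opp. ring. }
  rewrite L1, L2, L3, L4, L5. ring.
Qed.

(** The explicit product formula, read off near p: Dirac terms of the left factor take the right
    germ of the other, Dirac terms of the right factor take the left germ. *)
Lemma star_local (F G P : functional) (p r c1 d1 : R) (u v u' v' : smoothfun)
  (n n' : nat) (c c' : nat -> C) (psi : testfun) :
  is_star F G P ->
  eq_on (p - r) (p + r) F (coefficient p u v n c) ->
  eq_on (p - r) (p + r) G (coefficient p u' v' n' c') ->
  p - r < c1 < p -> p < d1 < p + r -> supported psi c1 d1 ->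
  P psi =
    (CInt (fun x => u x * u' x * psi x) c1 p +
     CInt (fun x => v x * v' x * psi x) p d1 +
     diracs p n c (test_mult v' psi) + diracs p n' c' (test_mult u psi))%C.
Proof.
  intros [_ [Pe [HPe Hlim]]] HF HG Hc Hd Hs.
  assert (Su := sf_smooth u). assert (Sv := sf_smooth v).
  assert (Su' := sf_smooth u'). assert (Sv' := sf_smooth v').
  assert (Sp := sf_smooth psi).
  assert (Sup := smooth_mult _ _ Su Sp). assert (Svp := smooth_mult _ _ Sv Sp).
  apply (Clim0_unique (fun e => Pe e psi)); [apply Hlim|].
  destruct HPe as [e0 He0].
  (* The integral over [c1, p - e] is rewritten as one over [c1, p] minus one over [p - e, p], so
     that every term has either a fixed domain or a shrinking one. *)
  apply (Clim0_ext (fun e => (CInt (fun x => (u x * psi x) * u' (x + e)%R) c1 p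
      + - (1) * CInt (fun x => (u x * psi x) * u' (x + e)%R) (p - e) p) +
     CInt (fun x => (u x * psi x) * v' (x + e)%R) (p - e) p +
     CInt (fun x => (v x * psi x) * v' (x + e)%R) p d1 +
     diracs p n c (test_mult (sf_translate e v') psi) +
     diracs p n' c' (test_translate (- e) (test_mult u psi)))%C _ _
     (Rmin e0 (Rmin (p - c1) (p + r - d1)))).
  - generalize (cond_pos e0). minmax.
  - intros e He.
    assert (He' : e < e0 /\ e < p - c1 /\ e < p + r - d1) by minmax.
    rewrite (hormander_local F G (Pe e) p r c1 d1 e u v u' v' n n' c c' psi); auto; try lra.
    + rewrite (CInt_Chasles _ c1 (p - e) p) by (apply smooth_mult; auto using smooth_translate). ring.
    + apply He0; [|lra]. change (Rabs (e - 0) < e0). rewrite Rabs_right; lra.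
  - replace (CInt (fun x => u x * u' x * psi x) c1 p)%C with
      (CInt (fun x => (u x * psi x) * u' x) c1 p + - (1) * 0 + 0)%C.
    replace (CInt (fun x => v x * v' x * psi x) p d1)%C with
      (CInt (fun x => (v x * psi x) * v' x) p d1)%C.
    + apply Clim0_plus; [apply Clim0_plus; [apply Clim0_plus; [apply Clim0_plus; [apply Clim0_plus|]|]|]|].
      * apply (CInt_translate_lim (fun x => u x * psi x)%C u'); auto; lra.
      * apply Clim0_scal, (CInt_shrink_lim (fun x => u x * psi x)%C u'); auto.
      * apply (CInt_shrink_lim (fun x => u x * psi x)%C v'); auto.
      * apply (CInt_translate_lim (fun x => v x * psi x)%C v'); auto; lra.
      * apply diracs_lim. intros j. now apply Cderive_n_translate_mult_lim.
      * apply diracs_lim. intros j.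
        apply (Clim0_ext (fun e => Cderive_n (test_mult u psi) j (p + - (1) * e)) _ _ 1); [lra| |].
        -- intros e _. simpl sf_fun. rewrite (Cderive_n_translate (fun x => u x * psi x)%C).
           f_equal. ring.
        -- apply Clim0_at, smooth_continuous, smooth_Cderive_n. exact Sup.
    + apply CInt_ext; [now apply smooth_mult|]. intros; ring.
    + rewrite (CInt_ext _ (fun x => u x * u' x * psi x)%C); [ring|now apply smooth_mult|].
      intros; ring.
Qed.

(** * The equation near a point *)

(** The j-th derivative of a product in terms of the two jets. The product rule recursion is used
    instead of binomial coefficients, so that it reduces by computation for numeral j. *)
Fixpoint leibniz (j : nat) (G F : nat -> C) : C :=
  match j with
  | O => (G 0%nat * F 0%nat)%C
  | S j => (leibniz j (fun i => G (S i)) F + leibniz j G (fun i => F (S i)))%C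
  end.

Lemma Cderive_n_mult (g f : R -> C) (j : nat) (p : R) : smooth g -> smooth f ->
  Cderive_n (fun x => g x * f x)%C j p =
  leibniz j (fun i => Cderive_n g i p) (fun i => Cderive_n f i p).
Proof.
  revert g f. induction j as [|j IH]; intros g f Hg Hf.
  - simpl. now rewrite !Cderive_n_0.
  - rewrite Cderive_n_mult_S by auto. simpl.
    rewrite !IH by auto using smooth_derive.
    f_equal; f_equal; apply functional_extensionality; intros i; now rewrite Cderive_n_S.
Qed.

Lemma leibniz_zero (j : nat) (G F : nat -> C) :
  (forall i, (i <= j)%nat -> F i = RtoC 0) -> leibniz j G F = RtoC 0.
Proof.
  revert G F. induction j as [|j IH]; intros G F H; simpl.
  - rewrite H by lia. ring.
  - rewrite !IH; [ring|intros; apply H; lia ..].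
Qed.

Lemma leibniz_first (j : nat) (G F : nat -> C) :
  (forall i, (i < j)%nat -> F i = RtoC 0) -> leibniz j G F = (G 0%nat * F j)%C.
Proof.
  revert G F. induction j as [|j IH]; intros G F H; simpl; auto.
  rewrite leibniz_zero, IH; [ring|intros; apply H; lia ..].
Qed.

(** * Extraction of Dirac coefficients by test functions *)

Definition kronecker (m i : nat) : C := if Nat.eqb i m then RtoC 1 else RtoC 0.

Lemma kronecker_eq (m : nat) : kronecker m m = RtoC 1.
Proof. unfold kronecker. now rewrite Nat.eqb_refl. Qed.

Lemma kronecker_neq (m i : nat) : i <> m -> kronecker m i = RtoC 0.
Proof. intros H. unfold kronecker. now destruct (Nat.eqb_spec i m). Qed.

(** The Taylor monomial (x - p)^m / m! cut off near p. Its jet at p is a unit vector, so pairing a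
    Dirac sum with it gives (-1)^m times the coefficient of delta^(m). *)
Lemma monomial_test (p r : R) (m : nat) : 0 < r ->
  exists psi : testfun, supported psi (p - r) (p + r) /\
    forall j, Cderive_n psi j p = kronecker m j.
Proof.
  intros Hr.
  set (s := fun x => step (p - r) (p - r / 2) x * (1 + - step (p + r / 2) (p + r) x)).
  assert (Ss : rsmooth s).
  { apply rsmooth_mult; [apply step_smooth|].
    apply (rsmooth_plus (fun _ => 1)); [apply rsmooth_const | apply rsmooth_opp, step_smooth]. }
  set (f := fun x => RtoC (monomial p m x * s x)).
  assert (Sf : smooth f) by (apply smooth_real, rsmooth_mult; [apply monomial_smooth | exact Ss]).
  assert (Zf : forall x, x < p - r \/ p + r < x -> f x = RtoC 0).
  { intros x Hx. unfold f, s. f_equal.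
    destruct Hx; [rewrite (step_0 (p - r)) by lra | rewrite (step_1 (p + r / 2)) by lra]; ring. }
  exists (TestFun (SmoothFun f Sf) (compact_of_interval f _ _ Zf)). split; [exact Zf|].
  intros j. simpl.
  rewrite (Cderive_n_ext_loc f (fun x => RtoC (monomial p m x))).
  - unfold Cderive_n, kronecker, RtoC; simpl. rewrite Derive_n_monomial.
    rewrite (Derive_n_zero_loc _ j p) by now apply filter_forall.
    now destruct Nat.eq_dec, (Nat.eqb_spec j m).
  - apply locally_Ioo with (p - r / 2) (p + r / 2); [lra|]. intros x Hx.
    unfold f, s. rewrite step_1, step_0 by lra. f_equal. ring.
Qed.

Lemma diracs_mult (p : R) (n : nat) (e : nat -> C) (g : smoothfun) (psi : testfun) :
  diracs p n e (test_mult g psi) =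
  csum (fun j => e j * ((- (1)) ^ j *
    leibniz j (fun i => Cderive_n g i p) (fun i => Cderive_n psi i p)))%C n.
Proof.
  apply csum_ext. intros j _. f_equal. f_equal.
  apply Cderive_n_mult; apply sf_smooth.
Qed.

(** Multiplying delta^(j) by a smooth function produces orders at most j only, so order m receives
    nothing from j < m. *)
Lemma diracs_mult_zero (p : R) (n m : nat) (e : nat -> C) (g : smoothfun) (psi : testfun) :
  (forall j, Cderive_n psi j p = kronecker m j) ->
  (forall j, (m <= j <= n)%nat -> e j = RtoC 0) ->
  diracs p n e (test_mult g psi) = RtoC 0.
Proof.
  intros Hp He. rewrite diracs_mult. apply csum_zero. intros j Hj.
  destruct (le_lt_dec m j) as [L|L]; [rewrite He by lia; ring|].
  rewrite leibniz_zero; [ring|]. intros i Hi. rewrite Hp. apply kronecker_neq. lia.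
Qed.

(** If m is the highest order present, the only Leibniz term reaching order m is the one in which
    [g] is not differentiated. *)
Lemma diracs_mult_top (p : R) (n m : nat) (e : nat -> C) (g : smoothfun) (psi : testfun) :
  (forall j, Cderive_n psi j p = kronecker m j) -> (m <= n)%nat ->
  (forall j, (m < j <= n)%nat -> e j = RtoC 0) ->
  diracs p n e (test_mult g psi) = (e m * (- (1)) ^ m * g p)%C.
Proof.
  intros Hp Hm. induction n as [|n IH]; intros He.
  - replace m with 0%nat in * by lia. rewrite diracs_mult, csum_0. simpl.
    rewrite Hp, Cderive_n_0. unfold kronecker; simpl. ring.
  - destruct (Nat.eq_dec m (S n)) as [->|N].
    + rewrite diracs_mult, csum_S, <- diracs_mult. fold (diracs p n e (test_mult g psi)).
      rewrite diracs_mult_zero with (m := S n); auto; [|intros; lia].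
      rewrite leibniz_first.
      * rewrite Hp, Cderive_n_0, kronecker_eq. ring.
      * intros i Hi. rewrite Hp. apply kronecker_neq. lia.
    + rewrite diracs_mult, csum_S, <- diracs_mult. rewrite He, IH by (intros; try apply He; lia).
      ring.
Qed.

Lemma binom_2 : binom 2 0 = RtoC 1 /\ binom 2 1 = RtoC 2 /\ binom 2 2 = RtoC 1.
Proof.
  unfold binom, Binomial.C. repeat split; f_equal; simpl; field.
Qed.

Lemma csum_2 (a : nat -> C) : csum a 2 = (a 0%nat + a 1%nat + a 2%nat)%C.
Proof. now rewrite !csum_S, csum_0. Qed.

(** Singular contribution of [a0^(i) * phi^(4-i) + phi^(4-i) * a1^(i)]. *)
Definition singular_term (p : R) (am ap : nat -> smoothfun) (A : nat -> nat -> C)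
  (u v : smoothfun) (N : nat) (c : nat -> C) (i : nat) (psi : testfun) : C :=
  (diracs p (i + 1) (jumps p (am 0%nat) (ap 0%nat) (A 0%nat) i) (test_mult (sf_derive (4 - i) v) psi) +
   diracs p (4 - i + N) (jumps p u v c (4 - i)) (test_mult (sf_derive i (am 0%nat)) psi) +
   diracs p (4 - i + N) (jumps p u v c (4 - i)) (test_mult (sf_derive i (ap 1%nat)) psi) +
   diracs p (i + 1) (jumps p (am 1%nat) (ap 1%nat) (A 1%nat) i) (test_mult (sf_derive (4 - i) u) psi))%C.

Definition singular_part (p : R) (w : C) (am ap bm bp : nat -> smoothfun) (A B : nat -> nat -> C)
  (u v : smoothfun) (N : nat) (c : nat -> C) (psi : testfun) : C :=
  (singular_term p am ap A u v N c 0 psi + 2 * singular_term p am ap A u v N c 1 psi +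
   singular_term p am ap A u v N c 2 psi -
   w ^ 2 * (diracs p 3 (B 0%nat) (test_mult v psi) + diracs p N c (test_mult (bm 0%nat) psi) +
            diracs p N c (test_mult (bp 1%nat) psi) + diracs p 3 (B 1%nat) (test_mult u psi)))%C.

(** The point and the germs are left free: this describes the coefficients at xi0, and also at any
    other point, where left and right germs coincide and [A], [B] are zero. *)
Definition local_coefficients (p r : R) (am ap bm bp : nat -> smoothfun) (A B : nat -> nat -> C)
  (a0 a1 b0 b1 : functional) : Prop :=
  eq_on (p - r) (p + r) a0 (coefficient p (am 0%nat) (ap 0%nat) 1 (A 0%nat)) /\
  eq_on (p - r) (p + r) a1 (coefficient p (am 1%nat) (ap 1%nat) 1 (A 1%nat)) /\
  eq_on (p - r) (p + r) b0 (coefficient p (bm 0%nat) (bp 0%nat) 3 (B 0%nat)) /\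
  eq_on (p - r) (p + r) b1 (coefficient p (bm 1%nat) (bp 1%nat) 3 (B 1%nat)).

Definition ode_side (w : C) (a b : nat -> smoothfun) (u : smoothfun) : R -> C :=
  classical_ode w (fun x => a 0%nat x + a 1%nat x)%C (fun x => b 0%nat x + b 1%nat x)%C u.

(** Kept as two products in the order of the two distributional products of index i, the form in
    which [star_local] delivers them. *)
Definition ode_part (a : nat -> smoothfun) (u : smoothfun) (i : nat) (x : R) : C :=
  (Cderive_n (a 0%nat) i x * Cderive_n u (4 - i) x + Cderive_n u (4 - i) x * Cderive_n (a 1%nat) i x)%C.

Lemma ode_side_eq (w : C) (a b : nat -> smoothfun) (u : smoothfun) (x : R) :
  ode_side w a b u x =
  (ode_part a u 0 x + 2 * ode_part a u 1 x + ode_part a u 2 x +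
   - w ^ 2 * (b 0%nat x * u x + u x * b 1%nat x))%C.
Proof.
  unfold ode_side, classical_ode.
  fold (csum (fun i => binom 2 i * (Cderive_n (fun x => a 0%nat x + a 1%nat x) i x *
    Cderive_n u (4 - i) x))%C 2).
  destruct binom_2 as [E0 [E1 E2]]. rewrite csum_2, E0, E1, E2.
  rewrite !Cderive_n_plus by apply sf_smooth. unfold ode_part. ring.
Qed.

Lemma ode_part_smooth (a : nat -> smoothfun) (u : smoothfun) (i : nat) : smooth (ode_part a u i).
Proof.
  apply smooth_plus; apply smooth_mult; apply smooth_Cderive_n, sf_smooth.
Qed.

Lemma ode_side_smooth (w : C) (a b : nat -> smoothfun) (u : smoothfun) : smooth (ode_side w a b u).
Proof.
  replace (ode_side w a b u) with (fun x =>
  (ode_part a u 0 x + 2 * ode_part a u 1 x + ode_part a u 2 x +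
   - w ^ 2 * (b 0%nat x * u x + u x * b 1%nat x))%C)
    by (apply functional_extensionality; intros x; now rewrite ode_side_eq).
  assert (O := ode_part_smooth a u). assert (S := sf_smooth).
  apply smooth_plus; [apply smooth_plus; [apply smooth_plus|]|]; auto.
  - apply smooth_mult; [apply smooth_const | apply O].
  - apply smooth_mult; [apply smooth_const|].
    apply smooth_plus; apply smooth_mult; apply S.
Qed.

Lemma CInt_ode_side (w : C) (a b : nat -> smoothfun) (u psi : smoothfun) (c d : R) :
  CInt (fun x => ode_side w a b u x * psi x)%C c d =
  (CInt (fun x => ode_part a u 0 x * psi x) c d + 2 * CInt (fun x => ode_part a u 1 x * psi x) c d +
   CInt (fun x => ode_part a u 2 x * psi x) c d -
   w ^ 2 * (CInt (fun x => b 0%nat x * u x * psi x) c d + CInt (fun x => u x * b 1%nat x * psi x) c d))%C.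
Proof.
  assert (Sp := sf_smooth psi).
  assert (S0 := fun i => smooth_mult _ _ (ode_part_smooth a u i) Sp).
  assert (S1 := smooth_mult _ _ (smooth_mult _ _ (sf_smooth (b 0%nat)) (sf_smooth u)) Sp).
  assert (S2 := smooth_mult _ _ (smooth_mult _ _ (sf_smooth u) (sf_smooth (b 1%nat))) Sp).
  apply is_CInt_unique.
  apply (is_CInt_ext (fun x => ode_part a u 0 x * psi x + 2 * (ode_part a u 1 x * psi x) +
    ode_part a u 2 x * psi x + - w ^ 2 * (b 0%nat x * u x * psi x + u x * b 1%nat x * psi x))%C).
  { intros x _. rewrite ode_side_eq. ring. }
  replace (_ - _)%C with
    (CInt (fun x => ode_part a u 0 x * psi x) c d + 2 * CInt (fun x => ode_part a u 1 x * psi x) c d +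
   CInt (fun x => ode_part a u 2 x * psi x) c d +
   - w ^ 2 * (CInt (fun x => b 0%nat x * u x * psi x) c d + CInt (fun x => u x * b 1%nat x * psi x) c d))%C
   by ring.
  assert (HC := fun f (Hf : smooth f) => is_CInt_correct f c d Hf).
  apply is_CInt_plus; [apply is_CInt_plus; [apply is_CInt_plus|]|]; auto.
  - apply is_CInt_scal; auto.
  - apply is_CInt_scal, is_CInt_plus; auto.
Qed.

Lemma CInt_ode_part (a : nat -> smoothfun) (u psi : smoothfun) (i : nat) (c d : R) :
  CInt (fun x => ode_part a u i x * psi x)%C c d =
  (CInt (fun x => Cderive_n (a 0%nat) i x * Cderive_n u (4 - i) x * psi x) c d +
   CInt (fun x => Cderive_n u (4 - i) x * Cderive_n (a 1%nat) i x * psi x) c d)%C.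
Proof.
  assert (Sp := sf_smooth psi).
  assert (Su := smooth_Cderive_n _ (4 - i) (sf_smooth u)).
  assert (Sa := fun k => smooth_Cderive_n _ i (sf_smooth (a k))).
  rewrite <- CInt_plus by (apply smooth_mult; auto; now apply smooth_mult).
  apply CInt_ext; [apply smooth_mult; auto; apply ode_part_smooth|].
  intros x _. unfold ode_part. ring.
Qed.

Lemma local_equation (p r : R) (w : C) (am ap bm bp : nat -> smoothfun) (A B : nat -> nat -> C)
  (a0 a1 b0 b1 phi : functional) (u v : smoothfun) (N : nat) (c : nat -> C)
  (psi : testfun) (c1 d1 : R) :
  local_coefficients p r am ap bm bp A B a0 a1 b0 b1 ->
  eq_on (p - r) (p + r) phi (coefficient p u v N c) ->
  is_solution w a0 a1 b0 b1 phi ->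
  p - r < c1 < p -> p < d1 < p + r -> supported psi c1 d1 ->
  (CInt (fun x => ode_side w am bm u x * psi x) c1 p +
   CInt (fun x => ode_side w ap bp v x * psi x) p d1 +
   singular_part p w am ap bm bp A B u v N c psi)%C = RtoC 0.
Proof.
  intros [Ha0 [Ha1 [Hb0 Hb1]]] Hphi [_ [P [Q [S0 [S1 [HPQ [HS0 [HS1 HE]]]]]]]] Hc Hd Hs.
  assert (T : forall i, (i <= 2)%nat ->
    (P i psi + Q i psi)%C =
    (CInt (fun x => ode_part am u i x * psi x) c1 p + CInt (fun x => ode_part ap v i x * psi x) p d1 +
     singular_term p am ap A u v N c i psi)%C).
  { intros i Hi. destruct (HPQ i Hi) as [H1 H2].
    assert (D0 := eq_on_deriv_n _ _ _ _ i Ha0). assert (D1 := eq_on_deriv_n _ _ _ _ i Ha1).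
    assert (Dp := eq_on_deriv_n _ _ _ _ (4 - i) Hphi).
    rewrite deriv_n_coefficient in D0, D1, Dp.
    rewrite (star_local _ _ _ p r c1 d1 (sf_derive i (am 0%nat)) (sf_derive i (ap 0%nat))
      (sf_derive (4 - i) u) (sf_derive (4 - i) v) _ _ _ _ psi H1 D0 Dp Hc Hd Hs).
    rewrite (star_local _ _ _ p r c1 d1 (sf_derive (4 - i) u) (sf_derive (4 - i) v)
      (sf_derive i (am 1%nat)) (sf_derive i (ap 1%nat)) _ _ _ _ psi H2 Dp D1 Hc Hd Hs).
    rewrite !CInt_ode_part. unfold singular_term. cbn [sf_fun sf_derive]. ring. }
  specialize (HE psi).
  fold (csum (fun i => binom 2 i * (P i psi + Q i psi))%C 2) in HE.
  destruct binom_2 as [E0 [E1 E2]]. rewrite csum_2, E0, E1, E2, !T in HE by lia.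
  rewrite (star_local _ _ _ p r c1 d1 _ _ _ _ _ _ _ _ psi HS0 Hb0 Hphi Hc Hd Hs) in HE.
  rewrite (star_local _ _ _ p r c1 d1 _ _ _ _ _ _ _ _ psi HS1 Hphi Hb1 Hc Hd Hs) in HE.
  rewrite !CInt_ode_side, <- HE. unfold singular_part. ring.
Qed.

Lemma jumps_tail (p : R) (u v : R -> C) (c : nat -> C) (i l : nat) :
  jumps p u v c i (i + l) = c l.
Proof. induction i as [|i IH]; simpl; auto. Qed.

Lemma singular_part_zero_loc (p : R) (w : C) (am ap bm bp : nat -> smoothfun) (A B : nat -> nat -> C)
  (u v : smoothfun) (N : nat) (c : nat -> C) (psi : testfun) :
  locally p (fun x => psi x = RtoC 0) -> singular_part p w am ap bm bp A B u v N c psi = RtoC 0.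
Proof.
  intros H.
  assert (Z : forall n e g, diracs p n e (test_mult g psi) = RtoC 0).
  { intros n e g. apply diracs_zero_loc. revert H. apply filter_imp. intros x Hx.
    simpl. rewrite Hx. ring. }
  unfold singular_part, singular_term. rewrite !Z. ring.
Qed.

(** A test function supported on one side of p removes the singular part and the other integral,
    which leaves the fundamental lemma on that side. Once both equations hold, the integrals vanish
    for every test function and the singular part remains alone. *)
Lemma local_odes (p r : R) (w : C) (am ap bm bp : nat -> smoothfun) (A B : nat -> nat -> C)
  (a0 a1 b0 b1 phi : functional) (u v : smoothfun) (N : nat) (c : nat -> C) : 0 < r ->
  local_coefficients p r am ap bm bp A B a0 a1 b0 b1 ->
  eq_on (p - r) (p + r) phi (coefficient p u v N c) ->
  is_solution w a0 a1 b0 b1 phi ->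
  (forall x, p - r < x < p -> ode_side w am bm u x = RtoC 0) /\
  (forall x, p < x < p + r -> ode_side w ap bp v x = RtoC 0) /\
  (forall psi c1 d1, p - r < c1 < p -> p < d1 < p + r -> supported psi c1 d1 ->
     singular_part p w am ap bm bp A B u v N c psi = RtoC 0).
Proof.
  intros Hr Hloc Hphi Hsol.
  assert (HL : forall x, p - r < x < p -> ode_side w am bm u x = RtoC 0).
  { apply (smooth_zero_of_tests (SmoothFun _ (ode_side_smooth w am bm u))). simpl.
    intros psi a b Ha Hab Hb Hs.
    (* [local_equation] asks for a support interval around p, so the support is formally enlarged
       past p. *)
    assert (Hs' : supported psi a (p + r / 2)) by (apply supported_le with (1 := Hs); lra).
    generalize (local_equation p r w am ap bm bp A B a0 a1 b0 b1 phi u v N c psi a (p + r / 2)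
      Hloc Hphi Hsol ltac:(lra) ltac:(lra) Hs').
    rewrite singular_part_zero_loc.
    2: { apply locally_Ioo with b (p + 1); [lra|]. intros y Hy. apply Hs. lra. }
    rewrite (CInt_zero _ p (p + r / 2)).
    2: { intros x Hx. rewrite Hs; [ring|]. right. minmax. }
    rewrite (CInt_Chasles _ a b p)
      by (apply smooth_mult; [apply ode_side_smooth | apply sf_smooth]).
    rewrite (CInt_zero _ b p).
    2: { intros x Hx. rewrite Hs; [ring|]. right. minmax. }
    intros <-. ring. }
  assert (HR : forall x, p < x < p + r -> ode_side w ap bp v x = RtoC 0).
  { apply (smooth_zero_of_tests (SmoothFun _ (ode_side_smooth w ap bp v))). simpl.
    intros psi a b Ha Hab Hb Hs.
    assert (Hs' : supported psi (p - r / 2) b) by (apply supported_le with (1 := Hs); lra).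
    generalize (local_equation p r w am ap bm bp A B a0 a1 b0 b1 phi u v N c psi (p - r / 2) b
      Hloc Hphi Hsol ltac:(lra) ltac:(lra) Hs').
    rewrite singular_part_zero_loc.
    2: { apply locally_Ioo with (p - 1) a; [lra|]. intros y Hy. apply Hs. lra. }
    rewrite (CInt_zero _ (p - r / 2) p).
    2: { intros x Hx. rewrite Hs; [ring|]. left. minmax. }
    rewrite (CInt_Chasles _ p a b)
      by (apply smooth_mult; [apply ode_side_smooth | apply sf_smooth]).
    rewrite (CInt_zero _ p a).
    2: { intros x Hx. rewrite Hs; [ring|]. left. minmax. }
    intros <-. ring. }
  split; [|split]; auto.
  intros psi c1 d1 Hc Hd Hs.
  rewrite <- (local_equation p r w am ap bm bp A B a0 a1 b0 b1 phi u v N c psi c1 d1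
      Hloc Hphi Hsol Hc Hd Hs).
  rewrite !CInt_zero; [ring| |]; intros x Hx; [rewrite HR by minmax | rewrite HL by minmax]; ring.
Qed.

(* The coefficient of [delta^(l+4)] in the equation is [(a0- + a1+)(p) c l]
   plus terms involving only [c l'] with [l' > l]. *)
Lemma dirac_coefficients_zero (p : R) (w : C) (am ap bm bp : nat -> smoothfun) (A B : nat -> nat -> C)
  (u v : smoothfun) (N : nat) (c : nat -> C) :
  (am 0%nat p + ap 1%nat p)%C <> RtoC 0 ->
  (forall m, exists psi : testfun, (forall j, Cderive_n psi j p = kronecker m j) /\
     singular_part p w am ap bm bp A B u v N c psi = RtoC 0) ->
  forall l, (l <= N)%nat -> c l = RtoC 0.
Proof.
  intros Ha Htest.
  (* Downward induction on l, phrased through the distance k to the top; [IH] covers all larger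
     indices. *)
  assert (H : forall k l, (N < l + k)%nat -> (l <= N)%nat -> c l = RtoC 0);
    [|intros l Hl; apply (H (S N)); lia].
  induction k as [|k IH]; intros l Hk Hl; [lia|].
  destruct (Htest (l + 4)%nat) as [psi [Hpsi HS]].
  assert (J : forall i j, (l < j - i)%nat -> (j <= i + N)%nat -> jumps p u v c i j = RtoC 0).
  { intros i j H1 H2. replace j with (i + (j - i))%nat by lia. rewrite jumps_tail. apply IH; lia. }
  assert (Z : forall n e g, (forall j, (l + 4 <= j <= n)%nat -> e j = RtoC 0) ->
     diracs p n e (test_mult g psi) = RtoC 0) by (intros n e g; now apply diracs_mult_zero).
  assert (T0 : singular_term p am ap A u v N c 0 psi =
    (c l * (- (1)) ^ (l + 4) * (am 0%nat p + ap 1%nat p))%C).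
  { unfold singular_term.
    rewrite (Z (0 + 1)%nat), (Z (0 + 1)%nat) by (intros; lia).
    rewrite !(diracs_mult_top p _ (l + 4)); auto; try lia;
      try (intros j Hj; apply J; lia).
    replace (jumps p u v c (4 - 0) (l + 4)) with (c l)
      by (rewrite (Nat.add_comm l 4); symmetry; apply (jumps_tail p u v c 4 l)).
    cbn [sf_fun sf_derive]. rewrite !Cderive_n_0. ring. }
  (* For i = 1, 2 phi is differentiated only 3 or 2 times, so order l + 4 is reached only by
     coefficients beyond l. The Dirac terms of the coefficients themselves stop at order 3. *)
  assert (TI : forall i, (i = 1 \/ i = 2)%nat -> singular_term p am ap A u v N c i psi = RtoC 0).
  { intros i Hi. unfold singular_term. rewrite !Z; [ring|intros; lia| | |intros; lia];
      intros j Hj; apply J; lia. }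
  unfold singular_part in HS. rewrite T0, !TI, !Z in HS by (try (intros; apply IH); lia).
  assert (E : (c l * ((- (1)) ^ (l + 4) * (am 0%nat p + ap 1%nat p)))%C = RtoC 0)
    by (rewrite <- HS; ring).
  apply NNPP. intros N0. revert E. apply Cmult_neq_0; auto. apply Cmult_neq_0; auto.
  apply Cpow_nz. intros E. apply RtoC_inj in E || (injection E; intros; lra).
Qed.

(** * The interface condition *)

(** The matrix identity row by row; row m, counted from 0, is the coefficient of delta^(m). *)
Definition interface (p : R) (w : C) (am ap : nat -> smoothfun) (A B : nat -> nat -> C)
  (u v : smoothfun) : Prop :=
  let U j := Cderive_n u j p in
  let V j := Cderive_n v j p in
  let a := fun x => (am 0%nat x + ap 1%nat x)%C in
  let a_minus := fun x => (am 0%nat x + am 1%nat x)%C in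
  let a_plus := fun x => (ap 0%nat x + ap 1%nat x)%C in
  ((B 1%nat 0%nat * w ^ 2 * U 0%nat - B 1%nat 1%nat * w ^ 2 * U 1%nat +
    (Cderive_n a_minus 1 p + B 1%nat 2%nat * w ^ 2) * U 2%nat +
    (a_minus p - B 1%nat 3%nat * w ^ 2) * U 3%nat =
    - (B 0%nat 0%nat * w ^ 2) * V 0%nat + B 0%nat 1%nat * w ^ 2 * V 1%nat +
    (Cderive_n a_plus 1 p - B 0%nat 2%nat * w ^ 2) * V 2%nat +
    (a_plus p + B 0%nat 3%nat * w ^ 2) * V 3%nat) /\
   (B 1%nat 1%nat * w ^ 2 * U 0%nat - 2 * B 1%nat 2%nat * w ^ 2 * U 1%nat +
    (a_minus p + 3 * B 1%nat 3%nat * w ^ 2) * U 2%nat =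
    - (B 0%nat 1%nat * w ^ 2) * V 0%nat + 2 * B 0%nat 2%nat * w ^ 2 * V 1%nat +
    (a_plus p - 3 * B 0%nat 3%nat * w ^ 2) * V 2%nat) /\
   ((- Cderive_n a 1 p + B 1%nat 2%nat * w ^ 2) * U 0%nat +
    (a p - 3 * B 1%nat 3%nat * w ^ 2) * U 1%nat - A 1%nat 0%nat * U 2%nat + A 1%nat 1%nat * U 3%nat =
    (- Cderive_n a 1 p - B 0%nat 2%nat * w ^ 2) * V 0%nat +
    (a p + 3 * B 0%nat 3%nat * w ^ 2) * V 1%nat + A 0%nat 0%nat * V 2%nat - A 0%nat 1%nat * V 3%nat) /\
   ((a p + B 1%nat 3%nat * w ^ 2) * U 0%nat - A 1%nat 1%nat * U 2%nat =
    (a p - B 0%nat 3%nat * w ^ 2) * V 0%nat + A 0%nat 1%nat * V 2%nat))%C.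

Lemma diracs_mult_test (p : R) (n m : nat) (e : nat -> C) (g : smoothfun) (psi : testfun) :
  (forall j, Cderive_n psi j p = kronecker m j) ->
  diracs p n e (test_mult g psi) =
  csum (fun j => e j * ((- (1)) ^ j * leibniz j (fun i => Cderive_n g i p) (kronecker m)))%C n.
Proof.
  intros H. rewrite diracs_mult. apply csum_ext. intros j _. do 3 f_equal.
  now apply functional_extensionality.
Qed.

Lemma diracs_derive_test (p : R) (n m k : nat) (e : nat -> C) (g : smoothfun) (psi : testfun) :
  (forall j, Cderive_n psi j p = kronecker m j) ->
  diracs p n e (test_mult (sf_derive k g) psi) =
  csum (fun j => e j * ((- (1)) ^ j * leibniz j (fun i => Cderive_n g (i + k) p) (kronecker m)))%C n.
Proof.
  intros H. rewrite (diracs_mult_test _ _ m) by auto. apply csum_ext. intros j _. do 3 f_equal.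
  apply functional_extensionality. intros i. apply Cderive_n_comp.
Qed.

(** With no Dirac terms left in phi all sums have numeral length, so each row unfolds to a
    polynomial identity in the jets. Derivatives of the coefficients beyond the first cancel: since
    the product obeys the Leibniz rule, the leading part of the equation is the second derivative of
    a_0 * phi'' + phi'' * a_1. *)
Lemma interface_of_tests (p : R) (w : C) (am ap bm bp : nat -> smoothfun) (A B : nat -> nat -> C)
  (u v : smoothfun) :
  (forall m, exists psi : testfun, (forall j, Cderive_n psi j p = kronecker m j) /\
     singular_part p w am ap bm bp A B u v 0 (fun _ => RtoC 0) psi = RtoC 0) ->
  interface p w am ap A B u v.
Proof.
  intros Htest. unfold interface. cbv zeta beta.
  rewrite !Cderive_n_plus by apply sf_smooth.
  (* The sign (-1)^m undoes the one from pairing delta^(m) with the test function of jet m. *)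
  assert (Fin : forall m (X Y : C) (psi : testfun), (forall j, Cderive_n psi j p = kronecker m j) ->
    singular_part p w am ap bm bp A B u v 0 (fun _ => RtoC 0) psi = RtoC 0 ->
    (Y - X)%C = ((- (1)) ^ m * singular_part p w am ap bm bp A B u v 0 (fun _ => RtoC 0) psi)%C ->
    X = Y).
  { intros m X Y psi _ H0 HXY. rewrite H0 in HXY.
    replace Y with (X + (Y - X))%C by ring. rewrite HXY. ring. }
  split; [|split; [|split]].
  1: destruct (Htest 0%nat) as [psi [Hpsi HS]]; apply (Fin 0%nat _ _ psi Hpsi HS).
  2: destruct (Htest 1%nat) as [psi [Hpsi HS]]; apply (Fin 1%nat _ _ psi Hpsi HS).
  3: destruct (Htest 2%nat) as [psi [Hpsi HS]]; apply (Fin 2%nat _ _ psi Hpsi HS).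
  4: destruct (Htest 3%nat) as [psi [Hpsi HS]]; apply (Fin 3%nat _ _ psi Hpsi HS).
  all: clear HS Htest Fin; unfold singular_part, singular_term;
    rewrite !(diracs_derive_test _ _ _ _ _ _ _ Hpsi), !(diracs_mult_test _ _ _ _ _ _ Hpsi);
    cbn [Nat.add Nat.sub];
    rewrite !csum_S, !csum_0;
    cbn [jumps leibniz kronecker Nat.eqb Nat.add];
    rewrite ?Cderive_n_0; ring.
Qed.

(** * From local to global *)

(** A supremum argument in place of a finite subcover: near the supremum of the reachable end points
    one can always go further, unless it is b. Used for integrability and for patching
    functionals. *)
Lemma interval_induction (Q : R -> R -> Prop) :
  (forall p, exists r, 0 < r /\ forall c d, p - r < c -> c <= d -> d < p + r -> Q c d) ->
  (forall a b c, a <= b -> b <= c -> Q a b -> Q b c -> Q a c) ->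
  forall a b, a <= b -> Q a b.
Proof.
  intros Hloc Hjoin a b Hab.
  set (E t := a <= t <= b /\ Q a t).
  assert (Ea : E a).
  { split; [lra|]. destruct (Hloc a) as [r [Hr H]]. apply H; lra. }
  destruct (completeness E) as [s [Hub Hlub]].
  - exists b. intros t Ht. apply Ht.
  - now exists a.
  - assert (Hs : a <= s <= b).
    { split; [now apply Hub|]. apply Hlub. intros t Ht. apply Ht. }
    destruct (Hloc s) as [r [Hr H]].
    assert (T : exists t, E t /\ s - r < t).
    { apply NNPP. intros N. assert (s <= s - r); [|lra]. apply Hlub. intros t Ht.
      apply Rnot_lt_le. intros L. apply N. now exists t. }
    destruct T as [t [[Ht Qt] Hst]].
    assert (t <= s) by now apply Hub.
    set (s' := Rmin b (s + r / 2)).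
    assert (Hs' : s <= s' <= b /\ s' < s + r) by (unfold s'; minmax).
    assert (Qs : Q a s') by (apply Hjoin with t; auto; try lra; apply H; lra).
    assert (L : s' <= s) by (apply Hub; split; auto; lra).
    replace b with s'; auto. unfold s' in *. minmax.
Qed.

(** * Functionals determined by their local behaviour *)

(** The share of linearity that cutting a test function into pieces calls for. For elements of A it
    is recovered from their form as derivatives of piecewise smooth functions. *)
Definition additive (F : functional) : Prop :=
  forall phi psi chi : testfun, (forall x, chi x = phi x + psi x)%C -> F chi = (F phi + F psi)%C.

Lemma additive_deriv_n (F : functional) (n : nat) : additive F -> additive (deriv_n n F).
Proof.
  induction n as [|n IH]; intros H; auto.
  intros phi psi chi E. simpl. unfold deriv.
  rewrite (IH H (test_derive phi) (test_derive psi) (test_derive chi)); [ring|].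
  intros x. simpl. rewrite <- Cderive_n_plus by apply sf_smooth.
  f_equal. now apply functional_extensionality.
Qed.

Lemma Cp_infty_integrable (f : R -> C) (psi : testfun) (a b : R) : Cp_infty f -> a <= b ->
  exists l, is_CInt (fun x => f x * psi x)%C a b l.
Proof.
  intros Hf. revert a b. apply interval_induction.
  - intros p. destruct (Cp_infty_germs f p Hf) as [r [u [v [Hr [Hu Hv]]]]].
    assert (Su := smooth_mult _ _ (sf_smooth u) (sf_smooth psi)).
    assert (Sv := smooth_mult _ _ (sf_smooth v) (sf_smooth psi)).
    exists r. split; auto. intros c d Hc Hcd Hd.
    assert (L : forall c d, p - r < c -> c <= d -> d <= p ->
      is_CInt (fun x => f x * psi x)%C c d (CInt (fun x => u x * psi x)%C c d)).
    { intros. apply is_CInt_ext with (fun x => u x * psi x)%C; [|now apply is_CInt_correct].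
      intros x Hx. rewrite Hu; auto. minmax. }
    assert (R : forall c d, p <= c -> c <= d -> d < p + r ->
      is_CInt (fun x => f x * psi x)%C c d (CInt (fun x => v x * psi x)%C c d)).
    { intros. apply is_CInt_ext with (fun x => v x * psi x)%C; [|now apply is_CInt_correct].
      intros x Hx. rewrite Hv; auto. minmax. }
    destruct (Rle_dec d p) as [H|H]; [eexists; apply L; lra|].
    destruct (Rle_dec p c) as [H'|H']; [eexists; apply R; lra|].
    eexists. apply is_CInt_Chasles with p; [apply L; lra | apply R; lra].
  - intros a b c _ _ [l Hl] [m Hm]. eexists. now apply is_CInt_Chasles with b; eauto.
Qed.

Lemma test_supported_2 (phi psi : testfun) :
  exists K, 0 < K /\ supported phi (- K) K /\ supported psi (- K) K.
Proof.
  destruct (test_supported phi) as [K1 [H1 S1]], (test_supported psi) as [K2 [H2 S2]].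
  exists (K1 + K2). split; [lra|]. split; eapply supported_le; eauto; lra.
Qed.

Lemma additive_regular_Cp (f : R -> C) : Cp_infty f -> additive (regular f).
Proof.
  intros Hf phi psi chi E. destruct (test_supported_2 phi psi) as [K [HK [S1 S2]]].
  destruct (Cp_infty_integrable f phi (- K) K Hf ltac:(lra)) as [l Hl].
  destruct (Cp_infty_integrable f psi (- K) K Hf ltac:(lra)) as [m Hm].
  rewrite (regular_of_is_CInt f phi (- K) K l), (regular_of_is_CInt f psi (- K) K m) by (auto; lra).
  apply (regular_of_is_CInt f chi (- K) K); [lra| |].
  - intros x Hx. rewrite E, S1, S2 by auto. ring.
  - apply is_CInt_ext with (fun x => f x * phi x + f x * psi x)%C; [|now apply is_CInt_plus].
    intros x _. rewrite E. ring.
Qed.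

Lemma additive_regular_glue (p : R) (u v : smoothfun) : additive (regular (glue p u v)).
Proof.
  intros phi psi chi E. destruct (test_supported_2 phi psi) as [K [HK [S1 S2]]].
  assert (S3 : supported chi (- K) K) by (intros x Hx; rewrite E, S1, S2 by auto; ring).
  assert (W : forall f, supported f (- K) K -> supported f (Rmin (- K) p) (Rmax K p))
    by (intros f Hf; apply supported_le with (1 := Hf); minmax).
  rewrite !(regular_glue u v _ (Rmin (- K) p) p (Rmax K p));
    auto using sf_smooth; try (split; [apply Rmin_r | apply Rmax_r]).
  assert (M : forall (g f : smoothfun), smooth (fun x => g x * f x)%C)
    by (intros; apply smooth_mult; apply sf_smooth).
  assert (P : forall (g : smoothfun) a b, CInt (fun x => g x * chi x)%C a b =
    (CInt (fun x => g x * phi x) a b + CInt (fun x => g x * psi x) a b)%C).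
  { intros g a b. rewrite <- CInt_plus by apply M. apply CInt_ext; [apply M|].
    intros x _. rewrite E. ring. }
  rewrite !P. ring.
Qed.

Lemma eq_of_eq_on_locally (F G : functional) : additive F -> additive G ->
  (forall p, exists r, 0 < r /\ eq_on (p - r) (p + r) F G) -> forall psi, F psi = G psi.
Proof.
  intros HF HG Hloc psi. destruct (test_supported psi) as [K [HK HS]].
  (* The margin [eta] makes neighbouring intervals overlap, so that a smooth step across the common
     end point can split the test function in two. *)
  assert (H : forall c d, c <= d -> exists eta, 0 < eta /\
    forall psi, supported psi (c - eta) (d + eta) -> F psi = G psi).
  { apply interval_induction.
    - intros p. destruct (Hloc p) as [r [Hr H]]. exists (r / 2). split; [lra|].
      intros c d Hc Hcd Hd. exists (r / 4). split; [lra|]. intros chi Hchi.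
      apply (H chi (c - r / 4) (d + r / 4)); auto; lra.
    - intros a b c Hab Hbc [e1 [He1 H1]] [e2 [He2 H2]].
      set (e := Rmin e1 e2).
      assert (He : 0 < e /\ e <= e1 /\ e <= e2) by (unfold e; minmax).
      exists e. split; [lra|]. intros chi Hchi.
      set (s := step (b - e) (b + e)).
      assert (Ss : rsmooth s) by apply step_smooth.
      assert (St : rsmooth (fun x => 1 + - s x))
        by (apply (rsmooth_plus (fun _ => 1)); [apply rsmooth_const | now apply rsmooth_opp]).
      set (chi1 := test_mult (sf_real _ St) chi). set (chi2 := test_mult (sf_real s Ss) chi).
      assert (E : forall x, chi x = (chi1 x + chi2 x)%C).
      { intros x. simpl. rewrite RtoC_plus, RtoC_opp. ring. }
      rewrite (HF chi1 chi2 chi E), (HG chi1 chi2 chi E), H1, H2; auto; intros x Hx; simpl.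
      + destruct (Rlt_dec x (b - e)) as [L|L].
        * unfold s. rewrite step_0 by lra. ring.
        * rewrite Hchi by lra. ring.
      + destruct (Rlt_dec (b + e) x) as [L|L].
        * unfold s. rewrite step_1, Rplus_opp_r by lra. apply Cmult_0_l.
        * rewrite Hchi by lra. ring. }
  destruct (H (- K) K ltac:(lra)) as [eta [He H']]. apply H'.
  apply supported_le with (1 := HS); lra.
Qed.

Lemma regular_ext (c d : R) (f g : R -> C) :
  (forall x, c < x < d -> f x = g x) -> eq_on c d (regular f) (regular g).
Proof.
  intros H psi c' d' Hc Hd Hs. unfold regular. f_equal.
  apply functional_extensionality. intros x.
  destruct (Rlt_dec x c') as [L|L]; [rewrite Hs by lra; ring|].
  destruct (Rlt_dec d' x) as [L'|L']; [rewrite Hs by lra; ring|].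
  rewrite H by lra. reflexivity.
Qed.

Lemma regular_inj (a b : R) (g h : smoothfun) :
  eq_on a b (regular g) (regular h) -> forall x, a < x < b -> g x = h x.
Proof.
  intros H x Hx.
  assert (Sk : smooth (fun x => g x + - (1) * h x)%C).
  { apply smooth_plus; [apply sf_smooth|]. apply smooth_mult; [apply smooth_const | apply sf_smooth]. }
  assert (Z : (SmoothFun _ Sk) x = RtoC 0).
  { apply (smooth_zero_of_tests (SmoothFun _ Sk) a b); auto. simpl.
    intros psi c d Hc Hcd Hd Hs.
    assert (M : forall f : smoothfun, smooth (fun x => f x * psi x)%C)
      by (intros; apply smooth_mult; apply sf_smooth).
    rewrite (CInt_ext _ (fun x => g x * psi x + - (1) * (h x * psi x))%C).
    - rewrite CInt_plus, CInt_scal; auto.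
      + rewrite <- !(regular_smooth _ psi c d) by (auto using sf_smooth; lra).
        rewrite (H psi c d) by auto. ring.
      + apply smooth_mult; auto using smooth_const.
    - apply (M (SmoothFun _ Sk)).
    - intros; ring. }
  simpl in Z. replace (g x) with (h x + (g x + - (1) * h x))%C by ring. rewrite Z. ring.
Qed.

Lemma smooth_of_locally (f : R -> C) :
  (forall x, exists g : smoothfun, locally x (fun y => f y = g y)) -> smooth f.
Proof.
  intros H n x. destruct (H x) as [g Hg]. destruct (sf_smooth g n x) as [G1 G2].
  split.
  - apply ex_derive_n_ext_loc with (fun t => Re (g t)); auto.
    revert Hg. apply filter_imp. intros y Hy. now rewrite Hy.
  - apply ex_derive_n_ext_loc with (fun t => Im (g t)); auto.
    revert Hg. apply filter_imp. intros y Hy. now rewrite Hy.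
Qed.

Lemma glue_smooth (p : R) (u v : smoothfun) :
  (forall n, Cderive_n u n p = Cderive_n v n p) ->
  exists g : smoothfun, (forall x, x < p -> g x = u x) /\ (forall x, p < x -> g x = v x).
Proof.
  intros H.
  assert (Su := sf_smooth u). assert (Sv := sf_smooth v).
  assert (L : forall f : R -> R, rsmooth f -> forall n,
    filterlim (Derive_n f n) (at_left p) (locally (Derive_n f n p))).
  { intros f Sf n. assert (C := rsmooth_continuous _ p (rsmooth_Derive_n f n Sf)).
    apply filterlim_filter_le_1 with (2 := C). intros P HP. unfold at_left, within.
    revert HP. apply filter_imp. auto. }
  assert (S1 : rsmooth (fun x => if Rlt_dec x p then Re (u x) else Re (v x))).
  { apply (rsmooth_piecewise (fun x => Re (u x)) (fun x => Re (v x))); try (intros; apply Su || apply Sv).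
    - intros n. replace (Derive_n (fun x => Re (v x)) n p) with (Derive_n (fun x => Re (u x)) n p)
        by (now injection (H n)). apply L. intros m x; apply Su.
    - intros n x. apply Sv. }
  assert (S2 : rsmooth (fun x => if Rlt_dec x p then Im (u x) else Im (v x))).
  { apply (rsmooth_piecewise (fun x => Im (u x)) (fun x => Im (v x))); try (intros; apply Su || apply Sv).
    - intros n. replace (Derive_n (fun x => Im (v x)) n p) with (Derive_n (fun x => Im (u x)) n p)
        by (now injection (H n)). apply L. intros m x; apply Su.
    - intros n x. apply Sv. }
  exists (SmoothFun _ (smooth_of_parts _ _ S1 S2)). simpl.
  split; intros x Hx; destruct (Rlt_dec x p); try lra; [now destruct (u x) | now destruct (v x)].
Qed.

Definition zero_seq : nat -> C := fun _ => RtoC 0.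

Lemma diracs_zero_seq (p : R) (n : nat) (c : nat -> C) (psi : testfun) :
  (forall j, (j <= n)%nat -> c j = RtoC 0) -> diracs p n c psi = RtoC 0.
Proof. intros H. apply csum_zero. intros j Hj. rewrite H by auto. ring. Qed.

Lemma coefficient_zero_seq (p : R) (u v : R -> C) (n : nat) (c : nat -> C) (psi : testfun) :
  (forall j, (j <= n)%nat -> c j = RtoC 0) ->
  coefficient p u v n c psi = regular (glue p u v) psi.
Proof. intros H. rewrite coefficient_eq, diracs_zero_seq by auto. ring. Qed.

(** Recentres at q the data given at p: seen from the left there is one germ and no Dirac term, up
    to the distance from q to p. The free length [m] fits both lengths, 1 and 3, of
    [local_coefficients]. *)
Lemma coefficient_left (p q : R) (u v : smoothfun) (n m : nat) (c : nat -> C) : q < p ->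
  eq_on (q - (p - q)) (q + (p - q)) (coefficient p u v n c) (coefficient q u u m zero_seq).
Proof.
  intros Hq.
  apply eq_on_trans with (regular u).
  - apply eq_on_sub with (p - 2 * (p - q)) p; try lra.
    apply (eq_on_left p (2 * (p - q)) _ u v n c); [lra|]. intros psi a b _ _ _. reflexivity.
  - apply eq_on_sym, eq_on_around with q; [lra|]. intros psi a b Ha Hb Hs.
    rewrite coefficient_zero_seq by reflexivity.
    rewrite (regular_glue u u psi a q b), (regular_smooth u psi a b) by (auto using sf_smooth; lra).
    symmetry. apply CInt_Chasles, smooth_mult; apply sf_smooth.
Qed.

Lemma coefficient_right (p q : R) (u v : smoothfun) (n m : nat) (c : nat -> C) : p < q ->
  eq_on (q - (q - p)) (q + (q - p)) (coefficient p u v n c) (coefficient q v v m zero_seq).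
Proof.
  intros Hq. apply eq_on_around with q; [lra|]. intros psi a b Ha Hb Hs.
  rewrite (coefficient_zero_seq q) by reflexivity.
  rewrite coefficient_eq, diracs_zero_loc.
  - rewrite (regular_germs _ v v psi a q b) by (auto using sf_smooth; try lra; intros; apply glue_right; lra).
    rewrite (regular_glue v v psi a q b) by (auto using sf_smooth; lra). ring.
  - apply locally_Ioo with (p - 1) a; [lra|]. intros y Hy. apply Hs. lra.
Qed.

Lemma local_coefficients_sub (p r r' : R) (am ap bm bp : nat -> smoothfun) (A B : nat -> nat -> C)
  (a0 a1 b0 b1 : functional) : r' <= r ->
  local_coefficients p r am ap bm bp A B a0 a1 b0 b1 ->
  local_coefficients p r' am ap bm bp A B a0 a1 b0 b1.
Proof.
  intros Hr [H1 [H2 [H3 H4]]].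
  repeat split; eapply eq_on_sub; eauto; lra.
Qed.

Lemma local_solution (p r : R) (w : C) (am ap bm bp : nat -> smoothfun) (A B : nat -> nat -> C)
  (a0 a1 b0 b1 phi : functional) (u v : smoothfun) (N : nat) (c : nat -> C) : 0 < r ->
  (am 0%nat p + ap 1%nat p)%C <> RtoC 0 ->
  local_coefficients p r am ap bm bp A B a0 a1 b0 b1 ->
  eq_on (p - r) (p + r) phi (coefficient p u v N c) ->
  is_solution w a0 a1 b0 b1 phi ->
  eq_on (p - r) (p + r) phi (regular (glue p u v)) /\
  (forall x, p - r < x < p -> ode_side w am bm u x = RtoC 0) /\
  (forall x, p < x < p + r -> ode_side w ap bp v x = RtoC 0) /\
  interface p w am ap A B u v.
Proof.
  intros Hr Ha Hloc Hphi Hsol.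
  assert (T : forall m, exists psi : testfun, supported psi (p - r / 2) (p + r / 2) /\
    forall j, Cderive_n psi j p = kronecker m j) by (intros m; apply monomial_test; lra).
  destruct (local_odes p r w am ap bm bp A B a0 a1 b0 b1 phi u v N c Hr Hloc Hphi Hsol)
    as [HL [HR HS]].
  assert (Hc : forall l, (l <= N)%nat -> c l = RtoC 0).
  { apply (dirac_coefficients_zero p w am ap bm bp A B u v N c Ha).
    intros m. destruct (T m) as [psi [Hs Hd]]. exists psi. split; auto.
    apply (HS psi (p - r / 2) (p + r / 2)); auto; lra. }
  assert (E : eq_on (p - r) (p + r) phi (regular (glue p u v))).
  { intros psi a b H1 H2 H3. rewrite (Hphi psi a b) by auto. now apply coefficient_zero_seq. }
  split; [|split; [|split]]; auto.
  apply (interface_of_tests p w am ap bm bp A B).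
  (* Second pass with the Dirac terms of phi known to vanish: the equation is read again with [N] =
     0, as [interface_of_tests] requires. *)
  assert (E' : eq_on (p - r) (p + r) phi (coefficient p u v 0 zero_seq)).
  { intros psi a b H1 H2 H3. rewrite (E psi a b) by auto. symmetry. now apply coefficient_zero_seq. }
  destruct (local_odes p r w am ap bm bp A B a0 a1 b0 b1 phi u v 0 zero_seq Hr Hloc E' Hsol)
    as [_ [_ HS']].
  intros m. destruct (T m) as [psi [Hs Hd]]. exists psi. split; auto.
  apply (HS' psi (p - r / 2) (p + r / 2)); auto; lra.
Qed.

(** ** Smoothness away from the interface *)

Definition sf_minus (u v : smoothfun) : smoothfun :=
  SmoothFun (fun x => u x + - (1) * v x)%C
    (smooth_plus _ _ (sf_smooth u) (smooth_mult _ _ (smooth_const _) (sf_smooth v))).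

Lemma Cderive_n_minus (u v : smoothfun) (n : nat) (x : R) :
  Cderive_n (sf_minus u v) n x = (Cderive_n u n x + - (1) * Cderive_n v n x)%C.
Proof.
  simpl. rewrite Cderive_n_plus, Cderive_n_scal; auto using sf_smooth.
  apply smooth_mult; auto using smooth_const, sf_smooth.
Qed.

Lemma ode_side_minus (w : C) (a b : nat -> smoothfun) (u v : smoothfun) (x : R) :
  ode_side w a b (sf_minus u v) x = (ode_side w a b u x + - (1) * ode_side w a b v x)%C.
Proof.
  rewrite !ode_side_eq. unfold ode_part. rewrite !Cderive_n_minus. simpl sf_fun. ring.
Qed.

(* Differentiating the equation [m] times expresses [a d^(m+4)] through lower
   derivatives of [d]. *)
Lemma ode_flat (w : C) (a b : nat -> smoothfun) (d : smoothfun) (p : R) :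
  (a 0%nat p + a 1%nat p)%C <> RtoC 0 ->
  (forall n, Cderive_n (ode_side w a b d) n p = RtoC 0) ->
  (forall j, (j < 4)%nat -> Cderive_n d j p = RtoC 0) ->
  forall n, Cderive_n d n p = RtoC 0.
Proof.
  intros Ha HO H4 n. induction n as [n IH] using Wf_nat.lt_wf_ind.
  destruct (le_lt_dec 4 n) as [L|L]; [|now apply H4].
  set (m := (n - 4)%nat). replace n with (m + 4)%nat in * by lia. clearbody m.
  specialize (HO m).
  assert (Sa : forall i, smooth (fun x => Cderive_n (a 0%nat) i x + Cderive_n (a 1%nat) i x)%C)
    by (intros i; apply smooth_plus; apply smooth_Cderive_n, sf_smooth).
  set (al i x := (Cderive_n (a 0%nat) i x + Cderive_n (a 1%nat) i x)%C) in *.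
  assert (Sb : smooth (fun x => - w ^ 2 * (b 0%nat x + b 1%nat x))%C).
  { apply smooth_mult; [apply smooth_const|]. apply smooth_plus; apply sf_smooth. }
  assert (S2 : smooth (fun x => 2 * al 1%nat x)%C) by (apply smooth_mult; [apply smooth_const | apply (Sa 1%nat)]).
  assert (Sd : forall k, smooth (Cderive_n d k)) by (intros k; apply smooth_Cderive_n, sf_smooth).
  assert (E : ode_side w a b d = (fun x => al 0%nat x * Cderive_n d 4 x +
     ((2 * al 1%nat x) * Cderive_n d 3 x + (al 2%nat x * Cderive_n d 2 x +
      (- w ^ 2 * (b 0%nat x + b 1%nat x)) * Cderive_n d 0 x)))%C).
  { apply functional_extensionality. intros x. rewrite ode_side_eq. unfold ode_part, al.
    simpl Nat.sub. rewrite !Cderive_n_0. ring. }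
  assert (P1 := smooth_mult _ _ (Sa 0%nat) (Sd 4%nat)). assert (P2 := smooth_mult _ _ S2 (Sd 3%nat)).
  assert (P3 := smooth_mult _ _ (Sa 2%nat) (Sd 2%nat)). assert (P4 := smooth_mult _ _ Sb (Sd 0%nat)).
  assert (P34 := smooth_plus _ _ P3 P4). assert (P234 := smooth_plus _ _ P2 P34).
  rewrite E, Cderive_n_plus, Cderive_n_plus, Cderive_n_plus in HO by assumption.
  assert (D : forall i k, (i + k < m + 4)%nat -> Cderive_n (Cderive_n d k) i p = RtoC 0)
    by (intros i k H; rewrite Cderive_n_comp; now apply IH).
  assert (Z : forall (f : R -> C) k, smooth f -> (k < 4)%nat ->
    Cderive_n (fun x => f x * Cderive_n d k x)%C m p = RtoC 0).
  { intros f k Sf Hk. rewrite (Cderive_n_mult f _ m p Sf (Sd k)).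
    apply leibniz_zero. intros i Hi. apply D. lia. }
  rewrite (Z (fun x => 2 * al 1%nat x)%C 3%nat S2), (Z (al 2%nat) 2%nat (Sa 2%nat)), (Z _ 0%nat Sb) in HO by lia.
  rewrite (Cderive_n_mult (al 0%nat) _ m p (Sa 0%nat) (Sd 4%nat)) in HO.
  rewrite leibniz_first in HO; [|intros i Hi; apply D; lia].
  rewrite Cderive_n_comp, Cderive_n_0 in HO. unfold al in HO. rewrite !Cderive_n_0 in HO.
  apply NNPP. intros N.
  apply (Cmult_neq_0 _ _ Ha N). rewrite <- HO. ring.
Qed.

Lemma solution_smooth_at (p r : R) (w : C) (a b : nat -> smoothfun)
  (a0 a1 b0 b1 phi : functional) : 0 < r ->
  (a 0%nat p + a 1%nat p)%C <> RtoC 0 ->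
  local_coefficients p r a a b b (fun _ => zero_seq) (fun _ => zero_seq) a0 a1 b0 b1 ->
  is_solution w a0 a1 b0 b1 phi ->
  exists (r' : R) (g : smoothfun), 0 < r' /\ eq_on (p - r') (p + r') phi (regular g).
Proof.
  intros Hr Ha Hloc Hsol.
  destruct (in_A_coefficient phi p (proj1 Hsol)) as [r0 [u [v [n [c [Hr0 Hphi]]]]]].
  set (r' := Rmin r r0).
  assert (Hr' : 0 < r' /\ r' <= r /\ r' <= r0) by (unfold r'; minmax).
  destruct (local_solution p r' w a a b b (fun _ => zero_seq) (fun _ => zero_seq) a0 a1 b0 b1 phi
    u v n c) as [E [HL [HR HI]]]; auto; try lra.
  { apply local_coefficients_sub with r; auto; lra. }
  { apply eq_on_sub with (1 := Hphi); lra. }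
  assert (J : forall j, (j < 4)%nat -> Cderive_n u j p = Cderive_n v j p).
  { unfold interface, zero_seq in HI. cbv zeta beta in HI.
    (* With [A] = [B] = 0 the rows are triangular in the order 0, 2, 1, 3 of derivatives: the row
       for u' contains a' u, the row for u''' contains a' u''. The literal zero terms below
       reproduce the shape of the rows for rewriting. *)
    destruct HI as [I3 [I2 [I1 I0]]].
    assert (K : forall x y : C, ((a 0%nat p + a 1%nat p) * x = (a 0%nat p + a 1%nat p) * y)%C -> x = y).
    { intros x y H. rewrite <- (Cmult_1_l x), <- (Cmult_1_l y), <- (Cinv_l _ Ha), <- !Cmult_assoc.
      now rewrite H. }
    assert (E0 : Cderive_n u 0 p = Cderive_n v 0 p).
    { apply K. transitivity ((a 0%nat p + a 1%nat p + 0 * w ^ 2) * Cderive_n u 0 p - 0 * Cderive_n u 2 p)%C;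
        [ring | rewrite I0; ring]. }
    rewrite E0 in *.
    assert (E2 : Cderive_n u 2 p = Cderive_n v 2 p).
    { apply K. transitivity (0 * w ^ 2 * Cderive_n v 0 p - 2 * 0 * w ^ 2 * Cderive_n u 1 p +
        (a 0%nat p + a 1%nat p + 3 * 0 * w ^ 2) * Cderive_n u 2 p)%C; [ring | rewrite I2; ring]. }
    rewrite E2 in *.
    assert (E1 : Cderive_n u 1 p = Cderive_n v 1 p).
    { set (a' := Cderive_n (fun x => a 0%nat x + a 1%nat x)%C 1 p) in *.
      apply K. transitivity (((- a' + 0 * w ^ 2) * Cderive_n v 0 p +
        (a 0%nat p + a 1%nat p - 3 * 0 * w ^ 2) * Cderive_n u 1 p - 0 * Cderive_n v 2 p +
        0 * Cderive_n u 3 p) + a' * Cderive_n v 0 p)%C; [ring | rewrite I1; ring]. }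
    rewrite E1 in *.
    assert (E3 : Cderive_n u 3 p = Cderive_n v 3 p).
    { set (a' := Cderive_n (fun x => a 0%nat x + a 1%nat x)%C 1 p) in *.
      apply K. transitivity ((0 * w ^ 2 * Cderive_n v 0 p - 0 * w ^ 2 * Cderive_n v 1 p +
        (a' + 0 * w ^ 2) * Cderive_n v 2 p + (a 0%nat p + a 1%nat p - 0 * w ^ 2) * Cderive_n u 3 p) -
        a' * Cderive_n v 2 p)%C; [ring | rewrite I3; ring]. }
    intros j Hj. destruct j as [|[|[|[|j]]]]; auto; lia. }
  (* [u] solves the equation to the left of p and [v] to the right, so the difference need not solve
     it anywhere. Its residual still has zero jet at p, by continuity from either side, and
     [ode_flat] uses only that. *)
  assert (F : forall j, Cderive_n (sf_minus u v) j p = RtoC 0).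
  { apply (ode_flat w a b); auto.
    - intros k.
      replace (ode_side w a b (sf_minus u v)) with
        (fun x => ode_side w a b u x + - (1) * ode_side w a b v x)%C
        by (apply functional_extensionality; intros; now rewrite ode_side_minus).
      rewrite Cderive_n_plus, Cderive_n_scal; auto using ode_side_smooth.
      2: apply smooth_mult; auto using smooth_const, ode_side_smooth.
      rewrite (Cderive_n_zero_closure (ode_side w a b u) (p - r') p p k),
        (Cderive_n_zero_closure (ode_side w a b v) p (p + r') p k);
        auto using ode_side_smooth; try lra. ring.
    - intros j Hj. rewrite Cderive_n_minus, J by auto. ring. }
  destruct (glue_smooth p u v) as [g [G1 G2]].
  { intros k. specialize (F k). rewrite Cderive_n_minus in F.
    replace (Cderive_n u k p) with (Cderive_n v k p + (Cderive_n u k p + - (1) * Cderive_n v k p))%C by ring.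
    rewrite F. ring. }
  exists r', g. split; [lra|].
  apply eq_on_trans with (1 := E). apply eq_on_around with p; [lra|]. intros psi c1 d1 Hc Hd Hs.
  assert (Sg := sf_smooth g). assert (Sp := sf_smooth psi).
  rewrite (regular_glue u v psi c1 p d1), (regular_smooth g psi c1 d1) by (auto using sf_smooth; lra).
  rewrite (CInt_Chasles _ c1 p d1) by now apply smooth_mult.
  f_equal; (apply CInt_ext; [apply smooth_mult; apply sf_smooth|]); intros x Hx;
    [rewrite G1 by minmax | rewrite G2 by minmax]; reflexivity.
Qed.

(** * Assembly of the global solution *)

(** A local smooth density is chosen at every point other than xi0. The choices agree on overlaps
    because a regular distribution determines its smooth density, and the germs [u0], [v0] continue
    the result across xi0. *)
Lemma glue_of_local (phi : functional) (xi0 r0 : R) (u0 v0 : smoothfun) : in_A phi -> 0 < r0 ->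
  eq_on (xi0 - r0) (xi0 + r0) phi (regular (glue xi0 u0 v0)) ->
  (forall p, p <> xi0 -> exists (r : R) (g : smoothfun), 0 < r /\ eq_on (p - r) (p + r) phi (regular g)) ->
  exists phi1 phi2 : smoothfun, forall psi, phi psi = regular (glue xi0 phi1 phi2) psi.
Proof.
  intros HA Hr0 H0 Hloc.
  assert (Hex : forall p, exists X : R * smoothfun, p <> xi0 ->
    0 < fst X /\ eq_on (p - fst X) (p + fst X) phi (regular (snd X))).
  { intros p. destruct (Req_dec p xi0) as [E|N].
    (* A dummy pair at xi0, so that the choice is total. *)
    - exists (0, u0). now intros.
    - destruct (Hloc p N) as [r [g H]]. exists (r, g). auto. }
  set (X p := proj1_sig (constructive_indefinite_description _ (Hex p))).
  assert (HX : forall p, p <> xi0 -> 0 < fst (X p) /\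
      eq_on (p - fst (X p)) (p + fst (X p)) phi (regular (snd (X p))))
    by (intros p; apply (proj2_sig (constructive_indefinite_description _ (Hex p)))).
  clearbody X.
  (* Each value is taken from the density chosen for that very point; [Hh] shows independence of the
     choice. *)
  set (h x := snd (X x) x).
  assert (Hh : forall (g : smoothfun) a b x, x <> xi0 -> a < x < b ->
     eq_on a b phi (regular g) -> h x = g x).
  { intros g a b x N Hx Hg. destruct (HX x N) as [Hr HE]. unfold h.
    set (r := fst (X x)) in *.
    apply (regular_inj (Rmax a (x - r)) (Rmin b (x + r))); [|minmax].
    apply eq_on_trans with phi.
    - apply eq_on_sym. apply eq_on_sub with (1 := HE); [apply Rmax_r | apply Rmin_r].
    - apply eq_on_sub with (1 := Hg); [apply Rmax_l | apply Rmin_l]. }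
  assert (Hu : forall x, xi0 - r0 < x < xi0 -> h x = u0 x).
  { intros x Hx. apply (Hh u0 (xi0 - r0) xi0); auto; [lra|].
    apply eq_on_trans with (regular (glue xi0 u0 v0)); [apply eq_on_sub with (1 := H0); lra|].
    apply regular_ext. intros y Hy. apply glue_left. lra. }
  assert (Hv : forall x, xi0 < x < xi0 + r0 -> h x = v0 x).
  { intros x Hx. apply (Hh v0 xi0 (xi0 + r0)); auto; [lra|].
    apply eq_on_trans with (regular (glue xi0 u0 v0)); [apply eq_on_sub with (1 := H0); lra|].
    apply regular_ext. intros y Hy. apply glue_right. lra. }
  assert (S1 : smooth (fun x => if Rlt_dec x xi0 then h x else u0 x)).
  { apply smooth_of_locally. intros x. destruct (Rlt_dec x xi0) as [L|L].
    - exists (snd (X x)). destruct (HX x ltac:(lra)) as [Hr HE].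
      apply locally_Ioo with (x - fst (X x)) (Rmin (x + fst (X x)) xi0); [minmax|].
      intros y Hy. destruct (Rlt_dec y xi0); [|minmax].
      apply Hh with (3 := HE); [lra | minmax].
    - exists u0. apply locally_Ioo with (xi0 - r0) (x + 1); [lra|].
      intros y Hy. destruct (Rlt_dec y xi0); auto. apply Hu. lra. }
  assert (S2 : smooth (fun x => if Rlt_dec xi0 x then h x else v0 x)).
  { apply smooth_of_locally. intros x. destruct (Rlt_dec xi0 x) as [L|L].
    - exists (snd (X x)). destruct (HX x ltac:(lra)) as [Hr HE].
      apply locally_Ioo with (Rmax (x - fst (X x)) xi0) (x + fst (X x)); [minmax|].
      intros y Hy. destruct (Rlt_dec xi0 y); [|minmax].
      apply Hh with (3 := HE); [lra | minmax].
    - exists v0. apply locally_Ioo with (x - 1) (xi0 + r0); [lra|].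
      intros y Hy. destruct (Rlt_dec xi0 y); auto. apply Hv. lra. }
  exists (SmoothFun _ S1), (SmoothFun _ S2).
  apply eq_of_eq_on_locally.
  - destruct HA as [k [f [Hf E]]]. intros f1 f2 f3 H3. rewrite !E.
    revert f1 f2 f3 H3. now apply additive_deriv_n, additive_regular_Cp.
  - apply additive_regular_glue.
  - intros p. destruct (Rtotal_order p xi0) as [L|[->|L]].
    + destruct (HX p ltac:(lra)) as [Hr HE]. set (r := fst (X p)) in *.
      exists (Rmin r (xi0 - p)). split; [minmax|].
      apply eq_on_trans with (regular (snd (X p))); [apply eq_on_sub with (1 := HE); minmax|].
      apply regular_ext. intros x Hx. assert (x < xi0) by minmax.
      rewrite glue_left by auto. simpl. destruct (Rlt_dec x xi0); [|lra].
      symmetry. apply Hh with (3 := HE); [lra | minmax].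
    + exists r0. split; auto. apply eq_on_trans with (1 := H0).
      apply regular_ext. intros x Hx. destruct (Rtotal_order x xi0) as [L|[->|L]].
      * rewrite !glue_left by auto. simpl. destruct (Rlt_dec x xi0); [|lra]. rewrite Hu; auto. lra.
      (* At xi0 itself both step functions are 0 by convention, so both glued functions vanish. *)
      * unfold glue, heaviside. rewrite Rminus_diag. destruct (Rlt_dec 0 0); [lra|]. ring.
      * rewrite !glue_right by auto. simpl. destruct (Rlt_dec xi0 x); [|lra]. rewrite Hv; auto. lra.
    + destruct (HX p ltac:(lra)) as [Hr HE]. set (r := fst (X p)) in *.
      exists (Rmin r (p - xi0)). split; [minmax|].
      apply eq_on_trans with (regular (snd (X p))); [apply eq_on_sub with (1 := HE); minmax|].
      apply regular_ext. intros x Hx. assert (xi0 < x) by minmax.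
      rewrite glue_right by auto. simpl. destruct (Rlt_dec xi0 x); [|lra].
      symmetry. apply Hh with (3 := HE); [lra | minmax].
Qed.

Lemma interface_matrix (p : R) (w : C) (am ap : nat -> smoothfun) (A B : nat -> nat -> C)
  (u v : smoothfun) : interface p w am ap A B u v ->
  Mmult (T := C_Ring) (matA w (fun x => Cplus (am 0%nat x) (ap 1%nat x))
    (fun x => Cplus (am 0%nat x) (am 1%nat x)) A B p) (jet u p) =
  Mmult (T := C_Ring) (matB w (fun x => Cplus (am 0%nat x) (ap 1%nat x))
    (fun x => Cplus (ap 0%nat x) (ap 1%nat x)) A B p) (jet v p).
Proof.
  unfold interface. cbv zeta beta. rewrite !Cderive_n_0.
  intros [I0 [I1 [I2 I3]]]. unfold Mmult. apply mk_matrix_ext. intros i j Hi Hj.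
  replace j with 0%nat by lia.
  change (csum (fun l => coeff_mat (zero (G := C_Ring)) (matA w (fun x => Cplus (am 0%nat x) (ap 1%nat x))
    (fun x => Cplus (am 0%nat x) (am 1%nat x)) A B p) i l * coeff_mat (zero (G := C_Ring)) (jet u p) l 0)%C 3 =
    csum (fun l => coeff_mat (zero (G := C_Ring)) (matB w (fun x => Cplus (am 0%nat x) (ap 1%nat x))
    (fun x => Cplus (ap 0%nat x) (ap 1%nat x)) A B p) i l * coeff_mat (zero (G := C_Ring)) (jet v p) l 0)%C 3).
  rewrite !csum_S, !csum_0.
  destruct i as [|[|[|[|i]]]]; [| | | |lia]; unfold matA, matB, jet;
    cbn [coeff_mat coeff_Tn fst snd];
    match goal with |- @eq _ ?x ?y => change (@eq C x y) end.
  - eapply eq_trans; [|eapply eq_trans; [exact I0|]]; ring.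
  - eapply eq_trans; [|eapply eq_trans; [exact I1|]]; ring.
  - eapply eq_trans; [|eapply eq_trans; [exact I2|]]; ring.
  - eapply eq_trans; [|eapply eq_trans; [exact I3|]]; ring.
Qed.

Theorem theorem3p2 (xi0 : R) (w : C)
  (am ap bm bp : nat -> smoothfun) (A B : nat -> nat -> C) :
  let a0 := coefficient xi0 (am 0%nat) (ap 0%nat) 1 (A 0%nat) in
  let a1 := coefficient xi0 (am 1%nat) (ap 1%nat) 1 (A 1%nat) in
  let b0 := coefficient xi0 (bm 0%nat) (bp 0%nat) 3 (B 0%nat) in
  let b1 := coefficient xi0 (bm 1%nat) (bp 1%nat) 3 (B 1%nat) in
  let a := fun x : R => Cplus (am 0%nat x) (ap 1%nat x) in
  let a_minus := fun x : R => Cplus (am 0%nat x) (am 1%nat x) in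
  let a_plus := fun x : R => Cplus (ap 0%nat x) (ap 1%nat x) in
  let b_minus := fun x : R => Cplus (bm 0%nat x) (bm 1%nat x) in
  let b_plus := fun x : R => Cplus (bp 0%nat x) (bp 1%nat x) in
  a xi0 <> RtoC 0 ->
  (forall x : R, a_minus x <> RtoC 0 /\ a_plus x <> RtoC 0) ->
  forall phi : functional,
    is_solution w a0 a1 b0 b1 phi ->
    exists phi1 phi2 : smoothfun,
      (forall psi : testfun, phi psi = regular (glue xi0 phi1 phi2) psi) /\
      (forall x : R, x <= xi0 ->
         classical_ode w a_minus b_minus phi1 x = RtoC 0) /\
      (forall x : R, xi0 <= x ->
         classical_ode w a_plus b_plus phi2 x = RtoC 0) /\
      Mmult (T := C_Ring) (matA w a a_minus A B xi0) (jet phi1 xi0) =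
      Mmult (T := C_Ring) (matB w a a_plus A B xi0) (jet phi2 xi0).
Proof.
  intros a0 a1 b0 b1 a a_minus a_plus b_minus b_plus Ha Hpm phi Hsol.
  set (Z := fun _ : nat => zero_seq).
  assert (LL : forall p, p < xi0 -> local_coefficients p (xi0 - p) am am bm bm Z Z a0 a1 b0 b1)
    by (intros p Hp; repeat split; now apply coefficient_left).
  assert (LR : forall p, xi0 < p -> local_coefficients p (p - xi0) ap ap bp bp Z Z a0 a1 b0 b1)
    by (intros p Hp; repeat split; now apply coefficient_right).
  assert (L0 : forall r, local_coefficients xi0 r am ap bm bp A B a0 a1 b0 b1)
    by (intros r; repeat split; intros psi c d _ _ _; reflexivity).
  destruct (in_A_coefficient phi xi0 (proj1 Hsol)) as [r0 [u0 [v0 [n [c [Hr0 Hphi]]]]]].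
  destruct (local_solution xi0 r0 w am ap bm bp A B a0 a1 b0 b1 phi u0 v0 n c) as [E0 _]; auto.
  destruct (glue_of_local phi xi0 r0 u0 v0 (proj1 Hsol) Hr0 E0) as [phi1 [phi2 E]].
  { intros p N. destruct (Rlt_dec p xi0) as [L|L].
    - apply (solution_smooth_at p (xi0 - p) w am bm a0 a1 b0 b1); auto; [lra | apply Hpm].
    - apply (solution_smooth_at p (p - xi0) w ap bp a0 a1 b0 b1); auto;
        [lra | apply Hpm | apply LR; lra]. }
  exists phi1, phi2.
  assert (EC : phi = coefficient xi0 phi1 phi2 0 zero_seq).
  { apply functional_extensionality. intros psi. rewrite E. symmetry. now apply coefficient_zero_seq. }
  assert (OL : forall x, x < xi0 -> ode_side w am bm phi1 x = RtoC 0).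
  { intros x Hx. set (p := (2 * x + xi0) / 3).
    assert (Hp : p - (xi0 - p) < x < p) by (unfold p; lra).
    destruct (local_odes p (xi0 - p) w am am bm bm Z Z a0 a1 b0 b1 phi phi1 phi1 0 zero_seq)
      as [H _]; auto; try lra.
    - apply LL. lra.
    - rewrite EC. apply coefficient_left. lra. }
  assert (OR : forall x, xi0 < x -> ode_side w ap bp phi2 x = RtoC 0).
  { intros x Hx. set (p := (2 * x + xi0) / 3).
    assert (Hp : p < x < p + (p - xi0)) by (unfold p; lra).
    destruct (local_odes p (p - xi0) w ap ap bp bp Z Z a0 a1 b0 b1 phi phi2 phi2 0 zero_seq)
      as [_ [H _]]; auto; try lra.
    - apply LR. lra.
    - rewrite EC. apply coefficient_right. lra. }
  split; [exact E|split; [|split]].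
  (* The equation reaches the end point xi0 by continuity. *)
  - intros x Hx. change (ode_side w am bm phi1 x = RtoC 0).
    rewrite <- (Cderive_n_0 (ode_side w am bm phi1)).
    apply (Cderive_n_zero_closure _ (x - 1) xi0); auto using ode_side_smooth; [lra | lra |].
    intros y Hy. apply OL. lra.
  - intros x Hx. change (ode_side w ap bp phi2 x = RtoC 0).
    rewrite <- (Cderive_n_0 (ode_side w ap bp phi2)).
    apply (Cderive_n_zero_closure _ xi0 (x + 1)); auto using ode_side_smooth; [lra | lra |].
    intros y Hy. apply OR. lra.
  - apply interface_matrix.
    (* The local analysis is repeated at xi0 with the global functions in place of the germs; the
       radius 1 is arbitrary. *)
    destruct (local_solution xi0 1 w am ap bm bp A B a0 a1 b0 b1 phi phi1 phi2 0 zero_seq)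
      as [_ [_ [_ H]]]; auto; [lra|].
    rewrite EC. intros psi c1 d1 _ _ _. reflexivity.
Qed.
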